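(* Let $\Omega\subset\mathbb C^2$ be a convex domain containing no affine complex lines, with $\mathcal C^1$-smooth boundary, and let $p\in\partial\Omega$. Suppose that $p$ is a strongly non-Goldilocks point and $F_p\ne\{p\}$. Then $p$ is not a visible point. Explicitly, there exists $\lambda>1$ such that $\Omega$ has $(\lambda,0)$-geodesics $\gamma_j:[0,1]\to\Omega$ $(j\in\mathbb N)$ with $\max_{t\in[0,1]}\delta_\Omega(\gamma_j(t))\to0$, $\gamma_j(0)\to p$ and $\gamma_j(1)\not\to p$ as $j\to\infty$.
   Context: For a domain $\Omega\subset\mathbb C^n$, $\Delta$ is the unit disc, $k_\Omega$ is the Kobayashi pseudodistance and $\kappa_\Omega(z;v)=\inf\{1/r: r>0,\ \exists \varphi\in\mathcal O(r\Delta,\Omega),\ \varphi(0)=z,\ \varphi'(0)=v\}$ is the Kobayashi-Royden pseudometric. $\Omega$ is hyperbolic if $k_\Omega$ is a distance (convex domains containing no affine complex lines are hyperbolic). $\delta_\Omega(z)$ is the Euclidean distance from $z$ to $\partial\Omega$. For an absolutely continuous curve $\gamma:I\to\Omega$, $l^\kappa_\Omega(\gamma)=\int_I\kappa_\Omega(\gamma(t);\gamma'(t))\,dt$. For $\lambda\ge1,\epsilon\ge0$, an absolutely continuous $\gamma:[0,1]\to\Omega$ is a $(\lambda,\epsilon)$-geodesic if $l^\kappa_\Omega(\gamma|_{[t_1,t_2]})\le\lambda k_\Omega(\gamma(t_1),\gamma(t_2))+\epsilon$ for all $t_1\le t_2$ in $[0,1]$. For $\Omega$ hyperbolic and distinct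 $p,q\in\partial\Omega$, $\{p,q\}$ is a $(\lambda,\epsilon)$-visible pair if there are neighbourhoods $U_p,U_q$ of $p,q$ and $K\subset\subset\Omega$ such that every $(\lambda,\epsilon)$-geodesic joining a point of $\Omega\cap U_p$ to a point of $\Omega\cap U_q$ meets $K$; it is a visible pair if this holds for all $\lambda\ge1$, $\epsilon\ge0$. A point $p\in\partial\Omega$ is a visible point if $\{p,q\}$ is a visible pair for every $q\in\partial\Omega$, $q\ne p$. A $\mathcal C^1$-smooth boundary point $p\in\partial\Omega$ is weakly Goldilocks if for some $\epsilon>0$ $$\int_0^\epsilon\frac{\sup\{\kappa_\Omega^{-1}(p_{r'};v): v\in\mathbb C^n,\ \|v\|=1,\ r'\le r\}}{r}\,dr<\infty,$$ where $p_r:=p+r\eta_p$ and $\eta_p$ is the inner unit normal to $\partial\Omega$ at $p$. It is strongly non-Goldilocks if it is not weakly Goldilocks. A face of a convex domain $\Omega$ is a set $\partial\Omega\cap H$ with $H$ a complex (affine) hyperplane not intersecting $\Omega$; the multiface $F_p$ of $\Omega$ at $p\in\partial\Omega$ is the union of all faces of $\Omega$ containing $p$. *)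

(* Defs.v *)
From HB Require Import structures.
From mathcomp Require Import all_boot all_order all_algebra.
From mathcomp Require Import all_classical all_reals all_analysis.
From mathcomp Require Import complex.

Set Implicit Arguments.
Unset Strict Implicit.
Unset Printing Implicit Defensive.

Import Order.TTheory GRing.Theory Num.Theory.
Import numFieldNormedType.Exports.

Local Open Scope classical_set_scope.
Local Open Scope ring_scope.
Local Open Scope complex_scope.

(* Packing R[i] as a numClosedFieldType gives it the topology, and the normed
   space structure over itself, that the library attaches to such fields. *)
Definition cplx (R : realType) : numClosedFieldType := R[i].

Definition toC {R : realType} (t : R) : cplx R := t%:C.

(* The norm of the library takes its values in the field itself. *)
Definition modulus {R : realType} (z : cplx R) : R := complex.Re `|z|.

Section Geometry.
Context {R : realType} {n : nat}.
Local Notation C := (cplx R).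
Local Notation Cn := 'rV[cplx R]_n.
Implicit Types (Omega U : set Cn) (p z w v eta : Cn) (rho : Cn -> R).

(* The library norm on row vectors is the maximum norm (with values in C);
   it induces the same topology. *)
Definition enorm v : R :=
  Num.sqrt (\sum_(i < n) (complex.Re (v 0 i) ^+ 2 + complex.Im (v 0 i) ^+ 2)).

Definition domain Omega := [/\ open Omega, Omega !=set0 & connected Omega].

(* The weights of [convex_set] range over the t : C with 0 <= t <= 1 in the
   partial order of C, that is over the real segment [0, 1]. *)
Definition convex_domain Omega :=
  domain Omega /\ @convex_set C Cn Omega.

Definition boundary Omega : set Cn := closure Omega `\` interior Omega.

Definition boundary_dist Omega z : \bar R :=
  ereal_inf [set (enorm (z - w))%:E | w in boundary Omega].

Definition contains_complex_line Omega :=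
  exists z v, v != 0 /\ forall zeta : C, Omega (z + zeta *: v).

Definition rderivable rho z v : Prop :=
  derivable (fun t : R => rho (z + toC t *: v)) 0 1.

Definition rderive rho z v : R :=
  derive1 (fun t : R => rho (z + toC t *: v)) 0.

Definition C1_on U rho := forall v z, U z ->
  rderivable rho z v /\ {for z, continuous (fun w => rderive rho w v)}.

(* The gradient with respect to the 2n real coordinates, where
   R^n + i R^n is identified with C^n. *)
Definition grad rho z : Cn :=
  \row_i ((rderive rho z (delta_mx 0 i)
           +i* rderive rho z (('i : C) *: delta_mx 0 i)) : C).

Definition local_defining_function Omega p U rho :=
  [/\ open U, U p, C1_on U rho, (forall z, U z -> grad rho z != 0)
    & forall z, U z -> (Omega z <-> rho z < 0)].

Definition C1_boundary_point Omega p :=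
  boundary Omega p /\ exists U rho, local_defining_function Omega p U rho.

Definition C1_boundary Omega :=
  forall q, boundary Omega q -> C1_boundary_point Omega q.

(* Does not depend on the choice of the defining function. *)
Definition inner_unit_normal Omega p eta :=
  exists U rho, local_defining_function Omega p U rho /\
    eta = - (toC (enorm (grad rho p))^-1 *: grad rho p).

Definition complex_hyperplane (H : set Cn) :=
  exists (a : Cn) (c : C),
    a != 0 /\ H = [set z | \sum_(i < n) a 0 i * z 0 i = c].

Definition face Omega (F : set Cn) := exists H : set Cn,
  [/\ complex_hyperplane H, H `&` Omega = set0 & F = boundary Omega `&` H].

Definition multiface Omega p : set Cn :=
  \bigcup_(F in [set F | face Omega F /\ F p]) F.

Definition relatively_compact_in Omega (K : set Cn) :=
  compact (closure K) /\ closure K `<=` Omega.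

End Geometry.

Section Kobayashi.
Context {R : realType} {n : nat}.
Local Notation C := (cplx R).
Local Notation Cn := 'rV[cplx R]_n.
Implicit Types (Omega : set Cn) (p q z w v eta : Cn) (gamma : R -> Cn).

Definition disc (r : R) : set C := [set zeta | modulus zeta < r].

(* phi belongs to O(r Delta, Omega); its values off the disc are irrelevant. *)
Definition holo_disc (r : R) Omega (phi : C -> Cn) := forall zeta,
  disc r zeta -> Omega (phi zeta) /\ derivable phi zeta 1.

Definition kobayashi_royden Omega z v : \bar R :=
  ereal_inf [set (r^-1)%:E | r in [set r : R | 0 < r /\
    exists phi, [/\ holo_disc r Omega phi, phi 0 = z & derive1 phi 0 = v]]].

(* Poincare distance from 0 to a point of modulus s in the unit disc; with this
   normalization k_Omega is the integrated form of kobayashi_royden. *)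
Definition artanh (s : R) : R := ln ((1 + s) / (1 - s)) / 2.

Definition lempert Omega z w : \bar R :=
  ereal_inf [set (artanh (modulus alpha))%:E | alpha in [set alpha : C |
    disc 1 alpha /\
    exists phi, [/\ holo_disc 1 Omega phi, phi 0 = z & phi alpha = w]]].

(* The Kobayashi pseudodistance, i.e. the largest pseudodistance not exceeding
   the Lempert function, as an infimum over finite chains of analytic discs. *)
Definition kobayashi Omega z w : \bar R :=
  ereal_inf [set l | exists (m : nat) (x : nat -> Cn),
    [/\ x 0%N = z, x m = w, (forall i, (i <= m)%N -> Omega (x i))
      & l = (\sum_(i < m) lempert Omega (x i) (x i.+1))%E]].

(* The finite families of non-overlapping subintervals [I.1, I.2] are listed
   from left to right. *)
Definition absolutely_continuous (a b : R) gamma :=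
  forall e : R, 0 < e -> exists d : R, 0 < d /\
    forall s : seq (R * R),
      (forall I, I \in s -> [/\ a <= I.1, I.1 <= I.2 & I.2 <= b]) ->
      pairwise (fun I J => I.2 <= J.1) s ->
      \sum_(I <- s) (I.2 - I.1) < d ->
      \sum_(I <- s) enorm (gamma I.2 - gamma I.1) < e.

(* Derivative in the real variable t; it exists for almost every t in [a, b]
   when gamma is absolutely continuous on [a, b]. *)
Definition velocity gamma (t : R) : Cn :=
  \row_i ((derive1 (fun s : R => complex.Re (gamma s 0 i)) t
           +i* derive1 (fun s : R => complex.Im (gamma s 0 i)) t) : C).

Definition kobayashi_length Omega gamma (t1 t2 : R) : \bar R :=
  (\int[lebesgue_measure]_(t in `[t1, t2])
    kobayashi_royden Omega (gamma t) (velocity gamma t))%E.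

Definition almost_geodesic Omega (lambda epsilon : R) gamma :=
  [/\ absolutely_continuous 0 1 gamma,
      (forall t, 0 <= t <= 1 -> Omega (gamma t))
    & forall t1 t2, 0 <= t1 -> t1 <= t2 -> t2 <= 1 ->
      (kobayashi_length Omega gamma t1 t2 <=
         lambda%:E * kobayashi Omega (gamma t1) (gamma t2) + epsilon%:E)%E].

Definition visible_pair_for Omega (lambda epsilon : R) p q :=
  exists Up Uq K : set Cn,
    [/\ nbhs p Up, nbhs q Uq, relatively_compact_in Omega K
      & forall gamma, almost_geodesic Omega lambda epsilon gamma ->
          (Omega `&` Up) (gamma 0) -> (Omega `&` Uq) (gamma 1) ->
          exists t, 0 <= t <= 1 /\ K (gamma t)].

Definition visible_pair Omega p q := forall lambda epsilon : R,
  1 <= lambda -> 0 <= epsilon -> visible_pair_for Omega lambda epsilon p q.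

Definition visible_point Omega p := boundary Omega p /\
  forall q, boundary Omega q -> q != p -> visible_pair Omega p q.

(* The inverse is the one of extended reals, so 0^-1 = +oo and +oo^-1 = 0. *)
Definition goldilocks_sup Omega p eta (r : R) : \bar R :=
  ereal_sup [set l | exists (r' : R) v,
    [/\ 0 < r' <= r, enorm v = 1
      & l = ((kobayashi_royden Omega (p + toC r' *: eta) v)^-1)%E]].

(* epsilon is small enough for p + r eta to stay in Omega, where the
   Kobayashi-Royden pseudometric makes sense. *)
Definition weakly_goldilocks Omega p := C1_boundary_point Omega p /\
  exists (eta : Cn) (epsilon : R),
    [/\ inner_unit_normal Omega p eta, 0 < epsilon,
        (forall r : R, 0 < r <= epsilon -> Omega (p + toC r *: eta))
      & (\int[lebesgue_measure]_(r in `]0%R, epsilon])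
           (goldilocks_sup Omega p eta r * (r^-1)%:E) < +oo)%E].

Definition strongly_non_goldilocks Omega p :=
  C1_boundary_point Omega p /\ ~ weakly_goldilocks Omega p.

End Kobayashi.

(* Main.v *)
(* Write [eta] for the inner normal at [p] and [c] for the complex linear form
   with [c eta = 1] whose real part supports [Omega] at [p].  Since the multiface
   is not [{p}], some boundary point [q != p] has [c (q - p) = 0]; in dimension 2
   the direction [tau = q - p] spans the kernel of [c], and all points
   [p + x tau] with [0 <= x <= 1] lie on the boundary.

   The map [z |-> c (z - p)] sends [Omega] into the right half-plane, so the
   Harnack inequality gives [k_Omega(z, w) >= |log (Re c(z - p) / Re c(w - p))| / 16].
   On the other hand, by convexity a disc through [p + r eta] in direction [tau]
   of size [1 / kappa] can be moved, with comparable size, to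
   [p + r eta + x tau] for [0 <= x <= 1/2].  Hence along a curve
   [p + r eta + x(r) tau] with [|dx/dr|] bounded by a multiple of [1 / (r kappa)]
   the Kobayashi length is at most a multiple of the log-ratio of the radii, and
   the curve is a [(lambda, 0)]-geodesic.  Failure of the Goldilocks integral
   means exactly that, starting at an arbitrarily small radius, such a curve can
   drift by [tau / 2] before [r] reaches [0].

   Discs are only assumed differentiable at every point, so the Cauchy estimate
   behind Harnack's inequality rests on Goursat's theorem for rectangles. *)
Require Import Defs.
From HB Require Import structures.
From mathcomp Require Import all_boot all_order all_algebra.
From mathcomp Require Import all_classical all_reals all_analysis.
From mathcomp Require Import complex measurable_realfun.
From mathcomp Require Import ring lra.
Import Order.TTheory GRing.Theory Num.Theory.
Import numFieldNormedType.Exports.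
Local Open Scope classical_set_scope.
Local Open Scope ring_scope.
Set Implicit Arguments.
Unset Strict Implicit.
Unset Printing Implicit Defensive.

(** * Goursat's theorem on rectangles *)

Section SegmentIntegral.
Context {R : realType}.
Implicit Types (f : R -> R) (a b c : R).

(** With additive error 0 there is no slack: length and distance must be comparable on every
    subinterval. Hence the radius decays exponentially in the parameter: the logarithmic lower bound
    for the distance is then exactly linear, and a constant bound on the speed suffices.

    The Goldilocks supremum runs over all unit directions and all smaller radii, and its regularity
    in the radius is not studied, so it is not integrated to produce the drift. It is sampled at the
    radii [r0 * 2^-k]; a divergent integral becomes a divergent series [b], and each positive term
    yields a single disc, in an uncontrolled direction and at a possibly smaller radius. Trading it
    for a disc along [tau] at the sampled radius costs a fixed factor. The drift is then a finite
    sum of explicit rational profiles, one per level, so that the velocity is known exactly; the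
    delicate point is to bound it independently of the number of levels.

    Upper bounds come from convex combinations and homotheties of discs, lower bounds from
    holomorphic maps into a half-plane. Constants only have to be uniform, so a crude Cauchy
    estimate over squares is enough. *)

Definition seg_int f a b : R := (\int[lebesgue_measure]_(x in `[a, b]) f x)%R.

Definition seg_continuous f a b := forall x0, a <= x0 <= b ->
  forall e : R, 0 < e -> exists2 d : R, 0 < d &
    forall x, a <= x <= b -> `|x - x0| < d -> `|f x - f x0| < e.

Lemma seg_continuous_within f a b :
  seg_continuous f a b -> {within `[a, b], continuous f}.
Proof.
move=> cf; apply/subspace_continuousP => x0; rewrite /= in_itv /= => x0ab.
apply/cvgrPdist_lt => e e0; have [d d0 H] := cf _ x0ab _ e0.
rewrite near_withinE; exists d => //= x; rewrite /= => x0x; rewrite in_itv /= => xab.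
by rewrite distrC; apply: H => //; rewrite distrC.
Qed.

Lemma within_integrable f a b : {within `[a, b], continuous f} ->
  lebesgue_measure.-integrable `[a, b] (EFin \o f).
Proof.
by move=> cf; apply: continuous_compact_integrable => //; exact: segment_compact.
Qed.

Lemma seg_continuousS f a b a' b' : a <= a' -> b' <= b ->
  seg_continuous f a b -> seg_continuous f a' b'.
Proof.
move=> aa' bb' cf x0 /andP[x1 x2] e e0.
have [|d d0 H] := cf x0 _ e e0; first by rewrite (le_trans aa' x1) (le_trans x2).
exists d => // x /andP[y1 y2]; apply: H.
by rewrite (le_trans aa' y1) (le_trans y2).
Qed.

Lemma seg_int_add f a c b : a <= c -> c <= b -> seg_continuous f a b ->
  seg_int f a b = seg_int f a c + seg_int f c b.
Proof.
move=> ac cb cf.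
have intf := within_integrable (seg_continuous_within cf).
rewrite /seg_int -(@Rintegral_itv_obnd_cbnd _ c).
  rewrite -(@Rintegral_itvB _ f (BLeft a) (BRight b) c)// ?bnd_simp//.
  by rewrite addrC subrK.
apply: integrableS intf => //.
by apply: subset_itvr; rewrite bnd_simp.
Qed.

Lemma seg_int_affine a b (k l : R) : a < b ->
  seg_int (fun x => k + l * x) a b = k * (b - a) + l * (b ^+ 2 - a ^+ 2) / 2.
Proof.
move=> ab; pose F (x : R) : R := k * x + l / 2 * x ^+ 2.
have dF (x : R) : is_derive x 1 F (k + l * x).
  by apply: is_derive_eq; rewrite /GRing.scale /=; lra.
have cF : continuous F.
  move=> x; apply: differentiable_continuous; apply/derivable1_diffP.
  exact: ex_derive.
rewrite /seg_int /Rintegral (@continuous_FTC2 _ _ F) //=.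
- by rewrite /F; field.
- apply: continuous_subspaceT => x; apply: differentiable_continuous.
  by apply/derivable1_diffP; exact: ex_derive.
- split.
  + by move=> x _; exact: ex_derive.
  + exact/cvg_at_right_filter/cF.
  + exact/cvg_at_left_filter/cF.
- by move=> x _; rewrite derive1E; exact: derive_val.
Qed.

(** Moving [e] into the constant term keeps the comparison functions affine, so monotonicity of the
    integral suffices. *)
Lemma seg_int_approx f a b (k l e : R) : a < b -> seg_continuous f a b ->
  (forall x, a <= x <= b -> `|f x - (k + l * x)| <= e) ->
  `|seg_int f a b - (k * (b - a) + l * (b ^+ 2 - a ^+ 2) / 2)| <= e * (b - a).
Proof.
move=> ab cf H; rewrite -seg_int_affine//.
have intf := within_integrable (seg_continuous_within cf).
have caff (u v : R) : lebesgue_measure.-integrable `[a, b]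
    (EFin \o (fun x => u + v * x)).
  apply: within_integrable; apply: continuous_subspaceT => x.
  by apply: differentiable_continuous; apply/derivable1_diffP.
rewrite ler_distl /seg_int; apply/andP; split.
- rewrite -[leLHS]/(seg_int _ _ _ - _).
  have -> : seg_int (fun x => k + l * x) a b - e * (b - a) =
      seg_int (fun x => (k - e) + l * x) a b by rewrite !seg_int_affine//; ring.
  apply: le_Rintegral => //= x; rewrite in_itv /= => /H.
  by rewrite ler_distl => /andP[+ _]; lra.
- rewrite -[leRHS]/(seg_int _ _ _ + _).
  have -> : seg_int (fun x => k + l * x) a b + e * (b - a) =
      seg_int (fun x => (k + e) + l * x) a b by rewrite !seg_int_affine//; ring.
  apply: le_Rintegral => //= x; rewrite in_itv /= => /H.
  by rewrite ler_distl => /andP[_ +]; lra.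
Qed.

End SegmentIntegral.

(** * Bisection of rectangles *)

Section Bisection.
Context {R : realType}.

Lemma nested_segments (x w : nat -> R) :
  (forall n, x n <= x n.+1) -> (forall n, x n.+1 + w n.+1 <= x n + w n) ->
  (forall n, 0 <= w n) -> exists z, forall n, x n <= z <= x n + w n.
Proof.
move=> hx hw w0.
have mx m k : x m <= x (m + k)%N.
  by elim: k => [|k IH]; rewrite ?addn0 // addnS; apply: (le_trans IH).
have mw m k : x (m + k)%N + w (m + k)%N <= x m + w m.
  by elim: k => [|k IH]; rewrite ?addn0 // addnS; apply: (le_trans (hw _)).
have H m n : x m <= x n + w n.
  have [mn|/ltnW nm] := leqP m n.
    by have := mx m (n - m)%N; rewrite subnKC // => /le_trans; apply; rewrite lerDl.
  by have := mw n (m - n)%N; rewrite subnKC //; apply: le_trans; rewrite lerDl.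
have ne : range x !=set0 by exists (x 0%N), 0%N.
exists (sup (range x)) => n; apply/andP; split.
  apply: ub_le_sup; last by exists n.
  by exists (x 0%N + w 0%N) => _ [m _ <-].
by apply: ge_sup => // _ [m _ <-].
Qed.

(** Contrapositive of quartering: a bad rectangle has a bad quarter, and nested bad quarters shrink
    to a point, where the local hypothesis fails. All quarters keep the proportions [w0 : h0], so
    the local hypothesis only concerns rectangles of that shape. *)
Lemma rectangle_bisection (Good : R -> R -> R -> R -> Prop) (x0 y0 w0 h0 : R) :
  0 < w0 -> 0 < h0 ->
  (forall x y w h, 0 < w -> 0 < h -> x0 <= x -> x + w <= x0 + w0 ->
     y0 <= y -> y + h <= y0 + h0 ->
     Good x y (w / 2) (h / 2) -> Good (x + w / 2) y (w / 2) (h / 2) ->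
     Good x (y + h / 2) (w / 2) (h / 2) ->
     Good (x + w / 2) (y + h / 2) (w / 2) (h / 2) -> Good x y w h) ->
  (forall xs ys, x0 <= xs <= x0 + w0 -> y0 <= ys <= y0 + h0 ->
     exists2 d : R, 0 < d & forall x y s, 0 < s -> s < d ->
       x0 <= x -> x + s * w0 <= x0 + w0 -> y0 <= y -> y + s * h0 <= y0 + h0 ->
       x <= xs <= x + s * w0 -> y <= ys <= y + s * h0 ->
       Good x y (s * w0) (s * h0)) ->
  Good x0 y0 w0 h0.
Proof.
move=> w0_gt0 h0_gt0 split4 loc; apply: contrapT => bad0.
pose In n (p : R * R) := [/\ x0 <= p.1, p.1 + 2^-1 ^+ n * w0 <= x0 + w0,
  y0 <= p.2 & p.2 + 2^-1 ^+ n * h0 <= y0 + h0].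
pose Bad n (p : R * R) := In n p /\
  ~ Good p.1 p.2 (2^-1 ^+ n * w0) (2^-1 ^+ n * h0).
pose Sub n (p q : R * R) := [/\ p.1 <= q.1,
  q.1 + 2^-1 ^+ n.+1 * w0 <= p.1 + 2^-1 ^+ n * w0, p.2 <= q.2 &
  q.2 + 2^-1 ^+ n.+1 * h0 <= p.2 + 2^-1 ^+ n * h0].
have gt0 n : 0 < 2^-1 ^+ n :> R by rewrite exprn_gt0.
(* The badness of the given rectangle sits inside the existential, so that [choice] returns a total
   function that can be iterated. *)
have step np : exists q, Bad np.1 np.2 -> Bad np.1.+1 q /\ Sub np.1 np.2 q.
  case: np => n [x y] /=; apply: contrapT => /forallNP nq.
  have [[[/= i1 i2 i3 i4] ng] _] : Bad n (x, y) /\ True.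
    (* The point is arbitrary: a failing implication yields its premise. *)
    by have /not_implyP [? _] := nq (0, 0).
  set w := 2^-1 ^+ n * w0 in i2 ng; set h := 2^-1 ^+ n * h0 in i4 ng.
  have wE : 2^-1 ^+ n.+1 * w0 = w / 2 by rewrite exprS /w; ring.
  have hE : 2^-1 ^+ n.+1 * h0 = h / 2 by rewrite exprS /h; ring.
  have wp : 0 < w by rewrite mulr_gt0.
  have hp : 0 < h by rewrite mulr_gt0.
  have G x' y' : (x' = x \/ x' = x + w / 2) -> (y' = y \/ y' = y + h / 2) ->
      Good x' y' (w / 2) (h / 2).
    move=> ex ey; apply: contrapT => ng'; apply: (nq (x', y')) => _.
    rewrite /Bad /In /Sub /= wE hE -/w -/h.
    have [hx1 hx2] : x <= x' /\ x' <= x + w / 2 by case: ex => ->; split; lra.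
    have [hy1 hy2] : y <= y' /\ y' <= y + h / 2 by case: ey => ->; split; lra.
    by split; [split; [split|]|split] => //; lra.
  by apply: ng; apply: split4 => //; apply: G; intuition.
have [nxt Hnxt] := choice step.
pose u n : nat * (R * R) := iter n (fun np => (np.1.+1, nxt np)) (0%N, (x0, y0)).
have u1 n : (u n).1 = n by elim: n => //= n ->.
have uB n : Bad n (u n).2.
  elim: n => [|n IH] /=.
    by rewrite /Bad /In /= expr0 !mul1r; split.
  by have := Hnxt (u n); rewrite u1 => /(_ IH) [].
have uS n : Sub n (u n).2 (u n.+1).2.
  by have := Hnxt (u n); rewrite u1 => /(_ (uB n)) [].
have [||| xs Hxs] := @nested_segments (fun n => (u n).2.1) (fun n => 2^-1 ^+ n * w0).
- by move=> n; case: (uS n).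
- by move=> n; case: (uS n).
- by move=> n; rewrite mulr_ge0 // ltW.
have [||| ys Hys] := @nested_segments (fun n => (u n).2.2) (fun n => 2^-1 ^+ n * h0).
- by move=> n; case: (uS n).
- by move=> n; case: (uS n).
- by move=> n; rewrite mulr_ge0 // ltW.
have [||d d0 Hd] := loc xs ys.
- by have := Hxs 0%N; rewrite /= expr0 mul1r.
- by have := Hys 0%N; rewrite /= expr0 mul1r.
have [n nd] : exists n, 2^-1 ^+ n < d.
  have : (2^-1 : R) ^+ n @[n --> \oo] --> 0.
    by apply: cvg_expr; rewrite ger0_norm // invf_lt1 // ltr1n.
  move=> /cvgrPdist_lt /(_ _ d0) [N _ HN]; exists N.
  by have := HN N (leqnn N); rewrite /= sub0r normrN ger0_norm ?ltW.
have [[i1 i2 i3 i4] ng] := uB n.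
by apply: ng; apply: Hd.
Qed.

End Bisection.

(** * Closed forms have zero integral around rectangles *)

Section Goursat.
Context {R : realType}.
Implicit Types (P Q : R -> R -> R).

(** The contour integral of [P dx + Q dy] around the rectangle, counterclockwise. *)
Definition rect_int P Q (a b c d : R) : R :=
  seg_int (P ^~ c) a b - seg_int (P ^~ d) a b
  + seg_int (Q b) c d - seg_int (Q a) c d.

(* [P dx + Q dy] is closed in the pointwise sense: both functions are
   differentiable at every point and the mixed partial derivatives agree. *)
Definition closed_form P Q (a b c d : R) :=
  forall x0 y0, a <= x0 <= b -> c <= y0 <= d -> exists A B D : R,
    forall e : R, 0 < e -> exists2 r : R, 0 < r &
      forall x y, a <= x <= b -> c <= y <= d -> `|x - x0| < r -> `|y - y0| < r ->
        `|P x y - P x0 y0 - A * (x - x0) - B * (y - y0)|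
           <= e * (`|x - x0| + `|y - y0|) /\
        `|Q x y - Q x0 y0 - B * (x - x0) - D * (y - y0)|
           <= e * (`|x - x0| + `|y - y0|).

Lemma affine_bound_lt (z A B e s t k : R) : 0 < e -> 0 <= s -> 0 <= t ->
  `|z - A - B| <= e * (s + t) -> `|A| <= k * s -> `|B| <= k * t ->
  `|z| <= (e + k) * (s + t).
Proof.
move=> e0 s0 t0 H HA HB.
have -> : z = (z - A - B) + A + B by ring.
apply: (le_trans (ler_normD _ _)).
have := ler_normD (z - A - B) A.
nra.
Qed.

Lemma closed_form_cvg P Q a b c d x0 y0 : closed_form P Q a b c d ->
  a <= x0 <= b -> c <= y0 <= d -> forall e : R, 0 < e -> exists2 r : R, 0 < r &
    forall x y, a <= x <= b -> c <= y <= d -> `|x - x0| < r -> `|y - y0| < r ->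
      `|P x y - P x0 y0| < e /\ `|Q x y - Q x0 y0| < e.
Proof.
move=> cf hx hy e e0; have [A [B [D H]]] := cf _ _ hx hy.
have [r r0 Hr] := H 1 ltr01.
pose k := `|A| + `|B| + `|D|.
have k0 : 0 <= k by rewrite /k; have := normr_ge0 A; have := normr_ge0 B;
  have := normr_ge0 D; lra.
pose r' := Order.min r (e / (4 * (1 + k))).
have r'0 : 0 < r' by rewrite lt_min r0 divr_gt0 //; lra.
exists r' => // x y hx' hy'; rewrite !lt_min => /andP[xr xe] /andP[yr ye].
have [HP HQ] := Hr x y hx' hy' xr yr.
set s := `|x - x0| in xe xr HP HQ; set t := `|y - y0| in ye yr HP HQ.
have s0 : 0 <= s by exact: normr_ge0.
have t0 : 0 <= t by exact: normr_ge0.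
have small : (1 + k) * (s + t) < e.
  move: xe ye; rewrite !ltr_pdivlMr; [|lra..]; nra.
have nA := normr_ge0 A; have nB := normr_ge0 B; have nD := normr_ge0 D.
split; apply: le_lt_trans small.
- apply: (@affine_bound_lt _ _ _ 1 s t k ltr01 s0 t0 HP);
  rewrite normrM -?/s -?/t ler_wpM2r // /k; lra.
- apply: (@affine_bound_lt _ _ _ 1 s t k ltr01 s0 t0 HQ);
  rewrite normrM -?/s -?/t ler_wpM2r // /k; lra.
Qed.

Lemma closed_form_continuous P Q a b c d : closed_form P Q a b c d ->
  (forall y, c <= y <= d ->
     seg_continuous (P ^~ y) a b) /\
  (forall x, a <= x <= b -> seg_continuous (Q x) c d).
Proof.
move=> cf; split=> [y hy x0 hx|x hx y0 hy] e e0.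
  have [r r0 H] := closed_form_cvg cf hx hy e0; exists r => // x hx' xr.
  by case: (H x y) => //; rewrite subrr normr0.
have [r r0 H] := closed_form_cvg cf hx hy e0; exists r => // y hy' yr.
by case: (H x y) => //; rewrite subrr normr0.
Qed.

Lemma closed_formS P Q a b c d a' b' c' d' : a <= a' -> b' <= b -> c <= c' ->
  d' <= d -> closed_form P Q a b c d -> closed_form P Q a' b' c' d'.
Proof.
move=> aa bb cc dd cf x0 y0 /andP[x1 x2] /andP[y1 y2].
have [||A [B [D H]]] := cf x0 y0; [by apply/andP; split; lra..|].
exists A, B, D => e e0; have [r r0 Hr] := H _ e0; exists r => // x y.
by move=> /andP[x3 x4] /andP[y3 y4]; apply: Hr; apply/andP; split; lra.
Qed.

Lemma rect_int_split4 P Q a m b c k d : a <= m <= b -> c <= k <= d ->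
  closed_form P Q a b c d ->
  rect_int P Q a b c d = rect_int P Q a m c k + rect_int P Q m b c k
    + rect_int P Q a m k d + rect_int P Q m b k d.
Proof.
move=> /andP[am mb] /andP[ck kd] /closed_form_continuous [cP cQ].
have ab := le_trans am mb; have cd := le_trans ck kd.
rewrite /rect_int (seg_int_add am mb (cP c _)) ?lexx //.
rewrite (seg_int_add am mb (cP d _)) ?lexx ?cd //.
rewrite (seg_int_add ck kd (cQ a _)) ?lexx //.
rewrite (seg_int_add ck kd (cQ b _)) ?lexx ?ab //.
ring.
Qed.

(** The affine part contributes nothing because the same [B] occurs in both expansions. The
    remainder is at most [e] times the half perimeter, and it is integrated along the full
    perimeter. *)
Lemma rect_int_local P Q a b c d x0 y0 (A B D e : R) : a < b -> c < d ->
  a <= x0 <= b -> c <= y0 <= d -> closed_form P Q a b c d -> 0 < e ->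
  (forall x y, a <= x <= b -> c <= y <= d ->
     `|P x y - P x0 y0 - A * (x - x0) - B * (y - y0)|
        <= e * (`|x - x0| + `|y - y0|) /\
     `|Q x y - Q x0 y0 - B * (x - x0) - D * (y - y0)|
        <= e * (`|x - x0| + `|y - y0|)) ->
  `|rect_int P Q a b c d| <= 2 * e * (b - a + (d - c)) ^+ 2.
Proof.
move=> ab cd /andP[x1 x2] /andP[y1 y2] cf e0 H.
have [cP cQ] := closed_form_continuous cf.
set E := e * (b - a + (d - c)).
have bnd x y : a <= x <= b -> c <= y <= d ->
    e * (`|x - x0| + `|y - y0|) <= E.
  move=> /andP[x3 x4] /andP[y3 y4]; rewrite /E ler_pM2l // lerD // ler_norml;
  by apply/andP; split; lra.
have hP y : c <= y <= d -> `|seg_int (P ^~ y) a b -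
    ((P x0 y0 - A * x0 + B * (y - y0)) * (b - a) + A * (b ^+ 2 - a ^+ 2) / 2)|
    <= E * (b - a).
  move=> hy; apply: seg_int_approx => //; first exact: cP.
  move=> x hx; have [+ _] := H x y hx hy => /le_trans /(_ (bnd _ _ hx hy)).
  by congr (`|_| <= _); ring.
have hQ x : a <= x <= b -> `|seg_int (Q x) c d -
    ((Q x0 y0 - D * y0 + B * (x - x0)) * (d - c) + D * (d ^+ 2 - c ^+ 2) / 2)|
    <= E * (d - c).
  move=> hx; apply: seg_int_approx => //; first exact: cQ.
  move=> y hy; have [_ +] := H x y hx hy => /le_trans /(_ (bnd _ _ hx hy)).
  by congr (`|_| <= _); ring.
have := hP c; have := hP d; have := hQ a; have := hQ b.
rewrite !lexx (ltW ab) (ltW cd) => /(_ isT) + /(_ isT) + /(_ isT) + /(_ isT).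
rewrite !ler_norml => /andP[q1 q2] /andP[q3 q4] /andP[p1 p2] /andP[p3 p4].
have -> : 2 * e * (b - a + (d - c)) ^+ 2 = 2 * (E * (b - a)) + 2 * (E * (d - c)).
  by rewrite /E; ring.
rewrite /rect_int.
move: p1 p2 p3 p4 q1 q2 q3 q4.
set i1 := seg_int _ _ _; set i2 := seg_int _ _ _; set i3 := seg_int _ _ _.
set i4 := seg_int _ _ _; set E1 := E * _; set E2 := E * _.
move=> *; apply/andP; split; lra.
Qed.

Lemma goursat_rectangle P Q a b c d : a < b -> c < d ->
  closed_form P Q a b c d -> rect_int P Q a b c d = 0.
Proof.
move=> ab cd cf; apply/eqP; rewrite -normr_le0; apply/ler_addgt0Pl => e e0.
rewrite addr0.
pose w0 := b - a; pose h0 := d - c.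
have w0p : 0 < w0 by rewrite subr_gt0.
have h0p : 0 < h0 by rewrite subr_gt0.
(* A bound proportional to the area adds up exactly over the four quarters. *)
pose e' := e / (w0 * h0).
have e'0 : 0 < e' by rewrite divr_gt0 // mulr_gt0.
suff : `|rect_int P Q a (a + w0) c (c + h0)| <= e' * (w0 * h0).
  by rewrite /w0 /h0 !(addrC _ (_ - _)) !subrK /e' divfK // mulf_neq0 ?gt_eqF.
apply: (@rectangle_bisection R (fun x y w h =>
  `|rect_int P Q x (x + w) y (y + h)| <= e' * (w * h)) a c w0 h0) => //.
  move=> x y w h wp hp x1 x2 y1 y2 g1 g2 g3 g4.
  have bE : a + w0 = b by rewrite /w0; ring.
  have dE : c + h0 = d by rewrite /h0; ring.
  have := @rect_int_split4 P Q x (x + w / 2) (x + w) y (y + h / 2) (y + h).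
  have -> : x + w = x + w / 2 + w / 2 by field.
  have -> : y + h = y + h / 2 + h / 2 by field.
  move=> ->; [|apply/andP; split; lra|apply/andP; split; lra|].
    apply: (le_trans (ler_normD _ _)).
    set r4 := `|rect_int _ _ (_ + _) _ (_ + _) _| in g4 *.
    have := ler_normD (rect_int P Q x (x + w / 2) y (y + h / 2)
      + rect_int P Q (x + w / 2) (x + w / 2 + w / 2) y (y + h / 2))
      (rect_int P Q x (x + w / 2) (y + h / 2) (y + h / 2 + h / 2)).
    have := ler_normD (rect_int P Q x (x + w / 2) y (y + h / 2))
      (rect_int P Q (x + w / 2) (x + w / 2 + w / 2) y (y + h / 2)).
    lra.
  by apply: closed_formS cf; lra.
move=> xs ys; rewrite /w0 /h0 !(addrC _ (_ - _)) !subrK => hx hy.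
have [A [B [D H]]] := cf xs ys hx hy.
(* With tolerance [e' * (w0 * h0) / k], the bound of [rect_int_local] on a rectangle of sides
   [s * w0] and [s * h0] is exactly [e'] times its area. *)
pose k := 2 * (w0 + h0) ^+ 2.
have k0 : 0 < k by rewrite /k mulr_gt0 // exprn_gt0 // addr_gt0.
have [r r0 Hr] := H (e' * (w0 * h0) / k) (divr_gt0 (mulr_gt0 e'0 (mulr_gt0 w0p h0p)) k0).
exists (r / (w0 + h0)); first by rewrite divr_gt0 // addr_gt0.
move=> x y s s0 sr x1 x2 y1 y2 hxs hys.
rewrite -/w0 -/h0 in x2 y2 hxs hys *.
have srw : s * w0 + s * h0 < r.
  have wh : 0 < w0 + h0 by exact: addr_gt0.
  by have := sr; rewrite (ltr_pdivlMr _ _ wh) mulrDr.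
have sw : 0 < s * w0 by rewrite mulr_gt0.
have sh : 0 < s * h0 by rewrite mulr_gt0.
have := @rect_int_local P Q x (x + s * w0) y (y + s * h0) xs ys A B D
  (e' * (w0 * h0) / k).
have -> : 2 * (e' * (w0 * h0) / k) * (x + s * w0 - x + (y + s * h0 - y)) ^+ 2
  = e' * (s * w0 * (s * h0)).
  rewrite /k; field; rewrite gt_eqF // addr_gt0 //.
apply => //; [lra|lra| | |].
- by apply: closed_formS cf; lra.
- by rewrite divr_gt0 // mulr_gt0 // mulr_gt0.
move: hxs hys => /andP[? ?] /andP[? ?] x' y' /andP[? ?] /andP[? ?].
by apply: Hr; rewrite ?ltr_norml; apply/andP; split; lra.
Qed.

End Goursat.

(** * The real-valued modulus and complex arithmetic by components *)

Section ComplexModulus.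
Context {R : realType}.
Implicit Types (z w : cplx R) (t : R).

Lemma normC_modulus z : `|z| = toC (modulus z).
Proof. by rewrite /modulus /toC normc_def. Qed.

Lemma modulusE z : modulus z = Num.sqrt (complex.Re z ^+ 2 + complex.Im z ^+ 2).
Proof. by rewrite /modulus normc_def. Qed.

Lemma toC_inj : injective (@toC R).
Proof. by move=> x y []. Qed.

Lemma modulus_ge0 z : 0 <= modulus z.
Proof. by rewrite modulusE sqrtr_ge0. Qed.

Lemma modulusM z w : modulus (z * w) = modulus z * modulus w.
Proof.
apply: toC_inj; rewrite -normC_modulus normrM !normC_modulus /toC.
by rewrite -[RHS]/((_)%:C%C) rmorphM.
Qed.

Lemma modulusN z : modulus (- z) = modulus z.
Proof. by rewrite /modulus normrN. Qed.

Lemma modulusB z w : modulus (z - w) = modulus (w - z).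
Proof. by rewrite -modulusN opprB. Qed.

Lemma modulusV z : modulus z^-1 = (modulus z)^-1.
Proof.
apply: toC_inj; rewrite -normC_modulus normfV normC_modulus /toC.
by rewrite -[RHS]/((_)%:C%C) fmorphV.
Qed.

Lemma ler_modulusD z w : modulus (z + w) <= modulus z + modulus w.
Proof.
have := ler_normD z w; rewrite !normC_modulus /toC -rmorphD /=.
by rewrite lecR.
Qed.

Lemma modulus_toC t : modulus (toC t) = `|t|.
Proof. by rewrite modulusE /toC /= expr0n addr0 sqrtr_sqr. Qed.

Lemma modulus0 : modulus (0 : cplx R) = 0.
Proof. by rewrite /modulus normr0. Qed.

Lemma modulus1 : modulus (1 : cplx R) = 1.
Proof. by rewrite /modulus normr1. Qed.

Lemma modulus_eq0 z : (modulus z == 0) = (z == 0).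
Proof.
apply/eqP/eqP => [h|->]; last exact: modulus0.
by apply/normr0_eq0; rewrite normC_modulus h.
Qed.

Lemma modulus_gt0 z : (0 < modulus z) = (z != 0).
Proof. by rewrite lt_neqAle modulus_ge0 andbT eq_sym modulus_eq0. Qed.

Lemma sqr_modulus z : modulus z ^+ 2 = complex.Re z ^+ 2 + complex.Im z ^+ 2.
Proof. by rewrite modulusE sqr_sqrtr // addr_ge0 // sqr_ge0. Qed.

Lemma normr_Re_le z : `|complex.Re z| <= modulus z.
Proof.
by rewrite modulusE -sqrtr_sqr ler_wsqrtr // lerDl sqr_ge0.
Qed.

Lemma normr_Im_le z : `|complex.Im z| <= modulus z.
Proof.
by rewrite modulusE -sqrtr_sqr ler_wsqrtr // lerDr sqr_ge0.
Qed.

Lemma modulus_le_ReIm z : modulus z <= `|complex.Re z| + `|complex.Im z|.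
Proof.
have hr := normr_ge0 (complex.Re z); have hi := normr_ge0 (complex.Im z).
rewrite -(@ler_pXn2r _ 2) ?nnegrE ?modulus_ge0 ?addr_ge0 // sqr_modulus.
by rewrite -(real_normK (num_real (complex.Re z))) -(real_normK (num_real (complex.Im z))); nra.
Qed.

Lemma cReD z w : complex.Re (z + w) = complex.Re z + complex.Re w.
Proof. by case: z w => [a b] [c d]. Qed.
Lemma cImD z w : complex.Im (z + w) = complex.Im z + complex.Im w.
Proof. by case: z w => [a b] [c d]. Qed.
Lemma cReN z : complex.Re (- z) = - complex.Re z.
Proof. by case: z. Qed.
Lemma cImN z : complex.Im (- z) = - complex.Im z.
Proof. by case: z. Qed.
Lemma cReB z w : complex.Re (z - w) = complex.Re z - complex.Re w.
Proof. by rewrite cReD cReN. Qed.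
Lemma cImB z w : complex.Im (z - w) = complex.Im z - complex.Im w.
Proof. by rewrite cImD cImN. Qed.
Lemma cReM z w : complex.Re (z * w) =
  complex.Re z * complex.Re w - complex.Im z * complex.Im w.
Proof. by case: z w => [a b] [c d]. Qed.
Lemma cImM z w : complex.Im (z * w) =
  complex.Re z * complex.Im w + complex.Im z * complex.Re w.
Proof. by case: z w => [a b] [c d] /=; rewrite addrC. Qed.
Lemma cReZ t z : complex.Re (toC t * z) = t * complex.Re z.
Proof. by rewrite cReM /= mul0r subr0. Qed.
Lemma cImZ t z : complex.Im (toC t * z) = t * complex.Im z.
Proof. by rewrite cImM /= mul0r addr0. Qed.
Lemma complex_eqP z w : complex.Re z = complex.Re w ->
  complex.Im z = complex.Im w -> z = w.
Proof. by case: z w => [a b] [c d] /= -> ->. Qed.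

Lemma toC_gt0 t : (0 < toC t :> cplx R) = (0 < t).
Proof. by rewrite /toC (ltcR 0 t). Qed.

Lemma gt0_toC (e : cplx R) : 0 < e -> exists2 t : R, 0 < t & e = toC t.
Proof.
case: e => a b; rewrite ltcE /= => /andP[/eqP -> a0].
by exists a.
Qed.

Lemma ltr_norm_toC z t : (`|z| < toC t) = (modulus z < t).
Proof. by rewrite normC_modulus /toC ltcR. Qed.

End ComplexModulus.

(** * Complex differentiability as a first-order expansion *)

Section ComplexDerivative.
Context {R : realType}.
Local Notation C := (cplx R).
Implicit Types (g : C -> C) (z d : C).

Definition cderiv g z d := forall e : R, 0 < e -> exists2 r : R, 0 < r &
  forall w, modulus (w - z) < r ->
    modulus (g w - g z - d * (w - z)) <= e * modulus (w - z).

Lemma is_derive_cderiv g z d : is_derive z 1 g d -> cderiv g z d.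
Proof.
move=> [dg <-] e e0.
have := dg; rewrite /derivable => /cvgrPdist_lt /(_ (toC e)).
rewrite toC_gt0 => /(_ e0); rewrite -[lim _]/('D_1 g z) => -[r0 r0p H].
have [r rp rE] := gt0_toC r0p; exists r => // w wz.
have [->|wz0] := eqVneq w z.
  by rewrite !subrr mulr0 subr0 modulus0 mulr0.
have wz1 : w - z != 0 by rewrite subr_eq0.
have := H (w - z); rewrite /ball_ /= sub0r normrN rE ltr_norm_toC => /(_ wz wz1).
rewrite /GRing.scale /= mulr1 subrK ltr_norm_toC => /ltW.
rewrite -(ler_pM2r (_ : 0 < modulus (w - z))) ?modulus_gt0 // -modulusM.
rewrite -modulusN; congr (modulus _ <= _).
by field.
Qed.

Lemma derivable_cderiv g z : derivable g z 1 -> cderiv g z ('D_1 g z).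
Proof. by move=> dg; apply: is_derive_cderiv; exact: DeriveDef. Qed.

End ComplexDerivative.

Lemma derivable_divX2 (K : numFieldType) (g : K -> K) (a z : K) :
  derivable g z 1 -> z != 0 -> derivable (fun w => a * g w / w ^+ 2) z 1.
Proof.
move=> dg z0; apply: derivableM; first by apply: derivableM.
apply: derivableV; first by rewrite expf_neq0.
exact: exprn_derivable.
Qed.

(** * Cauchy's estimate and Harnack's inequality *)

Section CauchyEstimate.
Context {R : realType}.
Local Notation C := (cplx R).
Implicit Types (g h : C -> C) (z : C).

Lemma seg_int_le (f : R -> R) a b k : a < b -> seg_continuous f a b ->
  (forall x, a <= x <= b -> f x <= k) -> seg_int f a b <= k * (b - a).
Proof.
move=> ab cf H.
have -> : k * (b - a) = seg_int (fun x => k + 0 * x) a b.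
  by rewrite seg_int_affine // !mul0r addr0.
apply: le_Rintegral => //.
- exact: within_integrable (seg_continuous_within cf).
- apply: within_integrable; apply: continuous_subspaceT => x.
  by apply: differentiable_continuous; apply/derivable1_diffP.
- by move=> x; rewrite /= in_itv /= mul0r addr0; exact: H.
Qed.

Lemma seg_int_ge (f : R -> R) a b k : a < b -> seg_continuous f a b ->
  (forall x, a <= x <= b -> k <= f x) -> k * (b - a) <= seg_int f a b.
Proof.
move=> ab cf H.
have -> : k * (b - a) = seg_int (fun x => k + 0 * x) a b.
  by rewrite seg_int_affine // !mul0r addr0.
apply: le_Rintegral => //.
- apply: within_integrable; apply: continuous_subspaceT => x.
  by apply: differentiable_continuous; apply/derivable1_diffP.
- exact: within_integrable (seg_continuous_within cf).
- by move=> x; rewrite /= in_itv /= mul0r addr0; exact: H.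
Qed.

(* [Re (h dz) = Re h dx - Im h dy]. *)
Definition dx_part h (x y : R) : R := complex.Re (h (x +i* y)%C).
Definition dy_part h (x y : R) : R := - complex.Im (h (x +i* y)%C).

(** These are the Cauchy-Riemann equations: for [h' = A + i B], the real part has differential
    [A dx - B dy] and minus the imaginary part has [- B dx - A dy], with equal mixed
    coefficients. *)
Lemma cderiv_closed_form h a b c d :
  (forall x y, a <= x <= b -> c <= y <= d -> exists l, cderiv h (x +i* y)%C l) ->
  closed_form (dx_part h) (dy_part h) a b c d.
Proof.
move=> H x0 y0 hx hy; have [[A B] Hl] := H _ _ hx hy.
exists A, (- B), (- A) => e e0; have [r r0 Hr] := Hl _ e0.
exists (r / 2); first by rewrite divr_gt0.
move=> x y _ _ xr yr.
set w : C := (x +i* y)%C; set z : C := (x0 +i* y0)%C in Hr.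
have wzE : w - z = ((x - x0) +i* (y - y0))%C :> C by [].
have wz : modulus (w - z) <= `|x - x0| + `|y - y0|.
  by rewrite wzE; apply: le_trans (modulus_le_ReIm _) _.
have /Hr hb : modulus (w - z) < r by lra.
have : e * modulus (w - z) <= e * (`|x - x0| + `|y - y0|) by rewrite ler_pM2l.
move=> /(le_trans hb) {}hb; split.
- apply: le_trans (le_trans (normr_Re_le _) hb).
  rewrite /dx_part -/w -/z !cReB cReM wzE /= le_eqVlt; apply/orP; left.
  by apply/eqP; congr `|_|; ring.
- apply: le_trans (le_trans (normr_Im_le _) hb).
  rewrite /dy_part -/w -/z !cImB cImM wzE /= le_eqVlt; apply/orP; left.
  by rewrite -normrN; apply/eqP; congr `|_|; ring.
Qed.

(** The region between the squares is cut into full-width strips below and above and two side pieces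
    of height [2 * s]; Goursat's theorem applies to each of the four. *)
Lemma square_int_annulus h (s S : R) : 0 < s -> s < S ->
  (forall x y : R, `|x| <= S -> `|y| <= S -> s <= `|x| \/ s <= `|y| ->
     exists l, cderiv h (x +i* y)%C l) ->
  rect_int (dx_part h) (dy_part h) (- S) S (- S) S =
  rect_int (dx_part h) (dy_part h) (- s) s (- s) s.
Proof.
move=> s0 sS H.
have strip (a b c d : R) : - S <= a -> b <= S -> - S <= c -> d <= S ->
    (b <= - s) \/ (s <= a) \/ (d <= - s) \/ (s <= c) ->
    closed_form (dx_part h) (dy_part h) a b c d.
  move=> h1 h2 h3 h4 h5; apply: cderiv_closed_form => x y /andP[x1 x2] /andP[y1 y2].
  apply: H; rewrite ?ler_norml; [by apply/andP; split; lra..|].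
  case: h5 => [h5|[h5|[h5|h5]]].
  - by left; rewrite ler_normr; apply/orP; right; lra.
  - by left; rewrite ler_normr; apply/orP; left; lra.
  - by right; rewrite ler_normr; apply/orP; right; lra.
  - by right; rewrite ler_normr; apply/orP; left; lra.
have SS : - S < S by lra.
have ss : - s < s by lra.
have Ss : - S < - s by lra.
have lSS : - S <= - S by [].
have uSS : S <= S by [].
have sS' := ltW sS; have Ss' := ltW Ss.
have sS2 : s <= S by [].
have sS3 : - S <= s by lra.
have sS4 : - s <= S by lra.
have zero a b c d : a < b -> c < d -> closed_form (dx_part h) (dy_part h) a b c d ->
    rect_int (dx_part h) (dy_part h) a b c d = 0 by exact: goursat_rectangle.
have bot : closed_form (dx_part h) (dy_part h) (- S) S (- S) (- s).
  by apply: strip => //; do 2 right; left.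
have top : closed_form (dx_part h) (dy_part h) (- S) S s S.
  by apply: strip => //; do 3 right.
have lef : closed_form (dx_part h) (dy_part h) (- S) (- s) (- S) S.
  by apply: strip => //; left.
have rig : closed_form (dx_part h) (dy_part h) s S (- S) S.
  by apply: strip => //; right; left.
have z1 := zero _ _ _ _ SS Ss bot.
have z2 := zero _ _ _ _ SS sS top.
have z3 := zero _ _ _ _ Ss ss (closed_formS lSS (lexx _) Ss' sS' lef).
have z4 := zero _ _ _ _ sS ss (closed_formS (lexx _) uSS Ss' sS' rig).
have [cb _] := closed_form_continuous bot.
have [ct _] := closed_form_continuous top.
have [_ cl] := closed_form_continuous lef.
have [_ cr] := closed_form_continuous rig.
have split3 f : seg_continuous f (- S) S ->
    seg_int f (- S) S = seg_int f (- S) (- s) + seg_int f (- s) s + seg_int f s S.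
  move=> cf; rewrite (seg_int_add Ss' sS4 cf) -addrA; congr (_ + _).
  by apply: seg_int_add => //; [exact: ltW|exact: seg_continuousS cf].
have e1 := split3 _ (cb (- s) _); have e2 := split3 _ (ct s _).
have e3 := split3 _ (cl (- S) _); have e4 := split3 _ (cr S _).
rewrite !lexx ?Ss' ?sS' in e1 e2 e3 e4.
move: (e1 isT) (e2 isT) (e3 isT) (e4 isT) z1 z2 z3 z4 => {e1 e2 e3 e4}.
rewrite /rect_int; clear; lra.
Qed.

(** The factor [8 * s] is the perimeter. The bounds change sign between opposite sides because these
    are traversed in opposite directions. *)
Lemma square_int_bounds h (s k : R) : 0 < s ->
  (forall x y : R, `|x| <= s -> `|y| <= s -> s <= `|x| \/ s <= `|y| ->
     exists l, cderiv h (x +i* y)%C l) ->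
  let J := rect_int (dx_part h) (dy_part h) (- s) s (- s) s in
  ((forall x, `|x| <= s -> [/\ k <= dx_part h x (- s), dx_part h x s <= - k,
      k <= dy_part h s x & dy_part h (- s) x <= - k]) -> 8 * k * s <= J) /\
  ((forall x, `|x| <= s -> [/\ dx_part h x (- s) <= k, - k <= dx_part h x s,
      dy_part h s x <= k & - k <= dy_part h (- s) x]) -> J <= 8 * k * s).
Proof.
move=> s0 H J.
have ss : - s < s by lra.
have cP t : `|t| = s -> seg_continuous (dx_part h ^~ t) (- s) s.
  move=> ts; have cf : closed_form (dx_part h) (dy_part h) (- s) s t t.
    apply: cderiv_closed_form => x y; rewrite -ler_norml => hx yt.
    have -> : y = t by apply/eqP; rewrite eq_le andbC.
    by apply: H; rewrite ?ts //; right.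
  by have [+ _] := closed_form_continuous cf; apply; rewrite lexx.
have cQ t : `|t| = s -> seg_continuous (dy_part h t) (- s) s.
  move=> ts; have cf : closed_form (dx_part h) (dy_part h) t t (- s) s.
    apply: cderiv_closed_form => y x yt; rewrite -ler_norml => hx.
    have -> : y = t by apply/eqP; rewrite eq_le andbC.
    by apply: H; rewrite ?ts //; left.
  by have [_ +] := closed_form_continuous cf; apply; rewrite lexx.
have ns : `|s| = s by rewrite gtr0_norm.
have nms : `|- s| = s by rewrite normrN.
split=> B.
- have b1 : k * (s - - s) <= seg_int (dx_part h ^~ (- s)) (- s) s.
    by apply: seg_int_ge => // [|x]; [exact: cP|rewrite -ler_norml => /B []].
  have b2 : seg_int (dx_part h ^~ s) (- s) s <= - k * (s - - s).
    by apply: seg_int_le => // [|x]; [exact: cP|rewrite -ler_norml => /B []].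
  have b3 : k * (s - - s) <= seg_int (dy_part h s) (- s) s.
    by apply: seg_int_ge => // [|x]; [exact: cQ|rewrite -ler_norml => /B []].
  have b4 : seg_int (dy_part h (- s)) (- s) s <= - k * (s - - s).
    by apply: seg_int_le => // [|x]; [exact: cQ|rewrite -ler_norml => /B []].
  rewrite /J /rect_int; move: b1 b2 b3 b4.
  move: (seg_int _ _ _) (seg_int _ _ _) (seg_int _ _ _) (seg_int _ _ _).
  by clear; move=> *; lra.
- have b1 : seg_int (dx_part h ^~ (- s)) (- s) s <= k * (s - - s).
    by apply: seg_int_le => // [|x]; [exact: cP|rewrite -ler_norml => /B []].
  have b2 : - k * (s - - s) <= seg_int (dx_part h ^~ s) (- s) s.
    by apply: seg_int_ge => // [|x]; [exact: cP|rewrite -ler_norml => /B []].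
  have b3 : seg_int (dy_part h s) (- s) s <= k * (s - - s).
    by apply: seg_int_le => // [|x]; [exact: cQ|rewrite -ler_norml => /B []].
  have b4 : - k * (s - - s) <= seg_int (dy_part h (- s)) (- s) s.
    by apply: seg_int_ge => // [|x]; [exact: cQ|rewrite -ler_norml => /B []].
  rewrite /J /rect_int; move: b1 b2 b3 b4.
  move: (seg_int _ _ _) (seg_int _ _ _) (seg_int _ _ _) (seg_int _ _ _).
  by clear; move=> *; lra.
Qed.

(* The contour integral of [g / z ^+ 2] over a square around [0] is [2 i pi]
   times [g^`() 0]; the factor [a] below makes it real. *)
Lemma cauchy_estimate g :
  (forall z, modulus z < 1 -> derivable g z 1 /\ modulus (g z) <= 1) ->
  g 0 = 0 -> modulus (derive1 g 0) <= 4.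
Proof.
move=> Hg g0; set d := derive1 g 0; set D := modulus d.
have [->|d0] := eqVneq D 0; first by rewrite ler0n.
have Dp : 0 < D by rewrite lt_neqAle eq_sym d0 modulus_ge0.
(* This is [- i] times the conjugate of [d], so [a * d = - i D ^+ 2] and the integral of [a * d / z]
   around [0] is [2 pi D ^+ 2]. *)
pose a : C := ((- complex.Im d) +i* (- complex.Re d))%C.
have Da : modulus a = D.
  by rewrite /D !modulusE /= !sqrrN addrC.
pose h z := a * g z / z ^+ 2.
have dg : is_derive (0 : C) 1 g d.
  have m01 : modulus (0 : C) < 1 by rewrite modulus0.
  have [dg0 _] := Hg 0 m01.
  by apply: (DeriveDef dg0); rewrite -derive1E.
have cg : cderiv g 0 d := is_derive_cderiv dg.
have dh z : modulus z < 1 -> z != 0 -> exists l, cderiv h z l.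
  move=> z1 z0; exists ('D_1 h z); apply: derivable_cderiv.
  by have [dgz _] := Hg z z1; exact: (@derivable_divX2 C g a z dgz z0).
have bd (x y : R) : `|x| <= 1 / 2 -> `|y| <= 1 / 2 -> modulus (x +i* y)%C < 1.
  move=> hx hy; rewrite -(@ltr_pXn2r _ 2) ?nnegrE ?modulus_ge0 // sqr_modulus /=.
  rewrite -(real_normK (num_real x)) -(real_normK (num_real y)).
  by have := normr_ge0 x; have := normr_ge0 y; nra.
have nz (x y s : R) : 0 < s -> s <= `|x| \/ s <= `|y| -> (x +i* y)%C != 0 :> C.
  move=> s0 hs; apply/negP => /eqP [] xE yE; move: hs.
  by rewrite xE yE normr0; case; lra.
have dh' (s S : R) : 0 < s -> S <= 1 / 2 -> forall x y : R,
    `|x| <= S -> `|y| <= S -> s <= `|x| \/ s <= `|y| ->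
    exists l, cderiv h (x +i* y)%C l.
  move=> s0 S1 x y hx hy hs; apply: dh; last exact: nz hs.
  by apply: bd; lra.
have modge (x y s : R) : s <= `|x| \/ s <= `|y| -> s <= modulus (x +i* y)%C.
  by case=> /le_trans; apply; [exact: (normr_Re_le (x +i* y)%C)
    |exact: (normr_Im_le (x +i* y)%C)].
(* On this square [|z| >= 1 / 2], so the integrand is at most [4 * D] in modulus, and the perimeter
   is [4]. *)
have upper : rect_int (dx_part h) (dy_part h) (- (1 / 2)) (1 / 2) (- (1 / 2)) (1 / 2)
    <= 16 * D.
  have h20 : (0 : R) < 1 / 2 by lra.
  have [_ /(_ _)] := @square_int_bounds h (1 / 2) (4 * D) h20 (dh' _ _ h20 (lexx _)).
  have -> : 8 * (4 * D) * (1 / 2) = 16 * D by field.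
  apply=> x hx.
  have hb (z : C) : modulus z < 1 -> 1 / 2 <= modulus z -> modulus (h z) <= 4 * D.
    move=> z1 z2; rewrite /h !modulusM modulusV expr2 modulusM Da.
    have [_ gz] := Hg z z1; have gz0 := modulus_ge0 (g z).
    have m4 : 1 / 4 <= modulus z * modulus z by nra.
    rewrite ler_pdivrMr; last by lra.
    rewrite mulrAC [leRHS]mulrC ler_pM2l //; lra.
  have h2 : `|1 / 2 : R| = 1 / 2 by rewrite gtr0_norm.
  have bb (u v : R) : `|u| <= 1 / 2 -> `|v| <= 1 / 2 ->
      1 / 2 <= `|u| \/ 1 / 2 <= `|v| -> - (4 * D) <= dx_part h u v <= 4 * D /\
       - (4 * D) <= dy_part h u v <= 4 * D.
    move=> hu hv huv; have := hb _ (bd _ _ hu hv) (modge _ _ _ huv) => hz.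
    rewrite -!ler_norml /dy_part normrN /dx_part.
    by split; [exact: le_trans (normr_Re_le _) hz|exact: le_trans (normr_Im_le _) hz].
  have l2 : `|- (1 / 2) : R| <= 1 / 2 by rewrite normrN h2.
  have r2 : `|1 / 2 : R| <= 1 / 2 by rewrite h2.
  have g2 : 1 / 2 <= `|1 / 2 : R| by rewrite h2.
  have k2 : 1 / 2 <= `|- (1 / 2) : R| by rewrite normrN h2.
  have [/andP[_ b1] _] := bb x (- (1 / 2)) hx l2 (or_intror k2).
  have [/andP[b2 _] _] := bb x (1 / 2) hx r2 (or_intror g2).
  have [_ /andP[_ b3]] := bb (1 / 2) x r2 hx (or_introl g2).
  have [_ /andP[b4 _]] := bb (- (1 / 2)) x l2 hx (or_introl k2).
  by [].
have adE : a * d = (0 -i* (D ^+ 2))%C.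
  rewrite /D sqr_modulus /a; case: (d) => u v; apply: complex_eqP.
    by rewrite cReM /=; ring.
  by rewrite cImM /=; ring.
apply/ler_addgt0Pl => e e0.
have [r r0 Hr] := cg (e / 2) (divr_gt0 e0 (ltr0n _ 2)).
(* The square must lie inside the large one, and its points, of modulus at most [2 * s], inside the
   disc of radius [r] where the expansion of [g] holds. *)
pose s := Order.min (1 / 4) (r / 4).
have s0 : 0 < s by rewrite lt_min; apply/andP; split; lra.
have [s4 sr] : s <= 1 / 4 /\ s <= r / 4 by rewrite !ge_min !lexx orbT.
have approx (x y : R) : `|x| <= s -> `|y| <= s -> s <= `|x| \/ s <= `|y| ->
    `|dx_part h x y - (- D ^+ 2 * y / (x ^+ 2 + y ^+ 2))| <= D * (e / 2) / s /\
    `|dy_part h x y - D ^+ 2 * x / (x ^+ 2 + y ^+ 2)| <= D * (e / 2) / s.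
  move=> hx hy hxy; set z : C := (x +i* y)%C.
  have z0 : z != 0 := nz _ _ _ s0 hxy.
  have sz : s <= modulus z := modge _ _ _ hxy.
  have zp : 0 < modulus z by rewrite modulus_gt0.
  have zr : modulus z < r.
    by have := modulus_le_ReIm z; rewrite /=; lra.
  have := Hr z; rewrite subr0 g0 subr0 => /(_ zr) gz.
  have hE : h z = a * d * z^-1 + a * (g z - d * z) / z ^+ 2 by rewrite /h; field.
  have hb : modulus (h z - a * d * z^-1) <= D * (e / 2) / s.
    rewrite hE addrC addrA addNr add0r !modulusM modulusV expr2 modulusM Da.
    rewrite -!mulrA ler_pM2l // ler_pdivrMr ?mulr_gt0 //; apply: le_trans gz _.
    have -> : e * (2^-1 / s) * (modulus z * modulus z) =
      e / 2 * modulus z * (modulus z / s) by field; rewrite gt_eqF.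
    rewrite ler_peMr ?mulr_ge0 ?invr_ge0 ?(ltW e0) ?(ltW zp) //.
    by rewrite ler_pdivlMr // mul1r.
  have zV : z^-1 = (x / (x ^+ 2 + y ^+ 2) -i* (y / (x ^+ 2 + y ^+ 2)))%C by [].
  split.
    apply: le_trans (le_trans (normr_Re_le _) hb).
    by rewrite cReB adE zV cReM /= /dx_part le_eqVlt; apply/orP; left; apply/eqP;
      congr `|_|; ring.
  apply: le_trans (le_trans (normr_Im_le _) hb).
  rewrite -normrN cImB adE zV cImM /= /dy_part le_eqVlt; apply/orP; left.
  by apply/eqP; congr `|_|; ring.
(* On each side the main term is [D ^+ 2 * s / (x ^+ 2 + s ^+ 2)] up to orientation, at least
   [D ^+ 2 / (2 * s)] as [|x| <= s]. Over the perimeter this gives [4 D ^+ 2] in place of the exact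
   [2 pi D ^+ 2], without computing arctangents. *)
pose k := D ^+ 2 / (2 * s) - D * (e / 2) / s.
have frac (x : R) : `|x| <= s -> D ^+ 2 / (2 * s) <= D ^+ 2 * s / (x ^+ 2 + s ^+ 2).
  move=> hx; have x2 : x ^+ 2 <= s ^+ 2.
    by rewrite -(real_normK (num_real x)); have := normr_ge0 x; nra.
  have x0 : 0 <= x ^+ 2 := sqr_ge0 x.
  have q0 : 0 < x ^+ 2 + s ^+ 2 by have := exprn_gt0 2 s0; lra.
  rewrite -mulrA ler_pM2l ?exprn_gt0 // ler_pdivlMr //.
  by rewrite mulrC ler_pdivrMr ?mulr_gt0 //; nra.
have ns : `|s| = s by rewrite gtr0_norm.
have nms : `|- s| = s by rewrite normrN.
have ls : `|- s| <= s by rewrite nms.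
have rs : `|s| <= s by rewrite ns.
have gs : s <= `|s| by rewrite ns.
have ks : s <= `|- s| by rewrite nms.
have sh : s <= 1 / 2 by lra.
have sh' : s < 1 / 2 by lra.
have lower : 8 * k * s <= rect_int (dx_part h) (dy_part h) (- s) s (- s) s.
  have [+ _] := @square_int_bounds h s k s0 (dh' _ _ s0 sh).
  apply=> x hx; have fx := frac x hx.
  have [+ _] := approx x (- s) hx ls (or_intror ks).
  have [+ _] := approx x s hx rs (or_intror gs).
  have [_ +] := approx s x rs hx (or_introl gs).
  have [_ +] := approx (- s) x ls hx (or_introl ks).
  rewrite !sqrrN !mulrN !mulNr opprK (addrC (s ^+ 2)) !ler_norml /k.
  by move=> /andP[? ?] /andP[? ?] /andP[? ?] /andP[? ?]; split; lra.
have annulus := square_int_annulus s0 sh' (dh' _ _ s0 (lexx _)).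
have {annulus lower upper} : 8 * k * s <= 16 * D.
  by apply: le_trans lower _; rewrite -annulus.
have -> : 8 * k * s = D * (4 * D - 4 * e) by rewrite /k; field; rewrite gt_eqF.
by rewrite mulrC ler_pM2r //; lra.
Qed.

End CauchyEstimate.

Section MoebiusDerivative.
Context {K : numFieldType}.
Implicit Types (f : K -> K) (a b z c : K).

Lemma derivable_moebius f a b z : derivable f z 1 -> f z + b != 0 ->
  derivable (fun w => (f w - a) / (f w + b)) z 1.
Proof.
move=> df nz; apply: (@derivableM _ _ (fun w => f w - a) (fun w => (f w + b)^-1)).
  exact: (@derivableB _ _ _ f (cst a)).
apply: (@derivableV _ _ (fun w => f w + b)) => //.
exact: (@derivableD _ _ _ f (cst b)).
Qed.

Lemma derive1_moebius f b z : derivable f z 1 -> f z + b != 0 ->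
  derive1 (fun w => (f w - f z) / (f w + b)) z = derive1 f z / (f z + b).
Proof.
move=> df nz; rewrite !derive1E.
have d2 : derivable (fun w => f w + b) z 1 by exact: (@derivableD _ _ _ f (cst b)).
have d3 : derivable (fun w => (f w + b)^-1) z 1.
  exact: (@derivableV _ _ (fun w => f w + b)).
have d4 c : derivable (fun w => f w - c) z 1 by exact: (@derivableB _ _ _ f (cst c)).
have -> := @deriveM _ _ (fun w => f w - f z) (fun w => (f w + b)^-1) z 1 (d4 (f z)) d3.
rewrite subrr scale0r add0r.
have -> := @deriveB _ _ _ f (cst (f z)) z 1 df (derivable_cst _ _ _).
by rewrite derive_cst subr0 /GRing.scale /= mulrC.
Qed.

(** The derivative of an affine reparametrization is a directional derivative of [f], because the
    two difference quotients coincide as functions of [h]. *)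
Lemma line_quotient (V : normedModType K) (f : K -> V) a c z :
  (fun h : K => h^-1 *: (((fun w => f (a + c * w)) \o shift z) (h *: (1 : K))
     - f (a + c * z))) =
  (fun h : K => h^-1 *: ((f \o shift (a + c * z)) (h *: c) - f (a + c * z))).
Proof.
apply/funext => h; congr (_ *: (f _ - _)); rewrite /= /shift /GRing.scale /=.
by rewrite mulr1; ring.
Qed.

Lemma derivable_line (V : normedModType K) (f : K -> V) a c z :
  derivable f (a + c * z) 1 -> derivable (fun w => f (a + c * w)) z 1.
Proof.
move=> /derivable1_diffP df; rewrite /derivable line_quotient.
exact: (@diff_derivable _ _ _ _ _ c df).
Qed.

Lemma derive1_line (V : normedModType K) (f : K -> V) a c z :
  derivable f (a + c * z) 1 ->
  derive1 (fun w => f (a + c * w)) z = c *: derive1 f (a + c * z).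
Proof.
move=> df; have /derivable1_diffP df' := df.
rewrite [LHS]derive1E /derive line_quotient.
by rewrite -/(derive f (a + c * z) c) deriveE // deriv1E.
Qed.

End MoebiusDerivative.

(** * Harnack's inequality for the right half-plane *)

Section Harnack.
Context {R : realType}.
Local Notation C := (cplx R).
Implicit Types (f : C -> C) (z : C).

(** The Cayley transform centred at [f 0] maps the half-plane into the unit disc and turns the
    derivative into [f' 0 / (2 Re (f 0))]; the bound [4] of [cauchy_estimate] becomes [8]. *)
Lemma halfplane_derive0_le f :
  (forall z, modulus z < 1 -> derivable f z 1 /\ 0 < complex.Re (f z)) ->
  modulus (derive1 f 0) <= 8 * complex.Re (f 0).
Proof.
move=> Hf; have m01 : modulus (0 : C) < 1 by rewrite modulus0.
have [df0 x0] := Hf 0 m01; set a := f 0 in x0 *.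
pose b : C := (complex.Re a -i* complex.Im a)%C.
pose g z := (f z - a) / (f z + b).
have nz z : modulus z < 1 -> f z + b != 0.
  move=> /Hf [_ fz]; apply/eqP => /(congr1 (@complex.Re R)).
  by rewrite cReD /=; lra.
have gle z : modulus z < 1 -> modulus (g z) <= 1.
  move=> z1; have [_ fz] := Hf z z1.
  rewrite /g modulusM modulusV ler_pdivrMr ?modulus_gt0 ?nz // mul1r.
  rewrite -(@ler_pXn2r _ 2) ?nnegrE ?modulus_ge0 // !sqr_modulus.
  by rewrite cReB cImB cReD cImD /=; nra.
have := @cauchy_estimate R g _ _.
have -> : derive1 g 0 = derive1 f 0 / (2 * toC (complex.Re a)).
  rewrite (@derive1_moebius C f b 0 df0 (nz 0 m01)); congr (_ / _).
  by apply: complex_eqP; rewrite ?cReD ?cImD ?cReM ?cImM /=; ring.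
move=> /(_ _ _); rewrite modulusM modulusV modulusM modulus_toC gtr0_norm //.
have -> : modulus (2 : C) = 2.
  have -> : 2 = toC (2 : R) :> C by apply: complex_eqP; rewrite //= addr0.
  by rewrite modulus_toC gtr0_norm.
rewrite ler_pdivrMr ?mulr_gt0 // mulrA -natrM; apply.
  move=> z z1; split; last exact: gle.
  by have [df _] := Hf z z1; exact: (@derivable_moebius C f a b z df (nz z z1)).
by rewrite /g subrr mul0r.
Qed.

(** The estimate at the centre, applied to the disc of radius [1 - modulus z0] about [z0]. *)
Lemma halfplane_derive_le f z0 :
  (forall z, modulus z < 1 -> derivable f z 1 /\ 0 < complex.Re (f z)) ->
  modulus z0 < 1 ->
  modulus (derive1 f z0) * (1 - modulus z0) <= 8 * complex.Re (f z0).
Proof.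
move=> Hf z01; pose c : C := toC (1 - modulus z0).
have mc : modulus c = 1 - modulus z0 by rewrite modulus_toC ger0_norm // ltW ?subr_gt0.
have in1 z : modulus z < 1 -> modulus (z0 + c * z) < 1.
  move=> z1; apply: le_lt_trans (ler_modulusD _ _) _; rewrite modulusM mc.
  by have := modulus_ge0 z; nra.
have := @halfplane_derive0_le (fun z => f (z0 + c * z)) _.
have [df0 _] := Hf _ z01.
have df0' : derivable f (z0 + c * 0) 1 by rewrite mulr0 addr0.
rewrite (@derive1_line C _ f z0 c 0 df0') mulr0 addr0.
rewrite -[_ *: _]/(c * derive1 f z0).
rewrite modulusM mc mulrC; apply=> z /in1 /Hf [df fz]; split; last exact: fz.
exact: (@derivable_line C _ f z0 c z df).
Qed.

Lemma is_derive1_real (u : R -> R) (x l : R) :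
  (forall e : R, 0 < e -> exists2 r : R, 0 < r & forall y, `|y - x| < r ->
     `|u y - u x - l * (y - x)| <= e * `|y - x|) -> is_derive x 1 u l.
Proof.
move=> H.
have L : h^-1 *: ((u \o shift x) (h *: (1 : R)) - u x) @[h --> 0^'] --> l.
  apply/cvgrPdist_le => e e0; have [r r0 Hr] := H e e0.
  exists r => //= h; rewrite /ball_ /= sub0r normrN => hr h0.
  have := Hr (x + h); rewrite (addrC x h) addrK => /(_ hr).
  have hn : 0 < `|h| by rewrite normr_gt0.
  rewrite /shift /= /GRing.scale /= mulr1 => hh.
  rewrite -(ler_pM2r hn) -normrM; apply: le_trans hh.
  by rewrite -normrN le_eqVlt; apply/orP; left; apply/eqP; congr `|_|; field.
apply: DeriveDef; first by apply/cvg_ex; exists l.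
exact: cvg_lim L.
Qed.

Lemma is_derive_Re_ray f (d a : C) (t : R) : cderiv f (toC t * a) d ->
  is_derive t 1 (fun s : R => complex.Re (f (toC s * a))) (complex.Re (d * a)).
Proof.
move=> cd; apply: is_derive1_real => e e0.
pose m := 1 + modulus a.
have m0 : 0 < m by have := modulus_ge0 a; rewrite /m; lra.
have [r r0 Hr] := cd (e / m) (divr_gt0 e0 m0).
exists (r / m); first exact: divr_gt0.
move=> s sr.
have dE : toC s * a - toC t * a = toC (s - t) * a.
  by apply: complex_eqP; rewrite ?cReB ?cImB ?cReZ ?cImZ; ring.
have mE : modulus (toC s * a - toC t * a) <= `|s - t| * m.
  by rewrite dE modulusM modulus_toC ler_wpM2l // /m lerDr.
have lt_r : modulus (toC s * a - toC t * a) < r.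
  by apply: le_lt_trans mE _; rewrite -ltr_pdivlMr.
have hb := Hr (toC s * a) lt_r.
apply: (@le_trans _ _ (e / m * (`|s - t| * m))); last first.
  by rewrite (mulrC `|_|) mulrA divfK ?gt_eqF.
apply: le_trans (le_trans hb _); last by rewrite ler_pM2l ?divr_gt0.
apply: le_trans (normr_Re_le _).
rewrite !cReB dE mulrCA cReZ le_eqVlt; apply/orP; left; apply/eqP.
by congr `|_|; ring.
Qed.

Lemma artanhE (s : R) : 0 <= s -> s < 1 ->
  artanh s = (ln (1 + s) - ln (1 - s)) / 2.
Proof.
move=> s0 s1; have h1 : 1 + s \is Num.pos by rewrite posrE; lra.
have h2 : 1 - s \is Num.pos by rewrite posrE; lra.
by rewrite /artanh (ln_div h1 h2).
Qed.

(** Along the radius to [a], of modulus [m], the logarithmic derivative of [Re f] is at most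
    [8 m / (1 - t m)], which is the derivative of [- 8 ln (1 - t m)]. The mean value theorem for
    [ln u] plus and minus [8 ln (1 - t m)] gives the bound [- 8 ln (1 - m)], and [16 * artanh m]
    exceeds it by [8 ln (1 + m)]. *)
Lemma harnack f (a : C) :
  (forall z, modulus z < 1 -> derivable f z 1 /\ 0 < complex.Re (f z)) ->
  modulus a < 1 ->
  `|ln (complex.Re (f a)) - ln (complex.Re (f 0))| <= 16 * artanh (modulus a).
Proof.
move=> Hf a1; set m := modulus a in a1 *; have m0 : 0 <= m := modulus_ge0 a.
pose u (t : R) := complex.Re (f (toC t * a)).
pose du (t : R) := complex.Re (derive1 f (toC t * a) * a).
have in1 (t : R) : 0 <= t <= 1 -> modulus (toC t * a) = t * m /\ t * m < 1.
  move=> /andP[t0 t1]; rewrite modulusM modulus_toC ger0_norm //; split=> //.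
  by nra.
have in2 (t : R) : 0 <= t <= 1 -> modulus (toC t * a) < 1.
  by move=> /in1 [-> ].
have u0 (t : R) : 0 <= t <= 1 -> 0 < u t by move=> /in2 /Hf [].
have dU (t : R) : 0 <= t <= 1 -> is_derive t 1 u (du t).
  move=> /in2 /Hf [df _]; apply: is_derive_Re_ray.
  by rewrite derive1E; exact: derivable_cderiv.
have bound (t : R) : 0 <= t <= 1 -> `|du t / u t| <= 8 * m / (1 - t * m).
  move=> ht; have [tE tm] := in1 t ht; have := halfplane_derive_le Hf (in2 t ht).
  rewrite tE -/(u t) => hb; have ut := u0 t ht.
  rewrite normrM normfV (gtr0_norm ut) ler_pdivrMr // mulrAC ler_pdivlMr ?subr_gt0 //.
  have : `|du t| <= modulus (derive1 f (toC t * a)) * m.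
    by apply: le_trans (normr_Re_le _) _; rewrite modulusM.
  move: hb; set M := modulus (derive1 f _); have M0 : 0 <= M by exact: modulus_ge0.
  by have := normr_ge0 (du t); nra.
have dF (k t : R) : 0 <= t <= 1 ->
    is_derive t 1 (fun s => ln (u s) + k * ln (1 - s * m))
      (du t / u t - k * (m / (1 - t * m))).
  move=> ht; have [_ tm] := in1 t ht.
  have d1 := is_derive1_comp (is_derive1_ln (u0 t ht)) (dU t ht).
  have tm' : 0 < 1 - t * m by rewrite subr_gt0.
  have d0 : is_derive t 1 (fun s : R => 1 - s * m) (- m).
    by apply: is_derive_eq; rewrite /GRing.scale /=; lra.
  have d2 := @is_derive1_comp R (@ln R) (fun s => 1 - s * m) t _ _ (is_derive1_ln tm') d0.
  have d3 := is_deriveD d1 (is_deriveZ k d2).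
  by apply: (is_derive_eq d3); rewrite /GRing.scale /=; ring.
have mvt (k : R) : exists2 t : R, 0 <= t <= 1 &
    ln (u 1) + k * ln (1 - m) - ln (u 0) = du t / u t - k * (m / (1 - t * m)).
  have [||t] := @MVT_segment R (fun s => ln (u s) + k * ln (1 - s * m))
    (fun t => du t / u t - k * (m / (1 - t * m))) 0 1 ler01.
  - by move=> x; rewrite in_itv /= => /andP[/ltW ? /ltW ?]; apply: dF; apply/andP.
  - apply: derivable_within_continuous => x; rewrite in_itv /= => /(dF k) [dx _].
    exact: dx.
  rewrite in_itv /= => ht; rewrite mul1r mul0r subr0 ln1 mulr0 addr0 mulr1 => E.
  by exists t.
have arith (A B c1 c2 q1 q2 l L : R) : B + 8 * l - A = c1 - 8 * q1 ->
    B + - 8 * l - A = c2 - - 8 * q2 -> - (8 * q2) <= c2 -> c2 <= 8 * q2 ->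
    - (8 * q1) <= c1 -> c1 <= 8 * q1 -> 0 <= L ->
    - (8 * L - 8 * l) <= B - A <= 8 * L - 8 * l.
  by clear => *; apply/andP; split; lra.
have uE1 : u 1 = complex.Re (f a).
  by rewrite /u (_ : toC 1 = 1 :> C) // mul1r.
have uE0 : u 0 = complex.Re (f 0).
  by rewrite /u (_ : toC 0 = 0 :> C) // mul0r.
have [t ht E1] := mvt 8; have [t' ht' E2] := mvt (- 8).
have := bound t ht; have := bound t' ht'; rewrite !ler_norml -uE1 -uE0.
rewrite -!mulrA => /andP[b1 b2] /andP[b3 b4].
have lnm : 0 <= ln (1 + m) by rewrite ln_ge0 // lerDl.
have aE : 16 * artanh m = 8 * ln (1 + m) - 8 * ln (1 - m).
  by rewrite (artanhE m0 a1); clear; lra.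
rewrite aE; exact: (arith _ _ _ _ _ _ _ _ E1 E2 b1 b2 b3 b4 lnm).
Qed.

End Harnack.

(** * Analytic discs and supporting half-planes *)

Section LinearForms.
Context {K : numFieldType} {n : nat}.
Implicit Types (c z w : 'rV[K]_n).

(** There is no conjugation: the form is complex linear in [z], so it composes with analytic discs,
    and it has the shape used in [complex_hyperplane]. *)
Definition lform c z : K := \sum_(i < n) c 0 i * z 0 i.

Lemma lformD c z w : lform c (z + w) = lform c z + lform c w.
Proof. by rewrite -big_split; apply: eq_bigr => i _; rewrite mxE mulrDr. Qed.

Lemma lformZ c (k : K) z : lform c (k *: z) = k * lform c z.
Proof. by rewrite mulr_sumr; apply: eq_bigr => i _; rewrite mxE mulrCA. Qed.

Lemma lformN c z : lform c (- z) = - lform c z.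
Proof. by rewrite -scaleN1r lformZ mulN1r. Qed.

Lemma lformB c z w : lform c (z - w) = lform c z - lform c w.
Proof. by rewrite lformD lformN. Qed.

Lemma lform_continuous c : continuous (lform c).
Proof.
rewrite /lform; apply: continuous_big => [|i _ x].
  by move=> x; apply: cvgD; [exact: cvg_fst|exact: cvg_snd].
apply: (@continuousM K _ (cst (c 0 i)) (fun z : 'rV[K]_n => z 0 i)).
  exact: cst_continuous.
exact: coord_continuous.
Qed.

Lemma is_derive_lform (f : K -> 'rV[K]_n) c p (z : K) : derivable f z 1 ->
  is_derive z 1 (fun u => lform c (f u - p)) (lform c (derive1 f z)).
Proof.
move=> df; rewrite derive1E.
pose q (h : K) := h^-1 *: ((f \o shift z) (h *: (1 : K)) - f z).
have E : (fun h : K => h^-1 *: (((fun u => lform c (f u - p)) \o shift z)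
    (h *: (1 : K)) - lform c (f z - p))) = lform c \o q.
  apply/funext => h; rewrite /= lformZ !lformB /GRing.scale /=.
  by congr (_ * _); ring.
have L : (lform c \o q) h @[h --> 0^'] --> lform c ('D_1 f z).
  have dq : q h @[h --> 0^'] --> 'D_1 f z by exact: df.
  exact: (cvg_comp _ _ dq (@lform_continuous c _)).
rewrite -E in L.
apply: DeriveDef; first by apply/cvg_ex; exists (lform c ('D_1 f z)).
exact: cvg_lim L.
Qed.

End LinearForms.

Section Combinations.
Context {K : numFieldType} {V : normedModType K}.
Implicit Types (f g : K -> V) (a b z : K).

Lemma is_derive_comb f g a b z : derivable f z 1 -> derivable g z 1 ->
  is_derive z 1 (fun u => a *: f u + b *: g u)
    (a *: derive1 f z + b *: derive1 g z).
Proof.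
move=> df dg; rewrite !derive1E.
have d1 : is_derive z 1 (a \*: f) (a *: 'D_1 f z).
  by apply: is_deriveZ; exact/derivableP.
have d2 : is_derive z 1 (b \*: g) (b *: 'D_1 g z).
  by apply: is_deriveZ; exact/derivableP.
exact: is_deriveD d1 d2.
Qed.

Lemma is_derive_affine (x y : V) (u : K) :
  is_derive u 1 (fun v => x + v *: y) y.
Proof.
pose q (h : K) := h^-1 *: (((fun v => x + v *: y) \o shift u) (h *: (1 : K))
  - (x + u *: y)).
have L : q h @[h --> 0^'] --> y.
  apply: cvg_near_cst; near=> h.
  have h0 : h != 0 by near: h; exact: nbhs_dnbhs_neq.
  rewrite /q /= /GRing.scale /= -/(_ *: _) mulr1 opprD addrACA subrr add0r.
  by rewrite -scalerBl addrK scalerA mulVf // scale1r.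
apply: DeriveDef; first by apply/cvg_ex; exists y.
exact: cvg_lim L.
Unshelve. all: by end_near. Qed.

End Combinations.

(** * Discs with prescribed centre and derivative *)

Section AnalyticDiscs.
Context {R : realType} {n : nat}.
Local Notation C := (cplx R).
Local Notation Cn := 'rV[cplx R]_n.
Implicit Types (Omega : set Cn) (z w p c : Cn).

(** A witness for [kobayashi_royden Omega z w <= 1], conversely available when the inequality is
    strict. Witnesses can be averaged and moved, which replaces computations with infima. *)
Definition disc_at Omega z w := exists phi : C -> Cn,
  [/\ holo_disc 1 Omega phi, phi 0 = z & derive1 phi 0 = w].

Lemma disc_at0 Omega z : Omega z -> disc_at Omega z 0.
Proof.
move=> Oz; exists (fun=> z); split=> //.
exact: (@derive1_cst C Cn).
Qed.

Lemma disc_atZ Omega z w (k : C) : modulus k <= 1 ->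
  disc_at Omega z w -> disc_at Omega z (k *: w).
Proof.
move=> k1 [phi [hphi phi0 dphi]].
have in1 u : modulus u < 1 -> modulus (0 + k * u) < 1.
  by move=> u1; rewrite add0r modulusM; have := modulus_ge0 u; have := modulus_ge0 k; nra.
exists (fun u => phi (0 + k * u)); split.
- move=> u /in1 hu; have [pu df] := hphi _ hu; split; first exact: pu.
  exact: (@derivable_line C Cn phi 0 k u df).
- by rewrite mulr0 addr0.
- have m00 : modulus (0 + k * 0) < 1 by apply: in1; rewrite modulus0.
  have [_ df] := hphi _ m00.
  by rewrite (@derive1_line C Cn phi 0 k 0 df) mulr0 addr0 dphi.
Qed.

Definition segment_convex Omega := forall z w (t : R), Omega z -> Omega w ->
  0 <= t <= 1 -> Omega (toC (1 - t) *: z + toC t *: w).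

Lemma convex_set_segment Omega : @convex_set C Cn Omega -> segment_convex Omega.
Proof.
move=> cO z w t Oz Ow /andP[t0 t1].
have h0 : 0 <= (toC (1 - t) : C) by rewrite /toC lecE /= eqxx subr_ge0.
have h1 : (toC (1 - t) : C) <= 1 by rewrite /toC lecE /= eqxx gerBl.
have := cO z w (Itv01 h0 h1); rewrite !inE => /(_ Oz Ow).
have -> : toC t = 1 - toC (1 - t) :> C.
  by apply: complex_eqP; rewrite ?cReB ?cImB /=; ring.
by [].
Qed.

Lemma disc_at_comb Omega z w z' w' (t : R) : segment_convex Omega ->
  0 <= t <= 1 -> disc_at Omega z w -> disc_at Omega z' w' ->
  disc_at Omega (toC (1 - t) *: z + toC t *: z') (toC (1 - t) *: w + toC t *: w').
Proof.
move=> cO ht [f [hf f0 df]] [g [hg g0 dg]].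
exists (fun u => toC (1 - t) *: f u + toC t *: g u); split.
- move=> u hu; have [fu dfu] := hf u hu; have [gu dgu] := hg u hu.
  split; first exact: cO.
  by case: (@is_derive_comb C Cn f g (toC (1 - t)) (toC t) u dfu dgu).
- by rewrite f0 g0.
- have m01 : modulus (0 : C) < 1 by rewrite modulus0.
  have [_ dfu] := hf 0 m01; have [_ dgu] := hg 0 m01.
  have := @is_derive_comb C Cn f g (toC (1 - t)) (toC t) 0 dfu dgu.
  by rewrite df dg => -[_ <-]; rewrite derive1E.
Qed.

Lemma disc_at_affine Omega z w :
  (forall u : C, modulus u < 1 -> Omega (z + u *: w)) -> disc_at Omega z w.
Proof.
move=> H.
have d := @is_derive_affine C Cn z w.
exists (fun v : C => z + v *: w); split.
- by move=> u /H Ou; split; [exact: Ou|case: (d u)].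
- by rewrite scale0r addr0.
- by rewrite derive1E; case: (d 0).
Qed.

(** The homothety towards [q] acts on the whole disc. Its invariance is assumed only on [Omega], so
    that [q] may be a boundary point. *)
Lemma disc_at_shrink Omega z w q (t : R) :
  (forall x, Omega x -> Omega (toC (1 - t) *: x + toC t *: q)) ->
  disc_at Omega z w ->
  disc_at Omega (toC (1 - t) *: z + toC t *: q) (toC (1 - t) *: w).
Proof.
move=> H [f [hf f0 df]].
have d u := @is_derive_comb C Cn f (fun=> q) (toC (1 - t)) (toC t) u.
exists (fun u => toC (1 - t) *: f u + toC t *: q); split.
- move=> u hu; have [fu dfu] := hf u hu; split; first exact: H.
  by case: (d u dfu (@derivable_cst C C Cn _ _ _)).
- by rewrite f0.
- have m01 : modulus (0 : C) < 1 by rewrite modulus0.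
  have [_ dfu] := hf 0 m01; rewrite derive1E.
  case: (d 0 dfu (@derivable_cst C C Cn _ _ _)) => _ ->.
  by rewrite df (@derive1_cst C Cn) scaler0 addr0.
Qed.

Lemma toCV (k : R) : (toC k)^-1 = toC k^-1.
Proof. by rewrite /toC -[RHS]/((_)%:C%C) fmorphV. Qed.

Lemma kobayashi_royden_le Omega z w (k : R) : 0 < k ->
  disc_at Omega z (toC k *: w) -> (kobayashi_royden Omega z w <= (k^-1)%:E)%E.
Proof.
move=> k0 [f [hf f0 df]]; apply: ereal_inf_lbound; exists k => //; split=> //.
have in1 (u : C) : modulus u < k -> modulus (0 + toC k^-1 * u) < 1.
  move=> uk; rewrite add0r modulusM modulus_toC gtr0_norm ?invr_gt0 //.
  by rewrite mulrC ltr_pdivrMr // mul1r.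
exists (fun u => f (0 + toC k^-1 * u)); split.
- move=> u /in1 hu; have [fu dfu] := hf _ hu; split; first exact: fu.
  exact: (@derivable_line C Cn f 0 (toC k^-1) u dfu).
- by rewrite mulr0 addr0.
- have m00 : modulus (0 + toC k^-1 * 0) < 1 by apply: in1; rewrite modulus0.
  have [_ dfu] := hf _ m00.
  rewrite (@derive1_line C Cn f 0 (toC k^-1) 0 dfu) mulr0 addr0 df scalerA.
  by rewrite -toCV mulVf ?scale1r //; apply/eqP => /toC_inj k00; move: k0; rewrite k00 ltxx.
Qed.

(** Strictness provides a disc of radius larger than [k], as the infimum need not be attained. *)
Lemma kobayashi_royden_lt Omega z w (k : R) : 0 < k ->
  (kobayashi_royden Omega z w < (k^-1)%:E)%E -> disc_at Omega z (toC k *: w).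
Proof.
move=> k0 /ereal_inf_lt [_ [r [r0 [f [hf f0 df]]] <-]]; rewrite lte_fin => rk.
have kr : k < r by move: rk; rewrite ltf_pV2.
have in1 (u : C) : modulus u < 1 -> modulus (0 + toC k * u) < r.
  move=> u1; rewrite add0r modulusM modulus_toC gtr0_norm //.
  by have := modulus_ge0 u; nra.
exists (fun u => f (0 + toC k * u)); split.
- move=> u /in1 hu; have [fu dfu] := hf _ hu; split; first exact: fu.
  exact: (@derivable_line C Cn f 0 (toC k) u dfu).
- by rewrite mulr0 addr0.
- have m00 : modulus (0 + toC k * 0) < r by apply: in1; rewrite modulus0.
  have [_ dfu] := hf _ m00.
  by rewrite (@derive1_line C Cn f 0 (toC k) 0 dfu) mulr0 addr0 df.
Qed.

Lemma disc_at_halfplane Omega z w p c :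
  (forall x, Omega x -> 0 < complex.Re (lform c (x - p))) ->
  disc_at Omega z w -> modulus (lform c w) <= 8 * complex.Re (lform c (z - p)).
Proof.
move=> H [f [hf f0 df]].
have m01 : modulus (0 : C) < 1 by rewrite modulus0.
have dl (u : C) (hu : modulus u < 1) := @is_derive_lform C n f c p u (proj2 (hf u hu)).
have := @halfplane_derive0_le R (fun u => lform c (f u - p)).
rewrite f0 derive1E; case: (dl 0 m01) => _ ->; rewrite df; apply=> u hu.
by split; [case: (dl u hu)|apply: H; case: (hf u hu)].
Qed.

Lemma lempert_halfplane Omega z w p c :
  (forall x, Omega x -> 0 < complex.Re (lform c (x - p))) ->
  ((`|ln (complex.Re (lform c (z - p))) - ln (complex.Re (lform c (w - p)))| / 16)%:E
    <= lempert Omega z w)%E.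
Proof.
move=> H; apply: le_ereal_inf_tmp => _ [a [a1 [f [hf f0 fa]]] <-].
rewrite lee_fin ler_pdivrMr // mulrC distrC -f0 -fa.
apply: (@harnack R (fun u => lform c (f u - p)) a) => // u hu.
have [fu dfu] := hf u hu.
by split; [case: (@is_derive_lform C n f c p u dfu)|exact: H].
Qed.

(** Harnack bounds every link of a chain by a difference of one function, [ln (Re c)], so the
    triangle inequality passes the bound on to chains. *)
Lemma kobayashi_halfplane Omega z w p c :
  (forall x, Omega x -> 0 < complex.Re (lform c (x - p))) ->
  ((`|ln (complex.Re (lform c (z - p))) - ln (complex.Re (lform c (w - p)))| / 16)%:E
    <= kobayashi Omega z w)%E.
Proof.
move=> H; apply: le_ereal_inf_tmp => _ [m [x [<- <- _ ->]]].
pose h y := ln (complex.Re (lform c (y - p))).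
apply: (@le_trans _ _ (\sum_(i < m) (`|h (x i) - h (x i.+1)| / 16)%:E)%E); last first.
  by apply: lee_sum => i _; exact: lempert_halfplane.
rewrite sumEFin lee_fin -mulr_suml ler_pM2r // -/(h _) -/(h _).
elim: m => [|m IH]; first by rewrite big_ord0 subrr normr0.
rewrite big_ord_recr /=; apply: le_trans (lerD IH (lexx _)).
by rewrite (le_trans _ (ler_normD _ _)) // addrA subrK.
Qed.

End AnalyticDiscs.

(** * Smooth boundary points and supporting half-planes *)

Section Tangent.
Context {R : realType} {n : nat}.
Local Notation C := (cplx R).
Local Notation Cn := 'rV[cplx R]_n.
Implicit Types (Omega U A : set Cn) (z w v p q eta : Cn) (rho : Cn -> R).

Lemma nbhs_rowP p A : nbhs p A -> exists2 e : R, 0 < e &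
  forall z, (forall i, modulus (z 0 i - p 0 i) < e) -> A z.
Proof.
move=> /nbhs_ballP [e0 /= /gt0_toC [e e_gt0 ->] H]; exists e => // z zp.
apply: H; split=> [|i j]; first by rewrite toC_gt0.
by rewrite ord1 /ball /= /ball_ /= ltr_norm_toC modulusB.
Qed.

Lemma row_nbhs p A (e : R) : 0 < e ->
  (forall z, (forall i, modulus (z 0 i - p 0 i) < e) -> A z) -> nbhs p A.
Proof.
move=> e0 H; apply/nbhs_ballP; exists (toC e); rewrite /= ?toC_gt0 // => z [_ zp].
by apply: H => i; rewrite modulusB -ltr_norm_toC; exact: zp.
Qed.

Lemma nbhs_plane p v w A : nbhs p A -> exists2 r : R, 0 < r &
  forall s t : R, `|s| < r -> `|t| < r -> A (p + toC s *: v + toC t *: w).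
Proof.
move=> /nbhs_rowP [e e0 H].
pose M := \sum_i (modulus (v 0 i) + modulus (w 0 i)).
have M0 : 0 <= M by apply: sumr_ge0 => i _; rewrite addr_ge0 ?modulus_ge0.
have M1 : 0 < 1 + M by lra.
exists (e / (1 + M)); first exact: divr_gt0.
move=> s t hs ht; apply: H => i; rewrite !mxE.
have -> : p 0 i + toC s * v 0 i + toC t * w 0 i - p 0 i =
  toC s * v 0 i + toC t * w 0 i by ring.
apply: le_lt_trans (ler_modulusD _ _) _; rewrite !modulusM !modulus_toC.
have : modulus (v 0 i) + modulus (w 0 i) <= M.
  rewrite /M (bigD1 i) //= lerDl; apply: sumr_ge0 => j _.
  by rewrite addr_ge0 ?modulus_ge0.
move: hs ht; rewrite !ltr_pdivlMr // => hs ht hM.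
have := modulus_ge0 (v 0 i); have := modulus_ge0 (w 0 i).
have := normr_ge0 s; have := normr_ge0 t.
nra.
Qed.

Lemma is_derive1_realP (u : R -> R) (x l : R) : is_derive x 1 u l ->
  forall e : R, 0 < e -> exists2 r : R, 0 < r & forall y, `|y - x| < r ->
     `|u y - u x - l * (y - x)| <= e * `|y - x|.
Proof.
move=> [du <-] e e0.
have := du; rewrite /derivable => /cvgrPdist_le /(_ _ e0).
rewrite -[lim _]/('D_1 u x) => -[r r0 H]; exists r => // y yr.
have [->|yx] := eqVneq y x; first by rewrite !subrr mulr0 subr0 normr0 mulr0.
have yx0 : y - x != 0 by rewrite subr_eq0.
have := H (y - x); rewrite /ball_ /= sub0r normrN => /(_ yr yx0).
rewrite /GRing.scale /= mulr1 subrK => hb.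
have hn : 0 < `|y - x| by rewrite normr_gt0.
rewrite -(ler_pM2r hn) -normrM in hb; apply: le_trans hb.
by rewrite -normrN le_eqVlt; apply/orP; left; apply/eqP; congr `|_|; field.
Qed.

Lemma rderive_line rho z v (s : R) : rderivable rho (z + toC s *: v) v ->
  is_derive s 1 (fun t : R => rho (z + toC t *: v)) (rderive rho (z + toC s *: v) v).
Proof.
rewrite /rderivable /rderive => dr; apply: is_derive1_real => e e0.
have := @is_derive1_realP (fun t => rho (z + toC s *: v + toC t *: v)) 0 _
  (derivableP dr) e e0.
rewrite -derive1E; set D := derive1 _ _ => -[r r0 H]; exists r => // y yr.
have shift t : z + toC s *: v + toC t *: v = z + toC (s + t) *: v.
  by rewrite -addrA -scalerDl; congr (_ + _ *: _); apply: complex_eqP; rewrite /= ?addr0.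
have := H (y - s); rewrite subr0 => /(_ yr).
by rewrite !shift addr0 (_ : s + (y - s) = y) //; ring.
Qed.

Lemma rderive0 rho z v : rderivable rho z v ->
  is_derive (0 : R) (1 : R) (fun t : R => rho (z + toC t *: v)) (rderive rho z v).
Proof. by rewrite /rderive derive1E => dr; exact: DeriveDef. Qed.

(** [C1_on] speaks of one direction at a time. The increment along [v + w] is split at [p + t v]; by
    the mean value theorem the second piece is a [w]-derivative at a nearby point, and this
    derivative is continuous. *)
Lemma rderiveD U rho p v w : open U -> U p -> C1_on U rho ->
  rderive rho p (v + w) = rderive rho p v + rderive rho p w.
Proof.
move=> oU Up C1; apply/eqP; rewrite -subr_eq0 -normr_le0; apply/ler_addgt0Pl => e e0.
rewrite addr0; set l := rderive rho p v; set m := rderive rho p w.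
set k := rderive rho p (v + w); pose e3 := e / 3.
have e30 : 0 < e3 by rewrite divr_gt0.
have p0 x : p + toC 0 *: x = p by rewrite (_ : toC 0 = 0 :> C) // scale0r addr0.
have dv := rderive0 (proj1 (C1 v p Up)).
have dk := rderive0 (proj1 (C1 (v + w) p Up)).
have [r1 r10 H1] := is_derive1_realP dv e30.
have [r2 r20 H2] := is_derive1_realP dk e30.
have [_ cw] := C1 w p Up.
have nU : nbhs p (U `&` [set x | `|rderive rho x w - m| < e3]).
  apply: filterI; first exact: open_nbhs_nbhs.
  move/cvgrPdist_lt: cw => /(_ _ e30); apply: filterS => x /=.
  by rewrite distrC.
have [r3 r30 H3] := nbhs_plane v w nU.
pose t := Order.min (r1 / 2) (Order.min (r2 / 2) (r3 / 2)).
have t0 : 0 < t by rewrite !lt_min; apply/and3P; split; rewrite divr_gt0.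
have tn : `|t| = t by rewrite gtr0_norm.
have [t1 t2 t3] : [/\ t < r1, t < r2 & t < r3].
  by rewrite /t !gt_min; split; apply/orP; [left|right; apply/orP; left|
    right; apply/orP; right]; lra.
have := H1 t; rewrite !subr0 tn p0 => /(_ t1) h1.
have := H2 t; rewrite !subr0 tn p0 => /(_ t2) h2.
have inU s : 0 <= s <= t -> U (p + toC t *: v + toC s *: w) /\
    `|rderive rho (p + toC t *: v + toC s *: w) w - m| < e3.
  by move=> /andP[s0 s1]; apply: H3; rewrite ?tn // ger0_norm //; lra.
have dw s : 0 <= s <= t -> is_derive s 1
    (fun s => rho (p + toC t *: v + toC s *: w))
    (rderive rho (p + toC t *: v + toC s *: w) w).
  by move=> /inU [Us _]; apply: rderive_line; case: (C1 w _ Us).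
have [||s] := @MVT_segment R (fun s => rho (p + toC t *: v + toC s *: w))
  (fun s => rderive rho (p + toC t *: v + toC s *: w) w) 0 t (ltW t0).
- by move=> x; rewrite in_itv /= => /andP[/ltW ? /ltW ?]; apply: dw; apply/andP.
- by apply: derivable_within_continuous => x; rewrite in_itv /= => /dw [dx _].
rewrite in_itv /= => /inU [_ hs].
rewrite (_ : toC 0 = 0 :> C) // scale0r addr0 subr0 -addrA -scalerDr => E.
rewrite -(ler_pM2r t0) -[X in `|_| * X]tn -normrM.
move: h1 h2 hs E; rewrite /e3.
set D := rderive rho _ w; set a := rho p; set b := rho (p + toC t *: v).
set c := rho (_ + toC t *: (v + w)) => h1 h2 hs E.
move: h1 h2 (ltW hs) t0 E; rewrite !ler_norml -/l -/k.
move: (t) (D) (a) (b) (c) (l) (m) (k) (e); clear.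
move=> t D a b c l m k e /andP[a1 a2] /andP[b1 b2] /andP[c1 c2] t0 E.
have d1 : - (e / 3) * t <= (D - m) * t by rewrite ler_pM2r.
have d2 : (D - m) * t <= (e / 3) * t by rewrite ler_pM2r.
by apply/andP; split; lra.
Qed.

Lemma rderiveZ rho p v (k : R) : rderivable rho p v ->
  rderive rho p (toC k *: v) = k * rderive rho p v.
Proof.
move=> dr; have d0 := rderive0 dr.
have dk : is_derive (0 : R) 1 (fun t : R => k * t) k.
  by apply: is_derive_eq; rewrite /GRing.scale /=; lra.
have d0' : is_derive (k * 0) 1 (fun t : R => rho (p + toC t *: v)) (rderive rho p v).
  by rewrite mulr0.
have := is_derive1_comp d0' dk; rewrite mulrC => -[_ <-].
have E : (fun t : R => rho (p + toC t *: (toC k *: v))) =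
    (fun t : R => rho (p + toC t *: v)) \o *%R k.
  apply/funext => t /=; rewrite scalerA; congr (rho (_ + _ *: _)).
  by apply: complex_eqP; rewrite ?cReM ?cImM /=; ring.
by rewrite /rderive E derive1E.
Qed.

(** Turns the Hermitian product with [eta] into an [lform]. *)
Definition conj_row eta : Cn :=
  \row_i ((complex.Re (eta 0 i) -i* complex.Im (eta 0 i))%C : C).

Lemma cRe_conj_mul (a b : R) (x : C) :
  complex.Re ((a -i* b)%C * x) = complex.Re x * a + complex.Im x * b.
Proof. by case: x => c d; rewrite cReM /=; ring. Qed.

Lemma rderive_grad U rho p v : open U -> U p -> C1_on U rho ->
  rderive rho p v = complex.Re (lform (conj_row (grad rho p)) v).
Proof.
move=> oU Up C1; have dr x := proj1 (C1 x p Up).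
have D := rderiveD _ _ oU Up C1.
have l0 : rderive rho p 0 = 0.
  by rewrite -(scaler0 Cn (toC 0)) rderiveZ // mul0r.
rewrite {1}(row_sum_delta v) (big_morph _ D l0).
rewrite /lform (big_morph (@complex.Re R) (@cReD R) (erefl : complex.Re 0 = 0)).
apply: eq_bigr => i _; set x := v 0 i.
have -> : x *: delta_mx 0 i = toC (complex.Re x) *: (delta_mx 0 i : Cn) +
    toC (complex.Im x) *: (((0 +i* 1)%C : C) *: delta_mx 0 i).
  rewrite scalerA -scalerDl; congr (_ *: _).
  by apply: complex_eqP; rewrite ?cReD ?cImD ?cReM ?cImM /=; ring.
rewrite D !rderiveZ; [|exact: dr..].
set a := rderive rho p (delta_mx 0 i); set b := rderive rho p (_ *: _).
have -> : conj_row (grad rho p) 0 i = (a -i* b)%C by rewrite 2!mxE.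
exact/esym/cRe_conj_mul.
Qed.

Lemma enorm_gt0 v : v != 0 -> 0 < enorm v.
Proof.
move=> v0; rewrite sqrtr_gt0 lt_neqAle eq_sym.
have s0 i : 0 <= complex.Re (v 0 i) ^+ 2 + complex.Im (v 0 i) ^+ 2.
  by rewrite addr_ge0 ?sqr_ge0.
rewrite sumr_ge0 // andbT; apply: contra v0 => /eqP s; apply/eqP/rowP => i.
have /eqP := psumr_eq0P (fun i _ => s0 i) s isT (i := i).
rewrite paddr_eq0 ?sqr_ge0 // !sqrf_eq0 mxE => /andP[/eqP rv /eqP iv].
exact: complex_eqP.
Qed.

Lemma enormZ (k : R) v : enorm (toC k *: v) = `|k| * enorm v.
Proof.
rewrite /enorm -sqrtr_sqr -sqrtrM ?sqr_ge0 // mulr_sumr; congr Num.sqrt.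
by apply: eq_bigr => i _; rewrite mxE cReZ cImZ; ring.
Qed.

Lemma lform_conj_row eta : lform (conj_row eta) eta = toC (enorm eta ^+ 2).
Proof.
rewrite /enorm sqr_sqrtr; last first.
  by apply: sumr_ge0 => i _; rewrite addr_ge0 ?sqr_ge0.
rewrite /lform /toC -[RHS]/((_)%:C%C) rmorph_sum /=; apply: eq_bigr => i _.
rewrite mxE; apply: complex_eqP; rewrite ?cReM ?cImM /=; ring.
Qed.

Lemma conj_rowZ (k : R) eta : conj_row (toC k *: eta) = toC k *: conj_row eta.
Proof.
by apply/rowP => i; rewrite !mxE; apply: complex_eqP; rewrite ?cReM ?cImM /=; ring.
Qed.

Lemma lformZl (k : C) v w : lform (k *: v) w = k * lform v w.
Proof. by rewrite mulr_sumr; apply: eq_bigr => i _; rewrite mxE mulrA. Qed.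

Lemma segment_near Omega z v : open Omega -> Omega z ->
  exists2 r : R, 0 < r & forall t : R, `|t| < r -> Omega (z + toC t *: v).
Proof.
move=> oO Oz; have [r r0 H] := nbhs_plane v 0 (open_nbhs_nbhs (conj oO Oz)).
exists r => // t tr; have := H t 0 tr; rewrite normr0 => /(_ r0).
by rewrite scaler0 addr0.
Qed.

(* [z] is interior: moving [q] to a nearby point of [Omega] only moves [z] a little. *)
Lemma segment_closure Omega z q (t : R) : open Omega -> segment_convex Omega ->
  Omega z -> closure Omega q -> 0 <= t < 1 ->
  Omega (toC (1 - t) *: z + toC t *: q).
Proof.
move=> oO cO Oz cq /andP[t0 t1]; have t10 : 0 < 1 - t by rewrite subr_gt0.
have [e e0 He] := nbhs_rowP (open_nbhs_nbhs (conj oO Oz)).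
pose d := e * (1 - t).
have d0 : 0 < d by rewrite mulr_gt0.
have [q' [Oq' qq]] := cq _ (@row_nbhs q [set x | forall i, modulus (x 0 i - q 0 i) < d]
  d d0 (fun x hx => hx)).
have k0 : toC (1 - t) != 0 :> C.
  by apply/eqP => /(congr1 (@complex.Re R)) /= /eqP; rewrite gt_eqF.
pose z' := z + (toC t / toC (1 - t)) *: (q - q').
have Oz' : Omega z'.
  apply: He => i.
  have -> : z' 0 i - z 0 i = toC t / toC (1 - t) * (q 0 i - q' 0 i).
    by rewrite !mxE; ring.
  rewrite !modulusM toCV !modulus_toC !ger0_norm ?invr_ge0 ?(ltW t10) //.
  have := qq i; rewrite modulusB /d => hq; rewrite mulrAC ltr_pdivrMr //.
  apply: le_lt_trans hq; rewrite ler_piMl ?modulus_ge0 //; exact: ltW.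
rewrite (_ : _ + _ = toC (1 - t) *: z' + toC t *: q').
  by apply: cO; rewrite // t0 ltW.
rewrite /z' scalerDr scalerA mulrCA divff // mulr1 scalerBr.
by rewrite -[RHS]addrA subrK.
Qed.

Section SupportingFunctional.
Variables (Omega : set Cn) (p eta : Cn).
Hypotheses (oO : open Omega) (cO : segment_convex Omega) (nO : Omega !=set0).
Hypotheses (bp : boundary Omega p) (neta : inner_unit_normal Omega p eta).

Lemma boundary_notin q : boundary Omega q -> ~ Omega q.
Proof. by move=> [_ nq] Oq; apply: nq; rewrite /interior; exact: open_nbhs_nbhs. Qed.

(** Here [l] is the real differential of a defining function, which is hidden from now on. Convexity
    makes [l] nonpositive towards [Omega]; the first-order expansion makes directions with [l v < 0]
    enter [Omega]. *)
Lemma inner_normal_tangent : exists l : Cn -> R, exists2 N : R, 0 < N &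
  [/\ forall v, l v = - N * complex.Re (lform (conj_row eta) v),
      enorm eta = 1,
      forall z, Omega z -> l (z - p) <= 0 &
      forall v, l v < 0 -> exists2 t0 : R, 0 < t0 &
        forall t, 0 < t <= t0 -> Omega (p + toC t *: v)].
Proof.
have [U [rho [[oU Up C1 g0 def] etaE]]] := neta.
set g := grad rho p in etaE.
have N0 : 0 < enorm g := enorm_gt0 (g0 p Up).
exists (rderive rho p), (enorm g) => //.
have lE v : rderive rho p v = - enorm g * complex.Re (lform (conj_row eta) v).
  rewrite (rderive_grad v oU Up C1) -/g etaE -scaleNr.
  rewrite (_ : - toC _ = toC (- (enorm g)^-1)); last first.
    by apply: complex_eqP; rewrite ?cReN ?cImN /= ?oppr0.
  by rewrite conj_rowZ lformZl cReZ; field; rewrite gt_eqF.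
have etaN : enorm eta = 1.
  rewrite etaE -scaleNr (_ : - toC _ = toC (- (enorm g)^-1)); last first.
    by apply: complex_eqP; rewrite ?cReN ?cImN /= ?oppr0.
  by rewrite enormZ normrN gtr0_norm ?invr_gt0 // mulVf // gt_eqF.
have der v := rderive0 (proj1 (C1 v p Up)).
have near_U v : exists2 r : R, 0 < r & forall t : R, `|t| < r -> U (p + toC t *: v).
  exact: segment_near.
have p0 x : p + toC 0 *: x = p by rewrite (_ : toC 0 = 0 :> C) // scale0r addr0.
have rp0 : 0 <= rho p.
  by rewrite leNgt; apply/negP => /def -/(_ Up) /(boundary_notin bp).
have inO z t : Omega z -> 0 < t <= 1 -> Omega (p + toC t *: (z - p)).
  move=> Oz /andP[t0 t1].
  have := @segment_closure Omega z p (1 - t) oO cO Oz (proj1 bp).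
  rewrite subr_ge0 t1 gtrBl t0 => /(_ isT); congr Omega.
  apply/rowP => i; rewrite !mxE; apply: complex_eqP; rewrite ?cReD ?cImD ?cReM ?cImM /=; ring.
have expand v (e : R) : 0 < e -> exists2 r : R, 0 < r & forall t : R, 0 < t < r ->
    U (p + toC t *: v) /\ `|rho (p + toC t *: v) - rho p - rderive rho p v * t| <= e * t.
  move=> e0; have [r1 r10 H1] := near_U v; have [r2 r20 H2] := is_derive1_realP (der v) e0.
  exists (Order.min r1 r2); first by rewrite lt_min r10.
  move=> t /andP[t0]; rewrite lt_min => /andP[tr1 tr2].
  split; first by apply: H1; rewrite gtr0_norm.
  by have := H2 t; rewrite subr0 p0 gtr0_norm //; apply.
have [z0 Oz0] := nO.
have neg z : Omega z -> exists2 r : R, 0 < r & forall t : R, 0 < t < r ->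
    rho (p + toC t *: (z - p)) < 0.
  move=> Oz; have [r1 r10 H1] := near_U (z - p); exists (Order.min r1 1).
    by rewrite lt_min r10 ltr01.
  move=> t /andP[t0]; rewrite lt_min => /andP[tr1 t1].
  have Ut : U (p + toC t *: (z - p)) by apply: H1; rewrite gtr0_norm.
  by apply/(def _ Ut); apply: inO => //; rewrite t0 ltW.
(* The definition only says where [rho] is negative. If [rho p > 0], the expansion would keep [rho]
   positive near [p] on the segment to [z0], which runs inside [Omega]; the first entry of [t]
   limits the loss [(|l| + 1) t] to half of [rho p]. *)
have rpE : rho p = 0.
  apply/eqP; rewrite eq_le rp0 andbT leNgt; apply/negP => rpp.
  have [r1 r10 H1] := expand (z0 - p) 1 ltr01; have [r2 r20 H2] := neg z0 Oz0.
  set l := rderive rho p (z0 - p) in H1; have l0 := normr_ge0 l.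
  pose t := Order.min (rho p / (2 * (`|l| + 1))) (Order.min (r1 / 2) (r2 / 2)).
  have l1 : 0 < 2 * (`|l| + 1) by lra.
  have t0 : 0 < t by rewrite !lt_min !divr_gt0.
  have [t1 t2 t3] : [/\ t < r1, t < r2 & t <= rho p / (2 * (`|l| + 1))].
    rewrite /t !gt_min !ge_min lexx; split=> //; apply/orP; right; apply/orP;
    by [left; lra|right; lra].
  have [_] := H1 t (introT andP (conj t0 t1)).
  have := H2 t; rewrite t0 t2 => /(_ isT) hneg.
  rewrite ler_norml => /andP[+ _]; rewrite mul1r.
  move: t3; rewrite ler_pdivlMr //; have := ler_norm (- l); rewrite normrN.
  nra.
split=> //.
- move=> z Oz; rewrite leNgt; apply/negP => l0.
  have l20 : 0 < rderive rho p (z - p) / 2 by rewrite divr_gt0.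
  have [r1 r10 H1] := expand (z - p) _ l20; have [r2 r20 H2] := neg z Oz.
  pose t := Order.min (r1 / 2) (r2 / 2).
  have t0 : 0 < t by rewrite lt_min !divr_gt0.
  have [t1 t2] : t < r1 /\ t < r2.
    by rewrite /t !gt_min; split; apply/orP; [left|right]; lra.
  have [_] := H1 t (introT andP (conj t0 t1)).
  have := H2 t; rewrite t0 t2 rpE subr0 => /(_ isT) hneg.
  by rewrite ler_norml => /andP[+ _]; nra.
- move=> v l0; have l20 : 0 < - rderive rho p v / 2 by rewrite divr_gt0 // oppr_gt0.
  have [r r0 H] := expand v _ l20; exists (r / 2); first by rewrite divr_gt0.
  move=> t /andP[t0 tr]; have tr' : t < r by lra.
  have [Ut] := H t (introT andP (conj t0 tr')).
  rewrite rpE subr0 ler_norml => /andP[_ h]; apply/(def _ Ut).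
  nra.
Qed.

Lemma supporting_functional :
  [/\ enorm eta = 1, lform (conj_row eta) eta = 1,
      forall z, Omega z -> 0 < complex.Re (lform (conj_row eta) (z - p)) &
      forall v, 0 < complex.Re (lform (conj_row eta) v) -> exists2 t0 : R, 0 < t0 &
        forall t, 0 < t <= t0 -> Omega (p + toC t *: v)].
Proof.
have [l [N N0 [lE eta1 l_le l_in]]] := inner_normal_tangent.
have le1 : lform (conj_row eta) eta = 1 by rewrite lform_conj_row eta1 expr1n.
split=> //.
(* Strict positivity comes from openness: a small shift by [- eta] stays in [Omega]. *)
- move=> z Oz; have [r r0 H] := segment_near (- eta) oO Oz.
  have := l_le _ (H (r / 2) _); rewrite gtr0_norm ?divr_gt0 // => /(_ _).
  rewrite lE addrAC lformD lformZ lformN le1 mulNr oppr_le0 pmulr_rge0 //.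
  have -> : toC (r / 2) * -1 = toC (- (r / 2)) :> C.
    by apply: complex_eqP; rewrite ?cReM ?cImM /=; ring.
  by rewrite cReD /=; lra.
- by move=> v v0; apply: l_in; rewrite lE mulNr oppr_lt0 mulr_gt0.
Qed.

(** A complex hyperplane through [p] that misses [Omega] must lie in the kernel of [c]: a direction
    with [c <> 0] could be multiplied by a complex scalar so as to point into [Omega] without
    leaving the hyperplane. *)
Lemma multiface_tangent : multiface Omega p <> [set p] ->
  exists q, [/\ q != p, boundary Omega q & lform (conj_row eta) (q - p) = 0].
Proof.
have [_ le1 lpos l_in] := supporting_functional; set c := conj_row eta in le1 lpos l_in *.
have c0 : c != 0.
  apply/eqP => c0; move: le1; rewrite c0 /lform big1 => [/eqP|i _].
    by rewrite eq_sym oner_eq0.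
  by rewrite mxE mul0r.
(* The hyperplane [c z = c p] puts [p] into its own multiface, so a multiface other than [{p}] must
   contain a second point. *)
have mp : multiface Omega p p.
  pose H := [set z : Cn | \sum_(i < n) c 0 i * z 0 i = lform c p].
  exists (boundary Omega `&` H) => //; split=> //; exists H; split=> //.
    by exists c, (lform c p).
  rewrite -subset0 => z [Hz /lpos]; rewrite lformB.
  by rewrite (_ : lform c z = lform c p) // subrr ltxx.
move=> neq; have [q [[F [[H [[a [k [a0 HE]]] HO FE] Fp] Fq]] qp]] :
    exists q, multiface Omega p q /\ q != p.
  apply: contrapT => /forallNP nq; apply: neq; rewrite eqEsubset; split=> z.
    by move=> mz; apply/eqP/negPn/negP => zp; exact: (nq z).
  by move->.
exists q; split; [exact: qp|by move: Fq; rewrite FE => -[]|].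
apply/eqP/negPn/negP => l0; pose v := (lform c (q - p))^-1 *: (q - p).
have lv : lform c v = 1 by rewrite lformZ mulVf.
have [|t0 t00 Ht] := l_in v; first by rewrite lv ltr01.
have := Ht t0; rewrite t00 lexx => /(_ isT) Ov.
suff : (H `&` Omega) (p + toC t0 *: v) by rewrite HO.
split=> //; move: Fp Fq; rewrite FE HE => -[_ /= Hp] [_ /= Hq].
rewrite -/(lform a _) lformD /v !lformZ (lformB a).
by rewrite (_ : lform a q = k) // (_ : lform a p = k) // subrr !mulr0 addr0.
Qed.

End SupportingFunctional.

End Tangent.

(** * Moving discs in convex domains *)

Section AffineCombinations.
Context {K : numFieldType} {n : nat}.
Implicit Types (p q e w : 'rV[K]_n).

Lemma comb_four p e w (k1 k2 k3 k4 k5 k6 r u1 u2 u3 u4 z t : K) :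
  k1 * (k2 + k3) + k4 * (k5 + k6) = 1 ->
  k1 * (k2 * u1 + k3 * u2) + k4 * (k5 * u3 + k6 * u4) = z * t / r -> r != 0 ->
  k1 *: (k2 *: (p + r *: (e + u1 *: w)) + k3 *: (p + r *: (e + u2 *: w)))
  + k4 *: (k5 *: (p + r *: (e + u3 *: w)) + k6 *: (p + r *: (e + u4 *: w)))
  = p + r *: e + z *: (t *: w).
Proof.
move=> h1 h2 r0; apply/rowP => i; rewrite !mxE.
have -> : z * (t * w 0 i) = z * t / r * (r * w 0 i) by field.
rewrite -h2 -[p 0 i in RHS]mul1r -[r * e 0 i in RHS]mul1r -h1.
ring.
Qed.

Lemma comb_base p e (k1 k2 r r' : K) : k1 + k2 = 1 -> k1 * r' = r ->
  k1 *: (p + r' *: e) + k2 *: p = p + r *: e.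
Proof.
move=> h1 h2; apply/rowP => i; rewrite !mxE -h2.
by rewrite -[p 0 i in RHS]mul1r -h1; ring.
Qed.

Lemma comb_normal p e (k1 k2 r r1 r2 : K) : k1 + k2 = 1 -> k1 * r1 + k2 * r2 = r ->
  k1 *: (p + r1 *: e) + k2 *: (p + r2 *: e) = p + r *: e.
Proof.
move=> h1 h2; apply/rowP => i; rewrite !mxE -h2.
by rewrite -[p 0 i in RHS]mul1r -h1; ring.
Qed.

Lemma comb_face p q e (k1 k2 r r1 : K) : k1 + k2 = 1 -> k1 * r1 = r ->
  k1 *: (p + r1 *: e) + k2 *: q = p + r *: e + k2 *: (q - p).
Proof.
move=> h1 h2; apply/rowP => i; rewrite !mxE -h2.
have -> : k1 = 1 - k2 by rewrite -h1 addrK.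
ring.
Qed.

Lemma comb_cancel e w (x y s a b t z k m : K) :
  x * y * s * a + t * z * k = 0 -> x * y * s * b = m ->
  x *: (y *: (s *: (a *: e + b *: w))) + t *: (z *: (k *: e)) = m *: w.
Proof.
move=> h1 h2; apply/rowP => i; rewrite !mxE -h2.
rewrite [LHS](_ : _ = (x * y * s * a + t * z * k) * e 0 i + x * y * s * b * w 0 i).
  by rewrite h1 mul0r add0r.
ring.
Qed.

End AffineCombinations.

Section NormalDiscs.
Context {R : realType} {n : nat}.
Local Notation C := (cplx R).
Local Notation Cn := 'rV[cplx R]_n.
Variables (Omega : set Cn) (p eta c : Cn).
Hypotheses (oO : open Omega) (cO : segment_convex Omega).
Hypotheses (cp : closure Omega p) (ceta : lform c eta = 1).
Hypothesis lpos : forall z, Omega z -> 0 < complex.Re (lform c (z - p)).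
Hypothesis l_in : forall v, 0 < complex.Re (lform c v) -> exists2 t0 : R, 0 < t0 &
  forall t, 0 < t <= t0 -> Omega (p + toC t *: v).

Local Notation pt r := (p + toC r *: eta).

Lemma toC_neq0 (t : R) : t != 0 -> toC t != 0 :> C.
Proof. by apply: contra => /eqP /(congr1 (@complex.Re R)) /= ->. Qed.

Lemma disc_at_scale z w (k k' : R) : 0 <= k <= k' -> disc_at Omega z (toC k' *: w) ->
  disc_at Omega z (toC k *: w).
Proof.
move=> /andP[k0 kk]; have [k'0|k'0] := eqVneq k' 0.
  by have -> : k = k' by apply/eqP; rewrite eq_le kk k'0 k0.
have k'p : 0 < k' by rewrite lt_neqAle eq_sym k'0 (le_trans k0).
move=> /(@disc_atZ R n Omega z _ (toC (k / k'))); rewrite modulus_toC.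
rewrite ger0_norm ?divr_ge0 ?(ltW k'p) //.
rewrite ler_pdivrMr // mul1r kk => /(_ isT); rewrite scalerA; congr (disc_at _ _ (_ *: _)).
by apply: complex_eqP; rewrite ?cReM ?cImM /=; field.
Qed.

(** The threshold in [l_in] depends on the direction, so it is used only for the four directions
    [eta + u m w] with [u] one of [1, -1, i, -i]; convexity fills in the discs. The choice of [m]
    keeps the real part of [c] at least [1 / 2] on them. *)
Lemma disc_at_normal w : exists k t0 : R, [/\ 0 < k, 0 < t0 & forall r, 0 < r <= t0 ->
  disc_at Omega (pt r) (toC (k * r) *: w)].
Proof.
pose m : R := (2 * (modulus (lform c w) + 1))^-1.
have mw := modulus_ge0 (lform c w).
have m0 : 0 < m by rewrite invr_gt0; lra.
have mm : m * modulus (lform c w) <= 1 / 2.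
  by rewrite mulrC ler_pdivrMr; lra.
have step (u : C) : modulus u <= 1 -> exists2 t0 : R, 0 < t0 &
    forall r, 0 < r <= t0 -> Omega (p + toC r *: (eta + (u * toC m) *: w)).
  move=> u1; apply: l_in; rewrite lformD ceta lformZ cReD /=.
  have := normr_Re_le (u * toC m * lform c w).
  rewrite !modulusM modulus_toC (gtr0_norm m0) ler_norml => /andP[+ _].
  have : modulus u * m * modulus (lform c w) <= 1 / 2.
    by rewrite -mulrA; have := modulus_ge0 u; nra.
  lra.
have im1 : modulus ((0 +i* 1)%C : C) <= 1.
  by rewrite modulusE /= expr0n expr1n add0r sqrtr1.
have m1 : modulus (1 : C) <= 1 by rewrite modulus1.
have mn1 : modulus (- 1 : C) <= 1 by rewrite modulusN.
have imn1 : modulus (- (0 +i* 1)%C : C) <= 1 by rewrite modulusN.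
have [t1 t10 H1] := step _ m1; have [t2 t20 H2] := step _ mn1.
have [t3 t30 H3] := step _ im1; have [t4 t40 H4] := step _ imn1.
(* For [u = a + i b], the horizontal pair is mixed to produce [a] and the vertical pair to produce
   [i b]; averaging the two results halves [m]. *)
exists (m / 2), (Order.min (Order.min t1 t2) (Order.min t3 t4)).
split; [by rewrite divr_gt0|by rewrite !lt_min t10 t20 t30|].
move=> r /andP[r0]; rewrite !le_min => /andP[/andP[r1 r2] /andP[r3 r4]].
apply: disc_at_affine => -[a b] u1.
have ha := le_lt_trans (normr_Re_le _) u1; have hb := le_lt_trans (normr_Im_le _) u1.
move: ha hb; rewrite /= !ltr_norml => /andP[a1 a2] /andP[b1 b2].
have O1 := H1 r (introT andP (conj r0 r1)); have O2 := H2 r (introT andP (conj r0 r2)).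
have O3 := H3 r (introT andP (conj r0 r3)); have O4 := H4 r (introT andP (conj r0 r4)).
have ha : 0 <= (1 - a) / 2 <= 1 by apply/andP; split; lra.
have hb : 0 <= (1 - b) / 2 <= 1 by apply/andP; split; lra.
have h2 : 0 <= (1 / 2 : R) <= 1 by apply/andP; split; lra.
apply: (eq_ind _ Omega (cO (cO O1 O2 ha) (cO O3 O4 hb) h2)).
apply: comb_four; last by apply: toC_neq0; rewrite gt_eqF.
  by apply: complex_eqP; rewrite ?(cReD, cImD, cReM, cImM) /=; field.
rewrite toCV; apply: complex_eqP;
  by rewrite ?(cReD, cImD, cReN, cImN, cReM, cImM) /=; field; rewrite ?gt_eqF //.
Qed.

Lemma pt_in : exists2 t0 : R, 0 < t0 & forall r, 0 < r <= t0 -> Omega (pt r).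
Proof. by apply: l_in; rewrite ceta ltr01. Qed.

Section Transport.
Variables (R0 : R).
Hypotheses (R00 : 0 < R0) (ptR0 : forall r, 0 < r <= R0 -> Omega (pt r)).

(** Downwards, the homothety towards [p] costs the factor [r / r']. Upwards, the one towards the
    interior point at radius [R0] costs at most [1 / 2], since both radii are at most [R0 / 2]. *)
Lemma disc_at_move w (r r' k : R) : 0 < r <= R0 / 2 -> 0 < r' <= R0 / 2 ->
  0 <= k <= 1 / 2 -> k <= r / r' -> disc_at Omega (pt r') w ->
  disc_at Omega (pt r) (toC k *: w).
Proof.
move=> /andP[r0 rR] /andP[r'0 r'R] /andP[k0 k2] kr D.
have [rr'|r'r] := leP r r'.
  pose t := 1 - r / r'.
  have t01 : 0 <= t < 1.
    rewrite /t subr_ge0 ler_pdivrMr // mul1r rr' /=.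
    by rewrite ltrBlDr ltrDl divr_gt0.
  have := disc_at_shrink (fun x Ox => segment_closure oO cO Ox cp t01) D.
  have -> : toC (1 - t) *: pt r' + toC t *: p = pt r.
    apply: comb_base; rewrite /t; apply: complex_eqP;
      by rewrite ?(cReD, cImD, cReM, cImM) /=; field; rewrite ?gt_eqF //.
  apply: disc_at_scale; rewrite k0 /t; lra.
have R0r' : 0 < R0 - r' by lra.
pose t := (r - r') / (R0 - r').
have t0 : 0 <= t by rewrite divr_ge0 //; lra.
have t2 : t <= 1 / 2 by rewrite ler_pdivrMr //; lra.
have OR : Omega (pt R0) by apply: ptR0; rewrite R00 lexx.
have t01 : 0 <= t < 1 by rewrite t0; lra.
have := disc_at_shrink (fun x Ox => segment_closure oO cO Ox (subset_closure OR) t01) D.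
have -> : toC (1 - t) *: pt r' + toC t *: pt R0 = pt r.
  apply: comb_normal; rewrite /t; apply: complex_eqP;
    by rewrite ?(cReD, cImD, cReM, cImM) /=; field; rewrite ?gt_eqF //.
by apply: disc_at_scale; rewrite k0 /=; lra.
Qed.

Lemma disc_at_move_face q w (r r' x k : R) : closure Omega q ->
  0 < r <= R0 / 4 -> 0 < r' <= R0 / 2 ->
  0 <= x <= 1 / 2 -> 0 <= k <= 1 / 2 -> k <= r / r' -> disc_at Omega (pt r') w ->
  disc_at Omega (pt r + toC x *: (q - p)) (toC (k / 2) *: w).
Proof.
move=> cq /andP[r0 rR] hr' /andP[x0 x2] hk kr D.
have x1 : 0 < 1 - x by lra.
(* The homothety of ratio [1 - x] towards [q] brings this radius back to [r]. As [x <= 1 / 2], the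
   radius at most doubles, which is why [r <= R0 / 4] is assumed. *)
pose r1 := r / (1 - x).
have r1r : r <= r1 by rewrite ler_pdivlMr //; nra.
have r1R : r1 <= R0 / 2 by rewrite ler_pdivrMr //; nra.
have hr1 : 0 < r1 <= R0 / 2 by rewrite r1R divr_gt0.
have k1 : k <= r1 / r'.
  by apply: le_trans kr _; rewrite ler_pM2r // invr_gt0; case/andP: hr'.
have x01 : 0 <= x < 1 by rewrite x0; lra.
have := disc_at_shrink (fun x Ox => segment_closure oO cO Ox cq x01)
  (disc_at_move hr1 hr' hk k1 D).
have -> : toC (1 - x) *: pt r1 + toC x *: q = pt r + toC x *: (q - p).
  apply: comb_face; rewrite /r1; apply: complex_eqP;
    by rewrite ?(cReD, cImD, cReM, cImM) /=; field; rewrite ?gt_eqF //.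
rewrite scalerA -/(toC _) (_ : toC (1 - x) * toC k = toC ((1 - x) * k)); last first.
  by apply: complex_eqP; rewrite ?(cReM, cImM) /=; ring.
by apply: disc_at_scale; move: hk => /andP[k0 _]; apply/andP; split; nra.
Qed.

End Transport.

End NormalDiscs.

(** Dimension two enters here: a disc direction without component along [eta] is a complex multiple
    of [tau]. *)
Lemma kernel_line (K : numFieldType) (c e t u : 'rV[K]_2) :
  lform c e != 0 -> t != 0 -> lform c t = 0 -> lform c u = 0 ->
  exists b : K, u = b *: t.
Proof.
pose i1 : 'I_2 := lift ord0 ord0.
have lE x : lform c x = c 0 ord0 * x 0 ord0 + c 0 i1 * x 0 i1.
  by rewrite /lform !big_ord_recl big_ord0 addr0.
rewrite !lE => ce t0 ct cu.
have ext (x y : 'rV[K]_2) : x 0 ord0 = y 0 ord0 -> x 0 i1 = y 0 i1 -> x = y.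
  move=> h0 h1; apply/rowP => i; case: (unliftP ord0 i) => [j ->|-> //].
  by rewrite (ord1 j).
have [t00|t00] := eqVneq (t 0 ord0) 0; last first.
  have c1 : c 0 i1 != 0.
    apply: contra ce => /eqP c1; move: ct; rewrite c1 !mul0r !addr0 => /eqP.
    by rewrite mulf_eq0 (negPf t00) orbF => /eqP ->; rewrite mul0r.
  exists (u 0 ord0 / t 0 ord0); apply: ext; rewrite mxE; first by field.
  apply: (mulfI c1); have -> : c 0 i1 * u 0 i1 = - (c 0 ord0 * u 0 ord0).
    by apply/eqP; rewrite -addr_eq0 addrC cu.
  have -> : c 0 i1 * (u 0 ord0 / t 0 ord0 * t 0 i1) =
    u 0 ord0 / t 0 ord0 * (c 0 i1 * t 0 i1) by ring.
  have -> : c 0 i1 * t 0 i1 = - (c 0 ord0 * t 0 ord0).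
    by apply/eqP; rewrite -addr_eq0 addrC ct.
  by field.
have t1 : t 0 i1 != 0.
  by apply: contra t0 => /eqP t1; apply/eqP; apply: ext; rewrite ?t00 ?t1 mxE.
have c1 : c 0 i1 = 0.
  by move: ct; rewrite t00 mulr0 add0r => /eqP; rewrite mulf_eq0 (negPf t1) orbF => /eqP.
have c0 : c 0 ord0 != 0 by apply: contra ce => /eqP ->; rewrite c1 !mul0r addr0.
have u0 : u 0 ord0 = 0.
  by move: cu; rewrite c1 mul0r addr0 => /eqP; rewrite mulf_eq0 (negPf c0) => /eqP.
exists (u 0 i1 / t 0 i1); apply: ext; rewrite mxE; first by rewrite t00 u0 mulr0.
by field.
Qed.

(** A consequence of the parallelogram law that serves as a triangle inequality up to a constant. *)
Lemma enorm_sqrD (R : realType) n (v w : 'rV[cplx R]_n) :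
  enorm (v + w) ^+ 2 <= 2 * enorm v ^+ 2 + 2 * enorm w ^+ 2.
Proof.
have e2 (x : 'rV[cplx R]_n) : enorm x ^+ 2 =
    \sum_(i < n) (complex.Re (x 0 i) ^+ 2 + complex.Im (x 0 i) ^+ 2).
  by rewrite sqr_sqrtr //; apply: sumr_ge0 => i _; rewrite addr_ge0 ?sqr_ge0.
rewrite !e2 !mulr_sumr -big_split /=; apply: ler_sum => i _.
rewrite mxE cReD cImD.
have := sqr_ge0 (complex.Re (v 0 i) - complex.Re (w 0 i)).
by have := sqr_ge0 (complex.Im (v 0 i) - complex.Im (w 0 i)); lra.
Qed.

Lemma enorm_sqrZ (R : realType) n (k : cplx R) (v : 'rV[cplx R]_n) :
  enorm (k *: v) ^+ 2 = modulus k ^+ 2 * enorm v ^+ 2.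
Proof.
have e2 (x : 'rV[cplx R]_n) : enorm x ^+ 2 =
    \sum_(i < n) (complex.Re (x 0 i) ^+ 2 + complex.Im (x 0 i) ^+ 2).
  by rewrite sqr_sqrtr //; apply: sumr_ge0 => i _; rewrite addr_ge0 ?sqr_ge0.
rewrite !e2 mulr_sumr; apply: eq_bigr => i _.
by rewrite mxE sqr_modulus cReM cImM; ring.
Qed.

(** * From discs in any direction to discs along the face *)

Section TangentialDiscs.
Context {R : realType}.
Local Notation C := (cplx R).
Local Notation Cn := 'rV[cplx R]_2.
Variables (Omega : set Cn) (p eta c tau : Cn).
Hypotheses (oO : open Omega) (cO : segment_convex Omega).
Hypotheses (cp : closure Omega p) (ceta : lform c eta = 1) (eta1 : enorm eta = 1).
Hypothesis lpos : forall z, Omega z -> 0 < complex.Re (lform c (z - p)).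
Hypothesis l_in : forall v, 0 < complex.Re (lform c v) -> exists2 t0 : R, 0 < t0 &
  forall t, 0 < t <= t0 -> Omega (p + toC t *: v).
Hypotheses (ctau : lform c tau = 0) (tau0 : tau != 0).

Local Notation pt r := (p + toC r *: eta).

(* If [v] has a small component along [tau], then [s] is at most a multiple of [r]
   by the half-plane bound; otherwise the component along [eta], also controlled
   by that bound, is cancelled against a disc of radius comparable to [r]. *)
Lemma disc_at_tangential : exists k0 R0 : R, [/\ 0 < k0, 0 < R0,
  forall r, 0 < r <= R0 -> Omega (pt r) &
  forall r r' s v, 0 < r' <= r -> r <= R0 / 2 -> enorm v = 1 -> 0 < s ->
    disc_at Omega (pt r') (toC s *: v) -> disc_at Omega (pt r) (toC (k0 * s) *: tau)].
Proof.
have half_sqr (x y : R) : 0 <= x -> x < 1 / 2 -> 0 <= y -> y < 1 / 2 ->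
    1 <= 2 * x ^+ 2 + 2 * y ^+ 2 -> False by move=> *; nra.
have [k1 [t1 [k10 t10 D1]]] := disc_at_normal cO ceta l_in eta.
have [k2 [t2 [k20 t20 D2]]] := disc_at_normal cO ceta l_in tau.
have [t3 t30 D3] := pt_in ceta l_in.
pose N := enorm tau; have N0 : 0 < N := enorm_gt0 tau0.
pose R0 := Order.min t1 (Order.min t2 t3).
have R00 : 0 < R0 by rewrite !lt_min t10 t20.
have [R1 R2 R3] : [/\ R0 <= t1, R0 <= t2 & R0 <= t3].
  by rewrite !ge_min !lexx !orbT.
(* If [modulus b < b0], then [b *: tau] is shorter than [1 / 2], and [enorm v = 1] forces
   [modulus a >= 1 / 2]. *)
pose b0 := (2 * N)^-1; have b00 : 0 < b0 by rewrite invr_gt0 mulr_gt0.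
(* Chosen so that [(1 - t) / t = k1 / 4]; the correction [z] below then has modulus at most
   [modulus a * s / (8 * r) <= 1]. *)
pose t := 4 / (4 + k1); have k14 : 0 < 4 + k1 by lra.
have t0 : 0 < t by rewrite divr_gt0.
have t1' : t < 1 by rewrite ltr_pdivrMr //; lra.
(* The two entries serve the two cases: what is left of [b] after the cancellation, and
   [s <= 16 * r] against the disc of size [k2 * r]. *)
pose k0 := Order.min ((1 - t) * b0 / 2) (k2 / 16).
have k00 : 0 < k0.
  by rewrite lt_min divr_gt0 ?mulr_gt0 ?subr_gt0 //= divr_gt0.
have ptin r : 0 < r <= R0 -> Omega (pt r).
  by move=> /andP[r0 rR]; apply: D3; rewrite r0 (le_trans rR).
exists k0, R0; split=> // r r' s v /andP[r'0 r'r] rR v1 s0 D.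
have r0 : 0 < r := lt_le_trans r'0 r'r.
pose a := lform c v.
have [b vE] : exists b, v - a *: eta = b *: tau.
  apply: (@kernel_line C c eta) => //; first by rewrite ceta oner_eq0.
  by rewrite lformB lformZ ceta mulr1 subrr.
have {}vE : v = a *: eta + b *: tau by rewrite -vE addrC subrK.
have as8 : modulus a * s <= 8 * r'.
  have := disc_at_halfplane lpos D; rewrite lformZ modulusM modulus_toC gtr0_norm //.
  by rewrite addrC addKr lformZ ceta mulr1 mulrC.
have [bs|bl] := leP b0 (modulus b); last first.
  have a2 : 1 / 2 <= modulus a.
    rewrite leNgt; apply/negP => a2.
    have := enorm_sqrD (a *: eta) (b *: tau); rewrite -vE v1 !enorm_sqrZ eta1 -/N.
    have bN : modulus b * N < 1 / 2.
      by move: bl; rewrite /b0 invfM -ltr_pdivrMr ?invr_gt0 // invrK div1r.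
    have -> : modulus b ^+ 2 * N ^+ 2 = (modulus b * N) ^+ 2 by ring.
    have bN0 : 0 <= modulus b * N by rewrite mulr_ge0 ?modulus_ge0 // ltW.
    rewrite !expr1n mulr1 => h; exact: (half_sqr _ _ (modulus_ge0 a) a2 bN0 bN h).
  have r1 : 0 < r <= t2 by rewrite r0; lra.
  have s16 : s <= 16 * r by nra.
  apply: disc_at_scale (D2 r r1); apply/andP; split; first by rewrite mulr_ge0 // ltW.
  have kk : k0 <= k2 / 16 by rewrite ge_min lexx orbT.
  nra.
have r1 : 0 < r <= t1 by rewrite r0; lra.
have hr : 0 < r <= R0 / 2 by rewrite r0.
have hr' : 0 < r' <= R0 / 2 by rewrite r'0; lra.
have h2 : 0 <= (1 / 2 : R) <= 1 / 2 by apply/andP; split; lra.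
have hk : 1 / 2 <= r / r' by rewrite ler_pdivlMr //; lra.
have E1 := disc_at_move oO cO cp R00 ptin hr hr' h2 hk D.
(* Solves [(1 - t) * (s / 2) * a + t * z * (k1 * r) = 0], so that the component along [eta]
   cancels. *)
pose z : C := - (toC ((1 - t) / t * (s / 2) / (k1 * r)) * a).
have k1r : 0 < k1 * r by rewrite mulr_gt0.
have mz : modulus z <= 1.
  rewrite /z modulusN modulusM modulus_toC.
  have tE : (1 - t) / t = k1 / 4 by rewrite /t; field; rewrite gt_eqF.
  rewrite tE ger0_norm; last by rewrite !divr_ge0 ?mulr_ge0 ?divr_ge0 // ltW.
  by rewrite mulrAC ler_pdivrMr //; nra.
have E2 := disc_atZ mz (D1 r r1).
have t01 : 0 <= t <= 1 by rewrite !ltW.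
have := disc_at_comb cO t01 E1 E2.
have -> : toC (1 - t) *: pt r + toC t *: pt r = pt r.
  rewrite -scalerDl (_ : toC (1 - t) + toC t = 1) ?scale1r //.
  by apply: complex_eqP; rewrite ?cReD ?cImD /=; ring.
have bp : 0 < modulus b := lt_le_trans b00 bs.
have -> : toC (1 - t) *: (toC (1 / 2) *: (toC s *: v)) +
   toC t *: (z *: (toC (k1 * r) *: eta)) = (toC ((1 - t) * s / 2) * b) *: tau.
  rewrite vE; apply: comb_cancel.
    rewrite /z; apply: complex_eqP;
      rewrite ?(cReD, cImD, cReN, cImN, cReM, cImM) /=; field;
      by rewrite ?gt_eqF.
  by apply: complex_eqP; rewrite ?(cReM, cImM) /=; field.
move=> F.
(* Rotating the disc makes its complex coefficient along [tau] real and positive. *)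
have mb : modulus (toC (modulus b) / b) <= 1.
  by rewrite modulusM modulusV modulus_toC gtr0_norm // divff ?gt_eqF.
have := disc_atZ mb F; rewrite scalerA.
have -> : toC (modulus b) / b * (toC ((1 - t) * s / 2) * b) =
    toC (modulus b * ((1 - t) * s / 2)).
  have b1 : b != 0 by rewrite -modulus_gt0.
  have -> : toC (modulus b * ((1 - t) * s / 2)) =
      toC (modulus b) * toC ((1 - t) * s / 2) :> C.
    by apply: complex_eqP; rewrite ?(cReM, cImM) /=; ring.
  by field.
apply: disc_at_scale; apply/andP; split; first by rewrite mulr_ge0 // ltW.
have kk : k0 <= (1 - t) * b0 / 2 by rewrite ge_min lexx.
have : k0 * s <= (1 - t) * b0 / 2 * s by rewrite ler_pM2r.
move/le_trans; apply.
have -> : modulus b * ((1 - t) * s / 2) = (1 - t) * modulus b / 2 * s by ring.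
by rewrite ler_pM2r // ler_pM2r // ler_pM2l // subr_gt0.
Qed.

End TangentialDiscs.

(** * Dyadic sums of the Goldilocks integral *)

Section DyadicIntegral.
Context {R : realType}.
Implicit Types (f g : R -> \bar R).

(** The integral of a nonnegative function is a supremum over simple functions below it, hence
    monotone for arbitrary functions. It is applied to integrands whose measurability is left
    open. *)
Lemma le_integral_nm d (T : measurableType d) (mu : {measure set T -> \bar R})
    (D : set T) (f g : T -> \bar R) :
  (forall x, D x -> (0 <= f x)%E) -> (forall x, D x -> (f x <= g x)%E) ->
  (\int[mu]_(x in D) f x <= \int[mu]_(x in D) g x)%E.
Proof.
move=> f0 fg; have g0 x : D x -> (0 <= g x)%E.
  by move=> Dx; exact: le_trans (f0 x Dx) (fg x Dx).
rewrite !ge0_integralE //; apply: ereal_sup_le => _ [h /= hf <-].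
exists h => //= x; apply: le_trans (hf x) _.
by rewrite /patch; case: ifPn => // /set_mem; exact: fg.
Qed.

Lemma dyadic_level (e r : R) : 0 < r -> r <= e ->
  exists k, e * 2^-1 ^+ k.+1 < r <= e * 2^-1 ^+ k.
Proof.
move=> r0 re; have e0 : 0 < e := lt_le_trans r0 re.
have ex : exists k, e * 2^-1 ^+ k < r.
  have : (2^-1 : R) ^+ n @[n --> \oo] --> 0.
    by apply: cvg_expr; rewrite ger0_norm // invf_lt1 // ltr1n.
  move=> /cvgrPdist_lt /(_ (r / e) (divr_gt0 r0 e0)) [N _ HN]; exists N.
  have := HN N (leqnn N); rewrite /= sub0r normrN ger0_norm ?exprn_ge0 //.
  by rewrite ltr_pdivlMr // mulrC.
have : e * 2^-1 ^+ (ex_minn ex) < r by case: ex_minnP.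
case: ex_minnP => -[|k] hk hmin _; first by move: hk; rewrite expr0 mulr1 ltNge re.
exists k; rewrite hk leNgt; apply/negP => h.
by have := hmin k h; rewrite ltnn.
Qed.

(** The [k]-th dyadic interval has length [e * 2^-1 ^+ k.+1], so its step contributes exactly
    [b k]. *)
Lemma dyadic_integral_le f (b : nat -> R) (e M : R) : 0 < e ->
  (forall r, 0 < r <= e -> (0 <= f r)%E) -> (forall k, 0 <= b k) ->
  (forall k r, e * 2^-1 ^+ k.+1 < r <= e * 2^-1 ^+ k ->
     (f r <= (b k / (e * 2^-1 ^+ k.+1))%:E)%E) ->
  (forall K, \sum_(k < K) b k <= M) ->
  (\int[lebesgue_measure]_(r in `]0%R, e]) f r <= M%:E)%E.
Proof.
move=> e0 f0 b0 fb bM.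
pose l k : R := e * 2^-1 ^+ k; have l0 k : 0 < l k by rewrite mulr_gt0 // exprn_gt0.
have lS k : l k.+1 = l k / 2 by rewrite /l exprS; ring.
pose A k : set R := `]l k.+1, l k]%classic.
pose t k (r : R) : \bar R := ((b k / l k.+1)%:E * (\1_(A k) r)%:E)%E.
have t0 k r : (0 <= t k r)%E.
  by rewrite /t -EFinM lee_fin mulr_ge0 // divr_ge0 // ltW.
have le_e k : l k <= e.
  by rewrite /l ler_piMr ?(ltW e0) // exprn_ile1 // invf_le1 // ler1n.
apply: (@le_trans _ _ (\int[lebesgue_measure]_(r in `]0%R, e])
    (\sum_(0 <= k <oo) t k r))%E).
  apply: le_integral_nm => r; rewrite /= in_itv /=; first exact: f0.
  move=> /andP[r0 re]; have [k hk] := dyadic_level r0 re.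
  apply: le_trans (fb k r hk) _.
  have := @nneseries_lim_ge R (fun k => t k r) xpredT 0 k.+1 (fun n _ _ => t0 n r).
  apply: le_trans; rewrite big_nat_recr //=.
  rewrite [X in (_ <= _ + X)%E](_ : _ = (b k / l k.+1)%:E).
    by rewrite leeDr // sume_ge0.
  by rewrite /t indicE mem_set ?mule1 //= in_itv.
rewrite integral_nneseries //=; last first.
  by move=> k; apply: measurable_funeM; apply/measurable_EFinP;
    apply: measurable_indic; exact: measurable_itv.
have intE k : (\int[lebesgue_measure]_(r in `]0%R, e]) t k r = (b k)%:E)%E.
  rewrite ge0_integralZl //=; last 2 first.
  - by apply/measurable_EFinP; apply: measurable_indic; exact: measurable_itv.
  - by rewrite lee_fin divr_ge0 // ltW.
  rewrite integral_indic; [|exact: measurable_itv..].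
  rewrite setIidl; last first.
    move=> x; rewrite /A /= !in_itv /= => /andP[x1 x2].
    by rewrite (lt_trans (l0 _) x1) (le_trans x2).
  rewrite /A [X in (_ * X)%E]lebesgue_measure_itv /= lte_fin lS.
  have -> : l k / 2 < l k by have := l0 k; lra.
  rewrite -EFinD -EFinM; congr (_%:E).
  by field; rewrite gt_eqF.
apply: lime_le.
  by apply: is_cvg_nneseries => k _ _; rewrite intE lee_fin.
near=> K; under eq_bigr do rewrite intE.
by rewrite sumEFin lee_fin big_mkord.
Unshelve. all: by end_near. Qed.

End DyadicIntegral.

(** * Divergence of the dyadic Goldilocks sum *)

Section GoldilocksSum.
Context {R : realType} {n : nat}.
Local Notation C := (cplx R).
Local Notation Cn := 'rV[cplx R]_n.
Variables (Omega : set Cn) (p eta : Cn).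

Local Notation G := (goldilocks_sup Omega p eta).

Lemma kobayashi_royden_ge0 z v : (0 <= kobayashi_royden Omega z v)%E.
Proof.
by apply: le_ereal_inf_tmp => _ [r [r0 _] <-]; rewrite lee_fin invr_ge0 ltW.
Qed.

Lemma goldilocks_sup_ge0 r : enorm eta = 1 -> 0 < r -> (0 <= G r)%E.
Proof.
move=> eta1 r0; apply: (@le_trans _ _ (kobayashi_royden Omega (p + toC r *: eta) eta)^-1%E).
  by rewrite inve_ge0 kobayashi_royden_ge0.
by apply: ereal_sup_ubound; exists r, eta; rewrite r0 lexx.
Qed.

Lemma goldilocks_sup_le r r' : r <= r' -> (G r <= G r')%E.
Proof.
move=> rr; apply: ereal_sup_le => _ [s [v [/andP[s0 sr] v1 ->]]].
by exists s, v; rewrite s0 (le_trans sr rr).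
Qed.

(** [b k] is the supremum at radius [r0 * 2^-1 ^+ k], truncated at [1] to be finite. Bounded partial
    sums would bound the Goldilocks integral near [0]. *)
Lemma goldilocks_dyadic (r0 : R) : C1_boundary_point Omega p ->
  inner_unit_normal Omega p eta -> enorm eta = 1 -> 0 < r0 ->
  (forall r : R, 0 < r <= r0 -> Omega (p + toC r *: eta)) ->
  ~ weakly_goldilocks Omega p ->
  exists b : nat -> R, [/\ forall k, 0 <= b k <= 1,
    forall M, exists K, M < \sum_(k < K) b k &
    forall k, 0 < b k -> exists r' v, [/\ 0 < r' <= r0 * 2^-1 ^+ k, enorm v = 1 &
      disc_at Omega (p + toC r' *: eta) (toC (b k / 2) *: v)]].
Proof.
move=> C1p neta eta1 r00 ptin nwG.
pose l k : R := r0 * 2^-1 ^+ k; have l0 k : 0 < l k by rewrite mulr_gt0 // exprn_gt0.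
have G0 r : 0 < r -> (0 <= G r)%E by exact: goldilocks_sup_ge0.
pose m k : \bar R := Order.min 1%E (G (l k)).
have m0 k : (0 <= m k)%E by rewrite le_min lee01 G0.
have m1 k : (m k <= 1)%E by rewrite ge_min lexx.
have mfin k : m k \is a fin_num.
  by rewrite ge0_fin_numE // (le_lt_trans (m1 k)) // ltry.
pose b k := fine (m k); have bE k : (b k)%:E = m k by rewrite fineK.
have b01 k : 0 <= b k <= 1 by rewrite -!lee_fin bE m0 m1.
exists b; split=> //.
  move=> M; apply: contrapT => /forallNP nM.
  have bM K : \sum_(k < K) b k <= M by rewrite leNgt; apply/negP; exact: nM.
  (* If all [b k] were [1], the sums would be unbounded. From [k0] on the truncation is inactive,
     because the supremum is monotone in the radius. *)
  have [k0 bk0] : exists k0, b k0 < 1.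
    apply: contrapT => /forallNP nb.
    have bb k : b k = 1.
      have /andP[_ b1] := b01 k; apply/eqP; rewrite eq_le b1 leNgt.
      by apply/negP; exact: nb.
    pose K := (Num.truncn `|M|).+1; have := bM K; rewrite leNgt => /negP; apply.
    under eq_bigr do rewrite bb.
    rewrite sumr_const card_ord; apply: le_lt_trans (ler_norm M) _.
    exact: truncnS_gt.
  have Glt1 : (G (l k0) < 1)%E.
    by move: bk0; rewrite -lte_fin bE /m gt_min ltxx /=.
  have GE k : G (l (k0 + k)%N) = (b (k0 + k)%N)%:E.
    rewrite bE /m min_r //; apply: le_trans (ltW Glt1); apply: goldilocks_sup_le.
    rewrite /l exprD mulrA ler_piMr ?(ltW (l0 k0)) //.
    by rewrite exprn_ile1 // invf_le1 // ler1n.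
  apply: nwG; split=> //; exists eta, (l k0); split=> //.
    move=> r /andP[rp rl]; apply: ptin; rewrite rp (le_trans rl) //.
    by rewrite /l ler_piMr ?(ltW r00) // exprn_ile1 // invf_le1 // ler1n.
  apply: (@le_lt_trans _ _ M%:E); last exact: ltry.
  apply: (@dyadic_integral_le R _ (fun k => b (k0 + k)%N)) => //.
  - move=> r /andP[rp _]; rewrite mule_ge0 ?G0 // lee_fin invr_ge0; exact: ltW.
  - by move=> k; case/andP: (b01 (k0 + k)%N).
  - move=> k r; rewrite -!/(l _) /l -!mulrA -!exprD => /andP[r1 r2].
    have rp : 0 < r by apply: lt_trans r1; rewrite mulr_gt0 // exprn_gt0.
    rewrite EFinM; apply: lee_pmul; rewrite ?G0 ?lee_fin ?invr_ge0 ?(ltW rp) //.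
      by rewrite -GE; exact: goldilocks_sup_le.
    rewrite lef_pV2 ?posrE ?mulr_gt0 ?exprn_gt0 //; exact: ltW.
  - move=> K; have := bM (k0 + K)%N; rewrite big_split_ord /=; apply: le_trans.
    by rewrite lerDr; apply: sumr_ge0 => i _; case/andP: (b01 i).
move=> k bk; have b2 : 0 < b k / 2 by rewrite divr_gt0.
(* Halving makes the inequality strict, so some admissible radius and direction exceed [b k / 2]. *)
have : ((b k / 2)%:E < G (l k))%E.
  apply: (@lt_le_trans _ _ (b k)%:E).
    by rewrite lte_fin; lra.
  by rewrite bE ge_min lexx orbT.
move=> /ereal_sup_gt [_ [r' [v [hr' v1 ->]]] hlt]; exists r', v; split=> //.
apply: kobayashi_royden_lt => //.
rewrite inve_pgt ?inE ?kobayashi_royden_ge0 ?lee_fin ?(ltW b2) // in hlt.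
by rewrite inver gt_eqF in hlt.
Qed.

End GoldilocksSum.

(** * The boundary curves *)

Section Profile.
Context {R : realType}.
Implicit Types (s t r : R) (a : nat -> R).

(** A rational cutoff, near [1] for small [s] and near [0] for large [s]. The next function is
    [- s * bump' s], its derivative in [- ln s]; the increments of [squash] from [s] to [2 * s]
    telescope over dyadic scales. *)
Definition bump s : R := (1 + s ^+ 2)^-1.
Definition bump_weight s : R := 2 * s ^+ 2 / (1 + s ^+ 2) ^+ 2.
Definition squash s : R := s / (1 + s).

Lemma one_sqr_gt0 s : 0 < 1 + s ^+ 2.
Proof. by have := sqr_ge0 s; lra. Qed.

Lemma is_derive_bump s : is_derive s 1 bump (- (2 * s) / (1 + s ^+ 2) ^+ 2).
Proof.
have d1 : is_derive s 1 (fun x : R => 1 + x ^+ 2) (2 * s).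
  by apply: is_derive_eq; rewrite /GRing.scale /=; lra.
have nz : (fun x : R => 1 + x ^+ 2) s != 0 by rewrite gt_eqF // one_sqr_gt0.
have d2 := @is_deriveV _ (fun x : R => 1 + x ^+ 2) s _ _ nz d1.
by apply: (is_derive_eq d2); rewrite /GRing.scale /=; field; rewrite gt_eqF // one_sqr_gt0.
Qed.

Lemma bump_weight_ge0 s : 0 <= bump_weight s.
Proof. by apply: divr_ge0; [rewrite mulr_ge0 ?sqr_ge0|rewrite sqr_ge0]. Qed.

Lemma bump_weight_le s : bump_weight s <= 1.
Proof.
rewrite /bump_weight ler_pdivrMr ?exprn_gt0 ?one_sqr_gt0 // mul1r.
by have := sqr_ge0 (s ^+ 2); have := sqr_ge0 s; nra.
Qed.

(** The increment of [squash] is at least [s / 6] for [s <= 1] and [1 / (6 s)] for [s >= 1], while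
    the weight is at most [2 s ^+ 2] and [2 / s] respectively. *)
Lemma bump_weight_squash s : 0 < s ->
  bump_weight s <= 12 * Order.min s 1 * (squash (2 * s) - squash s).
Proof.
move=> s0; have q0 := one_sqr_gt0 s.
have h1 : 0 < 1 + s by lra.
have h2 : 0 < 1 + 2 * s by lra.
have -> : squash (2 * s) - squash s = s / ((1 + 2 * s) * (1 + s)).
  by rewrite /squash; field; rewrite !gt_eqF.
rewrite /bump_weight ler_pdivrMr ?exprn_gt0 //.
have D0 : 0 < (1 + 2 * s) * (1 + s) by rewrite mulr_gt0.
have -> : 12 * Order.min s 1 * (s / ((1 + 2 * s) * (1 + s))) * (1 + s ^+ 2) ^+ 2 =
    (12 * Order.min s 1 * s * (1 + s ^+ 2) ^+ 2) / ((1 + 2 * s) * (1 + s)).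
  by field; rewrite !gt_eqF.
rewrite ler_pdivlMr //; have [s1|s1] := leP s 1.
  have e1 : (1 + 2 * s) * (1 + s) <= 6 by nra.
  have e2 : 1 <= (1 + s ^+ 2) ^+ 2 by have := sqr_ge0 s; nra.
  have := sqr_ge0 s; nra.
have e1 : s * ((1 + 2 * s) * (1 + s)) <= 6 * s ^+ 3 by rewrite !exprS expr0; nra.
have e2 : s ^+ 3 <= (1 + s ^+ 2) ^+ 2 by rewrite !exprS expr0; nra.
have -> : 2 * s ^+ 2 * ((1 + 2 * s) * (1 + s)) =
  2 * s * (s * ((1 + 2 * s) * (1 + s))) by ring.
have : s * (s * ((1 + 2 * s) * (1 + s))) <= s * (6 * (1 + s ^+ 2) ^+ 2).
  by rewrite ler_pM2l //; lra.
lra.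
Qed.

Lemma bumpB_ge (u v : R) : 0 <= u -> u <= 1 / 2 -> 2 <= v ->
  3 / 5 <= bump u - bump v.
Proof.
move=> u0 u2 v2; have hu : 4 / 5 <= bump u.
  by rewrite /bump -[4 / 5]invrK lef_pV2 ?posrE ?one_sqr_gt0 ?invr_gt0 //; nra.
have hv : bump v <= 1 / 5.
  by rewrite /bump -[1 / 5]invrK lef_pV2 ?posrE ?one_sqr_gt0 ?invr_gt0 //; nra.
lra.
Qed.

Lemma bump_le (u v : R) : 0 <= u -> u <= v -> bump v <= bump u.
Proof.
by move=> u0 uv; rewrite /bump lef_pV2 ?posrE ?one_sqr_gt0 //; nra.
Qed.

End Profile.

Section RealCurve.
Context {R : realType}.
Variables (r0 : R) (a : nat -> R) (j m : nat).
Hypotheses (r0_gt0 : 0 < r0) (a_ge0 : forall k, 0 <= a k) (m_gt0 : (0 < m)%N).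

(* [drift] is a smooth substitute for the step-by-step drift by [a k] while the
   radius passes the dyadic level [lev k], normalized to go from [0] to [1 / 2]. *)
Definition lev k : R := r0 * 2^-1 ^+ k.
Definition layers (r : R) : R := \sum_(i < m) a (j + i) * bump (r / lev (j + i)).
Definition layer_weight (r : R) : R :=
  \sum_(i < m) a (j + i) * bump_weight (r / lev (j + i)).
Definition depth : R := ln (lev j / lev (j + m)).
(** Exponential, so that [ln (rad t)], which controls the lower bound for the distance, is affine in
    [t] with slope [- depth]. *)
Definition rad (t : R) : R := lev j * expR (- depth * t).
Definition total : R := layers (lev (j + m)) - layers (lev j).
Definition drift (t : R) : R := (2 * total)^-1 * (layers (rad t) - layers (lev j)).

Lemma lev_gt0 k : 0 < lev k.
Proof. by rewrite mulr_gt0 // exprn_gt0. Qed.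

Lemma levS k : lev k = 2 * lev k.+1.
Proof. by rewrite /lev exprS; field. Qed.

Lemma lev_le k l : (k <= l)%N -> lev l <= lev k.
Proof.
move=> kl; rewrite /lev ler_pM2l // ler_wiXn2l //.
by rewrite invf_le1 // ler1n.
Qed.

Lemma lev_lt k l : (k < l)%N -> lev l <= lev k / 2.
Proof.
by move=> kl; rewrite (levS k) mulrC mulKf //; exact: lev_le.
Qed.

Lemma depth_gt0 : 0 < depth.
Proof.
rewrite ln_gt0 // ltr_pdivlMr ?lev_gt0 // mul1r.
have := @lev_lt j (j + m); rewrite -{1}(addn0 j) ltn_add2l m_gt0 => /(_ isT).
by have := lev_gt0 j; lra.
Qed.

Lemma rad_gt0 t : 0 < rad t.
Proof. by rewrite mulr_gt0 ?lev_gt0 ?expR_gt0. Qed.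

Lemma rad0 : rad 0 = lev j.
Proof. by rewrite /rad mulr0 expR0 mulr1. Qed.

Lemma rad1 : rad 1 = lev (j + m).
Proof.
rewrite /rad mulr1 expRN lnK ?posrE ?divr_gt0 ?lev_gt0 // invf_div mulrC divfK //.
by rewrite gt_eqF // lev_gt0.
Qed.

Lemma rad_le s t : s <= t -> rad t <= rad s.
Proof.
move=> st; rewrite /rad ler_pM2l ?lev_gt0 // ler_expR.
by have := depth_gt0; nra.
Qed.

Lemma ln_rad t : ln (rad t) = ln (lev j) - depth * t.
Proof. by rewrite lnM ?posrE ?lev_gt0 ?expR_gt0 // expRK mulNr. Qed.

Lemma is_derive_rad (t : R) : is_derive t 1 rad (- depth * rad t).
Proof.
have d1 : is_derive t 1 (fun x : R => - depth * x) (- depth).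
  by apply: is_derive_eq; rewrite /GRing.scale /=; lra.
have d2 := is_derive1_comp (is_derive_expR (- depth * t)) d1.
have d3 := is_deriveZ (lev j) d2.
by apply: (is_derive_eq d3); rewrite /rad /GRing.scale /=; ring.
Qed.

Lemma is_derive_layers (t : R) :
  is_derive t 1 (fun s => layers (rad s)) (depth * layer_weight (rad t)).
Proof.
pose f (i : 'I_m) (s : R) := a (j + i) * bump (rad s / lev (j + i)).
have df i : is_derive t 1 (f i) (depth * (a (j + i) * bump_weight (rad t / lev (j + i)))).
  have d1 : is_derive t 1 (fun s => (lev (j + i))^-1 * rad s)
    ((lev (j + i))^-1 * (- depth * rad t)) := is_deriveZ _ (is_derive_rad t).
  have d2 := is_derive1_comp (is_derive_bump _) d1.
  have d3 := is_deriveZ (a (j + i)) d2.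
  have fE : f i = a (j + i) \*: (bump \o (fun s => (lev (j + i))^-1 * rad s)).
    by apply/funext => s; rewrite /f /= (mulrC (rad s)).
  rewrite fE; apply: (is_derive_eq d3); rewrite /bump_weight /GRing.scale /= (mulrC _^-1).
  have -> : (lev (j + i))^-1 * (- depth * rad t) = - depth * (rad t / lev (j + i)).
    by ring.
  have := one_sqr_gt0 (rad t / lev (j + i)); move: (rad t / lev (j + i)) => x q.
  by field; rewrite gt_eqF.
have := is_derive_sum df; rewrite -mulr_sumr; congr (is_derive _ _ _ _).
by apply/funext => s; rewrite fct_sumE.
Qed.

Lemma layers_le r r' : 0 < r -> r <= r' -> layers r' <= layers r.
Proof.
move=> rp rr; apply: ler_sum => i _; rewrite ler_wpM2l //; apply: bump_le.
  by rewrite divr_ge0 // ltW // lev_gt0.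
by rewrite ler_pM2r // invr_gt0 lev_gt0.
Qed.

(** Each layer after the first sees its ratio fall from at least [2] to at most [1 / 2] and gains
    [3 / 5]. The first is already half passed at the start and is discarded, whence the term
    [a j]. *)
Lemma total_ge : 3 / 5 * (\sum_(i < m) a (j + i) - a j) <= total.
Proof.
have [m' mE] : exists m', m = m'.+1 by exists m.-1; rewrite prednK.
rewrite /total /layers -sumrB mulrBr mulr_sumr.
rewrite (bigD1 (Ordinal m_gt0)) //= [leRHS](bigD1 (Ordinal m_gt0)) //= addn0.
rewrite addrAC subrr add0r -[leLHS]add0r lerD //.
  rewrite -mulrBr mulr_ge0 // subr_ge0; apply: bump_le.
    by rewrite divr_ge0 // ltW // lev_gt0.
  by rewrite ler_pM2r ?invr_gt0 ?lev_gt0 // lev_le // leq_addr.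
apply: ler_sum => i i_neq0.
have i0' : (0 < i)%N by rewrite lt0n; apply: contra i_neq0 => /eqP i_0; apply/eqP/val_inj.
rewrite -mulrBr mulrC ler_wpM2l //; apply: bumpB_ge.
- by rewrite divr_ge0 // ltW // lev_gt0.
- by rewrite ler_pdivrMr ?lev_gt0 // mulrC mulrA mulr1 lev_lt // ltn_add2l.
- rewrite ler_pdivlMr ?lev_gt0 //.
  have := @lev_lt j (j + i); rewrite -{1}(addn0 j) ltn_add2l i0' => /(_ isT).
  by lra.
Qed.

Lemma layer_weight_ge0 r : 0 <= layer_weight r.
Proof. by apply: sumr_ge0 => i _; rewrite mulr_ge0 // bump_weight_ge0. Qed.

(* [12 min(s, 1)] times a telescoping difference of [squash] over the dyadic scales
   dominates each summand, so the bound does not depend on the number of layers. *)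
Lemma layer_weight_le r A : 0 < r -> 0 <= A ->
  (forall i : 'I_m, a (j + i) * Order.min (r / lev (j + i)) 1 <= A) ->
  layer_weight r <= 12 * A.
Proof.
have tel (T : nat -> R) k : \sum_(i < k) (T (j + i).+1 - T (j + i)%N) = T (j + k)%N - T j.
  elim: k => [|k IH]; first by rewrite big_ord0 addn0 subrr.
  by rewrite big_ord_recr /= IH addnS addrC addrA subrK.
move=> rp A0 H; pose T k := squash (r / lev k).
have T01 k : 0 <= T k <= 1.
  have q : 0 < r / lev k by rewrite divr_gt0 // lev_gt0.
  rewrite /T /squash; move: (r / lev k) q => x x0; have x1 : 0 < 1 + x by lra.
  by apply/andP; split; [rewrite divr_ge0 // ltW|rewrite ler_pdivrMr //; lra].
have -> : 12 * A = \sum_(i < m) 12 * A * (T (j + i).+1 - T (j + i))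
    + 12 * A * (1 - (T (j + m) - T j)).
  rewrite -mulr_sumr tel; move: (T (j + m)) (T j) => x y; ring.
rewrite -[leLHS]addr0 lerD //; last first.
  by rewrite !mulr_ge0 //; have := T01 (j + m); have := T01 j; lra.
apply: ler_sum => i _; set s := r / lev (j + i).
have s0 : 0 < s by rewrite divr_gt0 // lev_gt0.
have -> : T (j + i).+1 = squash (2 * s).
  rewrite /T /s (levS (j + i)); congr squash; have := lev_gt0 (j + i).+1.
  by move=> l; field; rewrite gt_eqF.
have := bump_weight_squash s0; set w := bump_weight s; set D := _ - _ => hw.
have D0 : 0 <= D.
  have := bump_weight_ge0 s; rewrite -/w; have ms : 0 < Order.min s 1.
    by rewrite lt_min s0 ltr01.
  move=> w0; have : 0 <= 12 * Order.min s 1 * D by lra.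
  by rewrite pmulr_rge0 // mulr_gt0.
have := H i; rewrite -/s => Hi; have ai := a_ge0 (j + i).
have h1 : a (j + i) * w <= a (j + i) * (12 * Order.min s 1 * D) by rewrite ler_wpM2l.
apply: le_trans h1 _.
have -> : a (j + i) * (12 * Order.min s 1 * D) = 12 * (a (j + i) * Order.min s 1) * D.
  by ring.
by rewrite ler_wpM2r // ler_pM2l.
Qed.

Section Drift.
Hypothesis total_big : 1 / 2 <= total.

Lemma is_derive_drift (t : R) :
  is_derive t 1 drift (depth * ((2 * total)^-1 * layer_weight (rad t))).
Proof.
have d1 := is_deriveB (is_derive_layers t) (is_derive_cst (layers (lev j)) t 1).
have d2 := is_deriveZ (2 * total)^-1 d1.
by apply: (is_derive_eq d2); rewrite /GRing.scale /=; ring.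
Qed.

Lemma drift0 : drift 0 = 0.
Proof. by rewrite /drift rad0 subrr mulr0. Qed.

Lemma drift1 : drift 1 = 1 / 2.
Proof.
have tp : 0 < total by apply: lt_le_trans total_big.
rewrite /drift rad1 -/total; move: total tp => x x0.
by field; rewrite gt_eqF.
Qed.

Lemma drift_le s t : s <= t -> drift s <= drift t.
Proof.
move=> st; have tp : 0 < total by apply: lt_le_trans total_big.
rewrite /drift ler_pM2l ?invr_gt0 ?mulr_gt0 //.
by rewrite lerB // layers_le ?rad_gt0 // rad_le.
Qed.

Lemma drift01 t : 0 <= t <= 1 -> 0 <= drift t <= 1 / 2.
Proof.
by move=> /andP[t0 t1]; rewrite -drift0 -drift1 !drift_le.
Qed.

Lemma drift_rate_ge0 r : 0 <= (2 * total)^-1 * layer_weight r.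
Proof.
have tp : 0 < total by apply: lt_le_trans total_big.
by rewrite mulr_ge0 ?layer_weight_ge0 // invr_ge0 mulr_ge0 // ltW.
Qed.

Lemma drift_rate_le r : (2 * total)^-1 * layer_weight r <= layer_weight r.
Proof.
have tp : 0 < total by apply: lt_le_trans total_big.
rewrite ler_piMl ?layer_weight_ge0 // invf_le1 ?mulr_gt0 //.
by move: total_big; rewrite ler_pdivrMr // mulrC.
Qed.

End Drift.

End RealCurve.

Lemma lipschitz_derive {R : realType} (f df : R -> R) (a b B : R) :
  (forall t : R, is_derive t 1 f (df t)) -> (forall t, a <= t <= b -> `|df t| <= B) ->
  forall s t, a <= s -> s <= t -> t <= b -> `|f t - f s| <= B * (t - s).
Proof.
move=> d H s t as_ st tb.
have cf : {within `[s, t], continuous f}.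
  by apply: derivable_within_continuous => x _; case: (d x).
have [c] := @MVT_segment R f df s t st (fun x _ => d x) cf.
rewrite in_itv /= => /andP[sc ct] ->.
have ts : 0 <= t - s by rewrite subr_ge0.
rewrite normrM (ger0_norm ts) ler_wpM2r //.
by apply: H; rewrite (le_trans as_ sc) (le_trans ct).
Qed.

Lemma comb_diff {K : numFieldType} {n : nat} (p e w : 'rV[K]_n) (x y x' y' u v : K) :
  x - x' = u -> y - y' = v ->
  p + x *: e + y *: w - (p + x' *: e + y' *: w) = u *: e + v *: w.
Proof.
by move=> <- <-; apply/rowP => i; rewrite !mxE; ring.
Qed.

Lemma comb_pair {K : numFieldType} {n : nat} (e w : 'rV[K]_n) (x y z x1 y1 k s t : K) :
  x * x1 = k * s -> y * z * y1 = - (k * t) ->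
  x *: (x1 *: w) + y *: (z *: (y1 *: e)) = k *: (s *: w - t *: e).
Proof.
by move=> h1 h2; rewrite scalerBr !scalerA h1 h2 scaleNr.
Qed.

(** * The curves are almost geodesics *)

Section BoundaryCurve.
Context {R : realType} {n : nat}.
Local Notation C := (cplx R).
Local Notation Cn := 'rV[cplx R]_n.
Variables (Omega : set Cn) (p q eta c : Cn).
Hypotheses (oO : open Omega) (cO : segment_convex Omega).
Hypotheses (cp : closure Omega p) (cq : closure Omega q).
Hypotheses (ceta : lform c eta = 1) (eta1 : enorm eta = 1).
Hypothesis lpos : forall z, Omega z -> 0 < complex.Re (lform c (z - p)).
Hypothesis cqp : lform c (q - p) = 0.
Local Notation tau := (q - p).
Local Notation pt r := (p + toC r *: eta).

Variables (R0 r0 k1 : R) (a : nat -> R) (j m : nat).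
Hypotheses (R0_gt0 : 0 < R0) (pt_in : forall r, 0 < r <= R0 -> Omega (pt r)).
Hypotheses (r0_gt0 : 0 < r0) (r0R : r0 <= R0 / 4) (k1_gt0 : 0 < k1).
Hypotheses (a_ge0 : forall k, 0 <= a k) (m_gt0 : (0 < m)%N).
Hypothesis disc_tau : forall k, disc_at Omega (pt (lev r0 k)) (toC (a k) *: tau).
Hypothesis disc_eta : forall r, 0 < r <= r0 ->
  disc_at Omega (pt r) (toC (k1 * r) *: eta).
Hypothesis total_big : 1 / 2 <= total r0 a j m.

Definition curve (t : R) : Cn :=
  pt (rad r0 j m t) + toC (drift r0 a j m t) *: tau.
Local Notation rd := (rad r0 j m).
Local Notation dr := (drift r0 a j m).
Local Notation L := (depth r0 j m).
Let xi t := (2 * total r0 a j m)^-1 * layer_weight r0 a j m (rd t).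

(** Abbreviated [kappa] below, but a constant, not the metric. The entry [1 / 96] gives
    [2 * kappa * (12 * B) <= B / 4] for discs along [tau], and [k1 / 8] gives
    [2 * kappa * r <= k1 * r / 4] along [eta]; the factor [2] pays for averaging the two. *)
Definition geodesic_gap : R := Order.min (1 / 96) (k1 / 8).
Local Notation kappa := geodesic_gap.

Lemma geodesic_gap_gt0 : 0 < kappa.
Proof. by rewrite lt_min !divr_gt0. Qed.

Lemma rd_le t : 0 <= t -> rd t <= lev r0 j.
Proof. by move=> t0; rewrite -(rad0 r0 j m); apply: rad_le. Qed.

Lemma lev_le0 k : lev r0 k <= r0.
Proof. by rewrite -[leRHS]mulr1 -(expr0 (2^-1)); exact: lev_le. Qed.

Lemma rd_r0 t : 0 <= t -> 0 < rd t <= r0.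
Proof. by move=> t0; rewrite rad_gt0 // (le_trans (rd_le t0)) // lev_le0. Qed.

Lemma curve_disc_move w (r' k t : R) : 0 <= t <= 1 -> 0 < r' <= r0 ->
  0 <= k <= 1 / 2 -> k <= rd t / r' -> disc_at Omega (pt r') w ->
  disc_at Omega (curve t) (toC (k / 2) *: w).
Proof.
move=> /andP[t0 t1] /andP[r'0 r'r] hk kr D; have /andP[rp rr] := rd_r0 t0.
apply: (disc_at_move_face oO cO cp R0_gt0 pt_in cq _ _ _ hk kr D).
- by rewrite rp (le_trans rr).
- by rewrite r'0 (le_trans r'r) // (le_trans r0R) // ler_pM2l // lef_pV2 ?posrE // ler_nat.
- by apply: drift01 => //; rewrite t0.
Qed.

Lemma curve_disc t : 0 <= t <= 1 ->
  disc_at Omega (curve t) (toC kappa *: (toC (xi t) *: tau - toC (rd t) *: eta)).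
Proof.
move=> ht; have t0 : 0 <= t by case/andP: ht.
have /andP[rp rr] := rd_r0 t0.
pose F (i : 'I_m) := a (j + i) * Order.min (rd t / lev r0 (j + i)) 1.
have sp (i : nat) : 0 < rd t / lev r0 (j + i) by rewrite divr_gt0 // lev_gt0.
(* Moving the disc of level [j + i] to the curve keeps the factor [min (rd t / lev) 1 / 2], halved
   again by the shift along the face. *)
have Di (i : 'I_m) : disc_at Omega (curve t) (toC (F i / 4) *: tau).
  pose k := Order.min (rd t / lev r0 (j + i)) 1 / 2.
  have k0 : 0 <= k <= 1 / 2.
    rewrite /k divr_ge0 ?ler_pM2r ?invr_gt0 ?ge_min ?lexx ?orbT //.
    by rewrite le_min ltW ?sp ?ler01.
  have kr : k <= rd t / lev r0 (j + i).
    have h : Order.min (rd t / lev r0 (j + i)) 1 <= rd t / lev r0 (j + i).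
      by rewrite ge_min lexx.
    by have := sp i; rewrite /k; lra.
  have hl : 0 < lev r0 (j + i) <= r0 by rewrite lev_gt0 // lev_le0.
  have := curve_disc_move ht hl k0 kr (disc_tau (j + i)).
  rewrite scalerA (_ : toC (k / 2) * toC (a (j + i)) = toC (F i / 4)) //.
  by rewrite /F /k; apply: complex_eqP; rewrite ?(cReM, cImM) /=; field.
(* Only the best disc is used: by [layer_weight_le] it controls the whole drift rate up to the
   factor [12], for any number of layers. *)
have [B [B0 FB DB]] : exists B, [/\ 0 <= B, forall i, F i <= B &
    disc_at Omega (curve t) (toC (B / 4) *: tau)].
  have [i _ Hi] := @arg_maxP _ _ _ (Ordinal m_gt0) xpredT F isT.
  exists (F i); split=> // [|k]; last exact: Hi.
  by rewrite mulr_ge0 // le_min ltW ?sp ?ler01.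
have xi0 : 0 <= xi t by apply: drift_rate_ge0.
have xiB : xi t <= 12 * B.
  apply: (@le_trans _ _ (layer_weight r0 a j m (rd t))); first exact: drift_rate_le.
  exact: layer_weight_le.
have gap1 : kappa <= 1 / 96 by rewrite ge_min lexx.
have gap2 : kappa <= k1 / 8 by rewrite ge_min lexx orbT.
have gap0 := geodesic_gap_gt0.
have D1 : disc_at Omega (curve t) (toC (2 * kappa * xi t) *: tau).
  apply: disc_at_scale DB; apply/andP; split; first by rewrite mulr_ge0 ?(ltW rp) // mulr_ge0 // ltW.
  nra.
have D2 : disc_at Omega (curve t) (toC (2 * kappa * rd t) *: eta).
  have h2 : 0 <= (1 / 2 : R) <= 1 / 2 by apply/andP; split; lra.
  have hk : 1 / 2 <= rd t / rd t by rewrite divff ?gt_eqF //; lra.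
  have hr : 0 < rd t <= r0 by rewrite rp.
  have := curve_disc_move ht hr h2 hk (disc_eta hr); rewrite scalerA.
  rewrite (_ : toC (1 / 2 / 2) * toC (k1 * rd t) = toC (k1 * rd t / 4)); last first.
    by apply: complex_eqP; rewrite ?(cReM, cImM) /=; field.
  apply: disc_at_scale; apply/andP; split; first by rewrite mulr_ge0 ?(ltW rp) // mulr_ge0 // ltW.
  nra.
have mN : modulus (- 1 : C) <= 1 by rewrite modulusN modulus1.
have D3 := disc_atZ mN D2.
have h2 : 0 <= (1 / 2 : R) <= 1 by apply/andP; split; lra.
have := disc_at_comb cO h2 D1 D3.
have -> : toC (1 - 1 / 2) *: curve t + toC (1 / 2) *: curve t = curve t.
  rewrite -scalerDl (_ : _ + _ = 1) ?scale1r //.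
  by apply: complex_eqP; rewrite ?cReD ?cImD /=; field.
congr disc_at.
apply: comb_pair.
  by apply: complex_eqP; rewrite ?(cReM, cImM) /=; field.
by apply: complex_eqP; rewrite ?(cReM, cImM, cReN, cImN) /=; field.
Qed.


Lemma is_derive_row_line (u : R -> R) (du t : R) (k l : R) :
  is_derive t 1 u du -> is_derive t 1 (fun s => k + u s * l) (du * l).
Proof.
move=> d; have d1 := is_deriveD (is_derive_cst k t 1) (is_deriveZ l d).
have -> : (fun s => k + u s * l) = cst k + l \*: u.
  by apply/funext => s; rewrite /= mulrC.
by apply: (is_derive_eq d1); rewrite add0r /GRing.scale /= mulrC.
Qed.

Lemma velocity_curve t :
  velocity curve t = toC L *: (toC (xi t) *: tau - toC (rd t) *: eta).
Proof.
have dR := is_derive_rad r0 j m t.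
have dX := is_derive_drift r0 a j m t.
have dc (k l1 l2 : R) : derive1 (fun s => k + rd s * l1 + dr s * l2) t =
    - L * rd t * l1 + L * xi t * l2.
  have d1 := is_derive_row_line k l1 dR.
  have d2 := is_derive_row_line 0 l2 dX.
  have d3 := is_deriveD d1 d2.
  have E : (fun s => k + rd s * l1 + dr s * l2) =
      (fun s => k + rd s * l1) \+ (fun s => 0 + dr s * l2).
    by apply/funext => s; rewrite /= add0r.
  by rewrite derive1E E; case: d3.
apply/rowP => i; rewrite !mxE.
have -> : (fun s => complex.Re (curve s 0 i)) =
    (fun s => complex.Re (p 0 i) + rd s * complex.Re (eta 0 i)
      + dr s * complex.Re (tau 0 i)).
  by apply/funext => s; rewrite /curve !mxE !cReD !cReZ !cReD.
have -> : (fun s => complex.Im (curve s 0 i)) =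
    (fun s => complex.Im (p 0 i) + rd s * complex.Im (eta 0 i)
      + dr s * complex.Im (tau 0 i)).
  by apply/funext => s; rewrite /curve !mxE !cImD !cImZ !cImD.
rewrite !dc; apply: complex_eqP.
  by rewrite cReZ cReB !cReZ !mxE /=; ring.
by rewrite cImZ cImB !cImZ !mxE /=; ring.
Qed.

Lemma curve_in t : 0 <= t <= 1 -> Omega (curve t).
Proof.
move=> /curve_disc [f [hf <- _]].
have m01 : modulus (0 : C) < 1 by rewrite modulus0 ltr01.
by case: (hf 0 m01).
Qed.

Lemma curve_royden t : 0 <= t <= 1 ->
  (kobayashi_royden Omega (curve t) (velocity curve t) <= (L / kappa)%:E)%E.
Proof.
move=> ht; have L0 := depth_gt0 j r0_gt0 m_gt0; have k0 := geodesic_gap_gt0.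
rewrite -[L / kappa]invrK; apply: kobayashi_royden_le.
  by rewrite invr_gt0 divr_gt0.
rewrite velocity_curve scalerA (_ : toC _ * toC L = toC kappa); first exact: curve_disc.
by apply: complex_eqP; rewrite ?(cReM, cImM) /=; field; rewrite !gt_eqF.
Qed.

Lemma curve_length t1 t2 : 0 <= t1 -> t1 <= t2 -> t2 <= 1 ->
  (kobayashi_length Omega curve t1 t2 <= (L / kappa * (t2 - t1))%:E)%E.
Proof.
move=> h1 h2 h3.
apply: (@le_trans _ _ (\int[lebesgue_measure]_(t in `[t1, t2]) (cst (L / kappa)%:E t))%E).
  apply: le_integral_nm => t; rewrite /= in_itv /= => /andP[ha hb].
    exact: kobayashi_royden_ge0.
  by apply: curve_royden; rewrite (le_trans h1 ha) (le_trans hb).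
rewrite integral_cst //= lebesgue_measure_itv /= lte_fin.
case: ltP => h; first by rewrite -EFinD -EFinM.
by rewrite mule0 lee_fin mulr_ge0 ?subr_ge0 // divr_ge0 // ltW // ?depth_gt0 // geodesic_gap_gt0.
Qed.

Lemma lform_curve t : lform c (curve t - p) = toC (rd t).
Proof.
by rewrite /curve addrAC (addrC p) addrK lformD !lformZ ceta cqp mulr1 mulr0 addr0.
Qed.

Lemma curve_kobayashi t1 t2 : t1 <= t2 ->
  ((L * (t2 - t1) / 16)%:E <= kobayashi Omega (curve t1) (curve t2))%E.
Proof.
have lE t : ln (complex.Re (lform c (curve t - p))) = ln (lev r0 j) - L * t.
  by rewrite lform_curve; exact: ln_rad.
have aux (x z A y u v : R) : x = A - y * u -> z = A - y * v -> 0 <= y -> u <= v ->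
    `|x - z| = y * (v - u).
  move=> -> -> y0 uv; have -> : A - y * u - (A - y * v) = y * (v - u) by ring.
  by rewrite ger0_norm // mulr_ge0 ?subr_ge0.
move=> h; have L0 := ltW (depth_gt0 j r0_gt0 m_gt0).
by rewrite -(aux _ _ _ _ _ _ (lE t1) (lE t2) L0 h); exact: kobayashi_halfplane.
Qed.

Lemma enorm_comb_le (u v : R) (x y : Cn) :
  enorm (toC u *: x + toC v *: y) <= 2 * (`|u| * enorm x + `|v| * enorm y).
Proof.
have ge0 (z : Cn) : 0 <= enorm z by rewrite sqrtr_ge0.
have hu := mulr_ge0 (normr_ge0 u) (ge0 x); have hv := mulr_ge0 (normr_ge0 v) (ge0 y).
rewrite -(@ler_pXn2r _ 2) ?nnegrE ?ge0 ?mulr_ge0 ?addr_ge0 //.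
by apply: le_trans (enorm_sqrD _ _) _; rewrite !enormZ; nra.
Qed.

Lemma curve_lipschitz : exists2 B : R, 0 < B & forall s t, 0 <= s -> s <= t -> t <= 1 ->
  enorm (curve t - curve s) <= B * (t - s).
Proof.
have L0 := depth_gt0 j r0_gt0 m_gt0.
have ge0 (z : Cn) : 0 <= enorm z by rewrite sqrtr_ge0.
pose A := \sum_(i < m) a (j + i).
have A0 : 0 <= A by apply: sumr_ge0.
have xiA t : `|L * xi t| <= L * A.
  have x0 : 0 <= xi t by apply: drift_rate_ge0.
  rewrite (ger0_norm (mulr_ge0 (ltW L0) x0)) ler_pM2l //.
  apply: (@le_trans _ _ (layer_weight r0 a j m (rd t))); first exact: drift_rate_le.
  by apply: ler_sum => i _; rewrite ler_piMr // bump_weight_le.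
have rdA t : 0 <= t <= 1 -> `|- L * rd t| <= L * r0.
  move=> /andP[t0 _]; have /andP[rp rr] := rd_r0 t0.
  by rewrite normrM normrN !gtr0_norm // ler_pM2l.
pose B := 2 * (L * r0 * enorm eta + L * A * enorm tau).
have B0 : 0 <= B by rewrite mulr_ge0 // addr_ge0 // !mulr_ge0 // ltW.
exists (B + 1); first by rewrite ltr_wpDl.
move=> s t s0 st t1.
have hr := lipschitz_derive (fun x => is_derive_rad r0 j m x) rdA s0 st t1.
have hx := lipschitz_derive (fun x => is_derive_drift r0 a j m x)
  (fun x _ => xiA x) s0 st t1.
have -> : curve t - curve s = toC (rd t - rd s) *: eta + toC (dr t - dr s) *: tau.
  by apply: comb_diff; apply: complex_eqP; rewrite ?(cReB, cImB) /= ?subrr.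
apply: le_trans (enorm_comb_le _ _ _ _) _.
have e1 := ge0 eta; have e2 := ge0 tau; have ts : 0 <= t - s by rewrite subr_ge0.
have g1 : `|rd t - rd s| * enorm eta <= L * r0 * (t - s) * enorm eta by rewrite ler_wpM2r.
have g2 : `|dr t - dr s| * enorm tau <= L * A * (t - s) * enorm tau by rewrite ler_wpM2r.
rewrite mulrDl mul1r /B; lra.
Qed.

Lemma curve_absolutely_continuous : absolutely_continuous 0 1 curve.
Proof.
have [B B0 HB] := curve_lipschitz; move=> e e0.
exists (e / B); split=> [|s hs _ hd]; first exact: divr_gt0.
apply: (@le_lt_trans _ _ (\sum_(I <- s) B * (I.2 - I.1))).
  rewrite big_seq [leRHS]big_seq; apply: ler_sum => I /hs [h1 h2 h3].
  exact: HB.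
by rewrite -mulr_sumr mulrC -ltr_pdivlMr.
Qed.

(** Length is at most [L / kappa] and distance at least [L / 16] per unit of [t], so the depth [L]
    cancels and the constant depends on neither [j] nor [m]. *)
Lemma curve_geodesic : almost_geodesic Omega (16 / kappa) 0 curve.
Proof.
split; [exact: curve_absolutely_continuous|exact: curve_in|].
move=> t1 t2 h1 h2 h3; apply: le_trans (curve_length h1 h2 h3) _.
have k0 := geodesic_gap_gt0; rewrite adde0.
have -> : L / kappa * (t2 - t1) = 16 / kappa * (L * (t2 - t1) / 16).
  by field; rewrite gt_eqF.
rewrite (EFinM (16 / kappa)); apply: lee_wpmul2l; last exact: curve_kobayashi.
by rewrite lee_fin divr_ge0 // ltW.
Qed.

End BoundaryCurve.

(** * Escape to the boundary and failure of visibility *)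

Section BoundaryBehaviour.
Context {R : realType} {n : nat}.
Local Notation C := (cplx R).
Local Notation Cn := 'rV[cplx R]_n.
Implicit Types (Omega : set Cn) (p q w v : Cn).

Lemma addr_toC0 p v : p + toC 0 *: v = p.
Proof. by rewrite (_ : toC 0 = 0 :> C) // scale0r addr0. Qed.

Lemma closure_segment Omega p q (x : R) : segment_convex Omega -> 0 <= x <= 1 ->
  closure Omega p -> closure Omega q -> closure Omega (p + toC x *: (q - p)).
Proof.
move=> cO /andP[x0 x1] cp cq B /nbhs_rowP [e e0 HB].
have [p' [Op' pp]] := cp _ (@row_nbhs R n p [set y | forall i, modulus (y 0 i - p 0 i) < e]
  e e0 (fun y hy => hy)).
have [q' [Oq' qq]] := cq _ (@row_nbhs R n q [set y | forall i, modulus (y 0 i - q 0 i) < e]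
  e e0 (fun y hy => hy)).
exists (toC (1 - x) *: p' + toC x *: q'); split; first by apply: cO; rewrite // x0.
apply: HB => i.
have -> : (toC (1 - x) *: p' + toC x *: q') 0 i - (p + toC x *: (q - p)) 0 i =
    toC (1 - x) * (p' 0 i - p 0 i) + toC x * (q' 0 i - q 0 i).
  have -> : toC (1 - x) = 1 - toC x :> C.
    by apply: complex_eqP; rewrite ?cReB ?cImB /= ?subr0.
  by rewrite !mxE; ring.
apply: le_lt_trans (ler_modulusD _ _) _; rewrite !modulusM !modulus_toC.
rewrite (ger0_norm x0) ger0_norm ?subr_ge0 //.
have := pp i; have := qq i; rewrite /=.
move: (modulus (p' 0 i - p 0 i)) (modulus (q' 0 i - q 0 i)) => u v hv hu.
have [->|xn0] := eqVneq x 0; first by lra.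
have xp : 0 < x by rewrite lt_neqAle eq_sym xn0.
have h1 : x * v < x * e by rewrite ltr_pM2l.
have h2 : (1 - x) * u <= (1 - x) * e by rewrite ler_wpM2l ?subr_ge0 // ltW.
lra.
Qed.

Lemma Re_lform_continuous (c p : Cn) :
  continuous (fun z : Cn => complex.Re (lform c (z - p))).
Proof.
move=> z A /nbhs_ballP [e /= e0 HA].
pose M := 1 + \sum_i modulus (c 0 i).
have M0 : 0 < M by rewrite ltr_pwDl // sumr_ge0 // => i _; exact: modulus_ge0.
apply: (@row_nbhs R n z _ (e / M)); first exact: divr_gt0.
move=> w hw; apply: HA; rewrite /ball /= -cReB -lformB; apply: le_lt_trans (normr_Re_le _) _.
have -> : z - p - (w - p) = z - w by rewrite opprB addrA subrK.
apply: (@le_lt_trans _ _ (\sum_i modulus (c 0 i) * (e / M))).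
  rewrite /lform; elim/big_ind2 : _ => [|x y x' y' h h'|i _].
  - by rewrite modulus0.
  - by apply: le_trans (ler_modulusD _ _) _; rewrite lerD.
  - rewrite modulusM ler_wpM2l ?modulus_ge0 // !mxE modulusB; exact/ltW/hw.
rewrite -mulr_suml mulrC -[ltRHS](divfK (lt0r_neq0 M0)) ltr_pM2l ?divr_gt0 //.
by rewrite /M ltrDr.
Qed.

Lemma cvg_row_line (u : nat -> R) p v : u @ \oo --> 0 ->
  (fun k => p + toC (u k) *: v) @ \oo --> p.
Proof.
move=> u0 A /(nbhs_plane v 0) [r r0 H].
move/cvgrPdist_lt: u0 => /(_ r r0) [N _ HN]; exists N => // k Nk.
have := HN k Nk; rewrite /= sub0r normrN => uk.
by have := H (u k) 0 uk; rewrite normr0 scaler0 addr0; apply.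
Qed.

Lemma relatively_compact_far Omega (K : set Cn) (c p : Cn) :
  (forall z, Omega z -> 0 < complex.Re (lform c (z - p))) ->
  relatively_compact_in Omega K -> K !=set0 ->
  exists2 d : R, 0 < d & forall z, K z -> d <= complex.Re (lform c (z - p)).
Proof.
move=> lpos [cK KO] [z0 Kz0].
have K0 : closure K !=set0 by exists z0; exact: subset_closure.
have cf : {within closure K, continuous (fun z => complex.Re (lform c (z - p)))}.
  by apply: continuous_subspaceT; exact: Re_lform_continuous.
have [z Kz Hz] := @compact_EVT_min _ R _ _ K0 cK cf.
exists (complex.Re (lform c (z - p))).
  by move: Kz; rewrite ?inE => Kz; apply: lpos; exact: KO.
by move=> w Kw; apply: Hz; rewrite ?inE; exact: subset_closure.
Qed.

(** The function [Re c (z - p)] measures the escape: it is bounded below by a positive constant on a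
    compact part of [Omega], but tends to [0] uniformly along the curves. *)
Lemma escaping_geodesics_not_visible Omega (c p q : Cn) (lambda : R)
    (gamma : nat -> R -> Cn) (d : nat -> R) :
  (forall z, Omega z -> 0 < complex.Re (lform c (z - p))) ->
  boundary Omega q -> q != p -> 1 <= lambda ->
  (forall j, almost_geodesic Omega lambda 0 (gamma j)) ->
  (fun j => gamma j 0) @ \oo --> p -> (fun j => gamma j 1) @ \oo --> q ->
  (forall j t, 0 <= t <= 1 -> complex.Re (lform c (gamma j t - p)) <= d j) ->
  d @ \oo --> 0 -> ~ visible_point Omega p.
Proof.
move=> lpos bq qp l1 geo g0 g1 gd d0 [_ vis].
have [Up [Uq [K [nUp nUq rcK HK]]]] := vis q bq qp lambda 0 l1 (lexx 0).
have gin j t : 0 <= t <= 1 -> Omega (gamma j t) by case: (geo j) => _ + _; exact.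
have h0 : 0 <= (0 : R) <= 1 by rewrite lexx ler01.
have h1 : 0 <= (1 : R) <= 1 by rewrite lexx ler01.
have [N0 _ HN0] := g0 _ nUp; have [N1 _ HN1] := g1 _ nUq.
have hit j : (N0 + N1 <= j)%N -> exists t, 0 <= t <= 1 /\ K (gamma j t).
  move=> Nj; have i0 : (N0 <= j)%N := leq_trans (leq_addr _ _) Nj.
  have i1 : (N1 <= j)%N := leq_trans (leq_addl _ _) Nj.
  exact: (HK (gamma j) (geo j) (conj (gin j 0 h0) (HN0 j i0))
    (conj (gin j 1 h1) (HN1 j i1))).
have K0 : K !=set0.
  by have [t [_ Kt]] := hit _ (leqnn _); exists (gamma (N0 + N1)%N t).
have [e e0 He] := relatively_compact_far lpos rcK K0.
have /cvgrPdist_lt /(_ e e0) [N2 _ HN2] := d0.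
pose j := (N0 + N1 + N2)%N.
have [t [ht Kt]] := hit j (leq_addr _ _).
have := HN2 j (leq_addl _ _); rewrite /= sub0r normrN.
have := gd j t ht; have := He _ Kt; have := ler_norm (d j); lra.
Qed.

Lemma boundary_dist_ge0 Omega z : (0 <= boundary_dist Omega z)%E.
Proof. by apply: le_ereal_inf_tmp => _ [w _ <-]; rewrite lee_fin sqrtr_ge0. Qed.

Lemma boundary_dist_cvg0 Omega (gamma : nat -> R -> Cn) (d : nat -> R) :
  (forall j t, 0 <= t <= 1 -> (boundary_dist Omega (gamma j t) <= (d j)%:E)%E) ->
  d @ \oo --> 0 ->
  (fun j => ereal_sup [set boundary_dist Omega (gamma j t) | t in `[0, 1]]) @ \oo
    --> 0%E.
Proof.
move=> gd d0.
apply: (@squeeze_cvge _ _ _ _ (fun=> 0%E) _ (fun j => (d j)%:E)).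
- near=> j; apply/andP; split.
    apply: (@le_trans _ _ (boundary_dist Omega (gamma j 0))).
      exact: boundary_dist_ge0.
    by apply: ereal_sup_ubound; exists 0 => //; rewrite /= in_itv /= lexx ler01.
  by apply: ge_ereal_sup => _ [t /= + <-]; rewrite in_itv /=; exact: gd.
- exact: cvg_cst.
- by apply: cvg_EFin; [near=> j|exact: d0].
Unshelve. all: by end_near. Qed.

End BoundaryBehaviour.

Lemma cvg_lev {R : realType} (r0 : R) : (fun k => lev r0 k) @ \oo --> 0.
Proof.
rewrite -[X in _ --> X](mulr0 r0); apply: cvgM; first exact: cvg_cst.
by apply: cvg_expr; rewrite ger0_norm // invf_lt1 // ltr1n.
Qed.

Lemma cvg_lev_addn {R : realType} (r0 : R) (m : nat -> nat) : 0 < r0 ->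
  (fun k => lev r0 (k + m k)%N) @ \oo --> 0.
Proof.
move=> r00; apply: (@squeeze_cvgr _ _ _ _ (fun=> 0) (fun k => lev r0 k)).
- by near=> k; rewrite ltW ?lev_gt0 //= lev_le // leq_addr.
- exact: cvg_cst.
- exact: cvg_lev.
Unshelve. all: by end_near. Qed.

Section CurveEndpoints.
Context {R : realType} {n : nat}.
Local Notation C := (cplx R).
Local Notation Cn := 'rV[cplx R]_n.
Variables (Omega : set Cn) (p q eta c : Cn).
Variables (r0 : R) (a : nat -> R) (j m : nat).
Hypotheses (r0_gt0 : 0 < r0) (a_ge0 : forall k, 0 <= a k) (m_gt0 : (0 < m)%N).
Hypothesis total_big : 1 / 2 <= total r0 a j m.

Lemma curve0 : curve p q eta r0 a j m 0 = p + toC (lev r0 j) *: eta.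
Proof. by rewrite /curve rad0 drift0; exact: addr_toC0. Qed.

Lemma curve1 : curve p q eta r0 a j m 1 =
  p + toC (1 / 2) *: (q - p) + toC (lev r0 (j + m)) *: eta.
Proof.
by rewrite /curve (rad1 _ _ r0_gt0) (drift1 r0_gt0 total_big) addrAC.
Qed.

Lemma rad_lev t : 0 <= t -> 0 < rad r0 j m t <= lev r0 j.
Proof.
by move=> t0; rewrite (rad_gt0 _ _ r0_gt0) -(rad0 r0 j m) (rad_le _ r0_gt0 m_gt0 t0).
Qed.

Lemma Re_lform_curve_le t : lform c eta = 1 -> lform c (q - p) = 0 -> 0 <= t ->
  complex.Re (lform c (curve p q eta r0 a j m t - p)) <= lev r0 j.
Proof. by move=> ce ct /rad_lev /andP[_ rl]; rewrite lform_curve. Qed.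

Lemma curve_boundary_dist t :
  (forall x, 0 <= x <= 1 -> boundary Omega (p + toC x *: (q - p))) ->
  enorm eta = 1 -> 0 <= t <= 1 ->
  (boundary_dist Omega (curve p q eta r0 a j m t) <= (lev r0 j)%:E)%E.
Proof.
move=> bdry eta1 ht; have t0 : 0 <= t by case/andP: ht.
have /andP[rp rl] := rad_lev t0.
have /andP[x0 x2] := drift01 r0_gt0 a_ge0 m_gt0 total_big ht.
have hx : 0 <= drift r0 a j m t <= 1 by rewrite x0; lra.
apply: (@le_trans _ _ (rad r0 j m t)%:E); last by rewrite lee_fin.
apply: ereal_inf_lbound.
exists (p + toC (drift r0 a j m t) *: (q - p)); first exact: bdry.
rewrite /curve (addrAC p) (addrAC _ (toC _ *: eta)) subrr add0r enormZ eta1 mulr1.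
by rewrite gtr0_norm.
Qed.

End CurveEndpoints.

Theorem theorem17 (R : realType) (Omega : set 'rV[cplx R]_2)
    (p : 'rV[cplx R]_2) :
  convex_domain Omega ->
  ~ contains_complex_line Omega ->
  C1_boundary Omega ->
  boundary Omega p ->
  strongly_non_goldilocks Omega p ->
  multiface Omega p <> [set p] ->
  ~ visible_point Omega p /\
  exists lambda : R, 1 < lambda /\
    exists gamma : nat -> R -> 'rV[cplx R]_2,
      [/\ forall j, almost_geodesic Omega lambda 0 (gamma j),
          (fun j => ereal_sup [set boundary_dist Omega (gamma j t) |
             t in `[0, 1]]) @ \oo --> 0%E,
          (fun j => gamma j 0) @ \oo --> p
        & ~ ((fun j => gamma j 1) @ \oo --> p)].
Proof.
move=> [[oO nO _] /convex_set_segment cO] _ _ bp [C1p nwG] mf.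
have [_ [U [rho ldf]]] := C1p.
pose eta := - (toC (enorm (grad rho p))^-1 *: grad rho p).
have neta : inner_unit_normal Omega p eta by exists U, rho.
have [eta1 ceta lpos l_in] := supporting_functional oO cO nO bp neta.
have [q [qp bq cqp]] := multiface_tangent oO cO nO bp neta mf.
set c := conj_row eta in ceta lpos l_in cqp.
have cp : closure Omega p by case: bp.
have cq : closure Omega q by case: bq.
have tau0 : q - p != 0 by rewrite subr_eq0.
have [k0 [R0 [k00 R00 ptin tang]]] :=
  disc_at_tangential oO cO cp ceta eta1 lpos l_in cqp tau0.
have [k1 [t1 [k10 t10 norm]]] := disc_at_normal cO ceta l_in eta.
(* The first bound is required for moving discs along the face, the second for the discs along
   [eta]. *)
pose r0 := Order.min (R0 / 4) t1.
have r00 : 0 < r0 by rewrite lt_min divr_gt0.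
have [r0R r0t] : r0 <= R0 / 4 /\ r0 <= t1 by rewrite !ge_min !lexx orbT.
have ptin0 (r : R) : 0 < r <= r0 -> Omega (p + toC r *: eta).
  by move=> /andP[rp rr]; apply: ptin; rewrite rp; lra.
have [b [b01 bsum bdisc]] := goldilocks_dyadic C1p neta eta1 r00 ptin0 nwG.
(* A disc of size [b k / 2] in some direction, at a radius at most [lev r0 k], becomes one of this
   size along [tau] at radius [lev r0 k]. *)
pose a k := k0 * (b k / 2).
have a_ge0 k : 0 <= a k by case/andP: (b01 k) => b0 _; rewrite !mulr_ge0 // ltW.
have disc_tau k : disc_at Omega (p + toC (lev r0 k) *: eta) (toC (a k) *: (q - p)).
  have lk : 0 < lev r0 k <= r0.
    by rewrite lev_gt0 //= -[leRHS]mulr1 -(expr0 (2^-1)) lev_le.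
  (* For [b k = 0] no disc is supplied; a constant one serves. *)
  have [bk|bk] := eqVneq (b k) 0.
    rewrite /a bk mul0r mulr0 (_ : toC 0 = 0 :> cplx R) // scale0r.
    exact/disc_at0/ptin0.
  have bk0 : 0 < b k by rewrite lt_neqAle eq_sym bk; case/andP: (b01 k).
  have [r' [v [hr' v1 D]]] := bdisc k bk0.
  apply: (tang _ r' _ v) => //; last by rewrite divr_gt0.
  by case/andP: lk => l0 lr; lra.
have disc_eta (r : R) : 0 < r <= r0 ->
    disc_at Omega (p + toC r *: eta) (toC (k1 * r) *: eta).
  by move=> /andP[rp rr]; apply: norm; rewrite rp (le_trans rr).
(* Divergence makes the layers after the [j]-th sum to more than [1], once [a j], lost in
   [total_ge], is paid for; then [total] exceeds [3 / 5]. *)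
have long j : exists m, (0 < m)%N /\ 1 / 2 <= total r0 a j m.
  have [K HK] := bsum ((\sum_(k < j) a k + a j + 1) * (2 / k0)).
  have aK : \sum_(k < j) a k + a j + 1 < \sum_(k < K) a k.
    have aE : \sum_(k < K) a k = (\sum_(k < K) b k) * (k0 / 2).
      by rewrite mulr_suml; apply: eq_bigr => i _; rewrite /a; ring.
    rewrite aE; move: (\sum_(k < j) a k + a j + 1) HK => x HK.
    have -> : x = x * (2 / k0) * (k0 / 2) by field; rewrite gt_eqF.
    by rewrite ltr_pM2r // divr_gt0.
  have jK : (j < K)%N.
    rewrite ltnNge; apply/negP => Kj; move: aK; rewrite -(subnKC Kj) big_split_ord /=.
    have : 0 <= \sum_(i < j - K) a (K + i)%N by apply: sumr_ge0.
    have := a_ge0 (K + (j - K))%N; lra.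
  have [l lE] : exists l, K = (j + l)%N by exists (K - j)%N; rewrite subnKC // ltnW.
  have l0 : (0 < l)%N by move: jK; rewrite lE -{1}(addn0 j) ltn_add2l.
  exists l; split=> //; have := total_ge j r00 a_ge0 l0; apply: le_trans.
  move: aK; rewrite lE big_split_ord /=.
  by move: (\sum_(i < l) _) (\sum_(k < j) _) => *; lra.
have [m Hm] := choice long.
have m0 j : (0 < m j)%N by case: (Hm j).
have tot j : 1 / 2 <= total r0 a j (m j) by case: (Hm j).
pose gamma j := curve p q eta r0 a j (m j).
pose lambda : R := 16 / geodesic_gap k1.
have gap0 : 0 < geodesic_gap k1 by exact: geodesic_gap_gt0.
have lambda1 : 1 < lambda.
  rewrite ltr_pdivlMr // mul1r; apply: (@le_lt_trans _ _ (1 / 96)); last lra.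
  by rewrite ge_min lexx.
have geo j : almost_geodesic Omega lambda 0 (gamma j).
  exact: (curve_geodesic oO cO cp cq ceta lpos cqp R00 ptin r00 r0R k10 a_ge0
    (m0 j) disc_tau disc_eta (tot j)).
have gam0 : (fun j => gamma j 0) @ \oo --> p.
  rewrite (_ : (fun j => gamma j 0) = (fun j => p + toC (lev r0 j) *: eta)).
    exact/cvg_row_line/cvg_lev.
  by apply/funext => j; exact: curve0.
(* The curves end near the midpoint of the segment, so the pair that fails to be visible is [p] and
   [q'], not [p] and [q]. *)
pose q' := p + toC (1 / 2) *: (q - p).
have gam1 : (fun j => gamma j 1) @ \oo --> q'.
  rewrite (_ : (fun j => gamma j 1) =
      (fun j => q' + toC (lev r0 (j + m j)) *: eta)).
    exact/cvg_row_line/cvg_lev_addn.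
  by apply/funext => j; exact: (curve1 p q eta r00 (tot j)).
have q'p : q' != p.
  rewrite /q' -subr_eq0 addrAC subrr add0r scaler_eq0 (negPf tau0) orbF.
  by apply: toC_neq0; rewrite gt_eqF // divr_gt0.
have bdry (x : R) : 0 <= x <= 1 -> boundary Omega (p + toC x *: (q - p)).
  move=> hx; split; first exact: closure_segment.
  move=> /interior_subset /lpos.
  by rewrite addrAC subrr add0r lformZ cqp mulr0 ltxx.
have ngam1 : ~ ((fun j => gamma j 1) @ \oo --> p).
  by move=> g1; move/eqP: q'p; apply; exact: (cvg_unique _ gam1 g1).
split.
  apply: (escaping_geodesics_not_visible lpos (bdry _ _) q'p (ltW lambda1) geo gam0 gam1
    _ (cvg_lev r0)); first by apply/andP; split; lra.
  by move=> j t /andP[t0 _]; exact: (Re_lform_curve_le a j r00 (m0 j) ceta cqp t0).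
exists lambda; split; first exact: lambda1.
exists gamma.
split; [exact: geo| |exact: gam0|exact: ngam1].
apply: (boundary_dist_cvg0 _ (cvg_lev r0)) => j t ht.
exact: (curve_boundary_dist r00 a_ge0 (m0 j) (tot j) bdry eta1 ht).
Qed.
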